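(* Let $d=2$, fix $\nu,\alpha>0$, and assume that the mean-zero scalar function $\omega_0$ belongs to $\mathcal{D}(e^{\tau_0\Lambda^{1/s}})$ for some $s\ge1$ and $\tau_0>0$. Then there exists a unique global in time Gevrey-class $s$ solution $\omega(t)$ of $$\partial_t\omega-\nu\Delta(I-\alpha^2\Delta)^{-1}\omega+(u\cdot\nabla)\omega=0,\qquad u=\mathcal{K}_\alpha\omega,\qquad \omega(0,x)=\omega_0(x)$$ on $\mathbb{T}^2\times(0,\infty)$, such that for all $t\ge0$ we have $\omega(t)\in\mathcal{D}(e^{\tau(t)\Lambda^{1/s}})$, and moreover $$\tau(t)\ \ge\ \tau_0\exp\Big(-\frac{CM_0}{\alpha}\int_0^te^{-\nu\sigma/(2+2\alpha^2)}\,d\sigma\Big)\ \ge\ \tau_0\exp\Big(-\frac{C(2+2\alpha^2)M_0}{\alpha\nu}\Big),$$ where $M_0=\|e^{\tau_0\Lambda^{1/s}}\omega_0\|_{L^2}$ and $C$ is a universal constant.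
   Context: $\mathbb{T}^2=[0,2\pi]^2$ is the periodic torus; all functions are mean-free. The equation is the vorticity form of the two-dimensional second-grade fluid equations, with $\omega=\operatorname{curl}(u-\alpha^2\Delta u)$ (a scalar). The velocity $u=\mathcal{K}_\alpha\omega$ is obtained by solving $\operatorname{div}u=0$, $\operatorname{curl}u=\partial_1u_2-\partial_2u_1=(I-\alpha^2\Delta)^{-1}\omega$, $\int_{\mathbb{T}^2}u=0$. $\Lambda=(-\Delta)^{1/2}$, and $\mathcal{D}(\Lambda^re^{\tau\Lambda^{1/s}})$ is the set of mean-free $v$ with $\|\Lambda^re^{\tau\Lambda^{1/s}}v\|_{L^2}^2=(2\pi)^2\sum_k|k|^{2r}e^{2\tau|k|^{1/s}}|\hat v_k|^2<\infty$. A function is of Gevrey-class $s$ ($s\ge1$) if it lies in $\bigcup_{\tau>0}\mathcal{D}(\Lambda^re^{\tau\Lambda^{1/s}})$ for some (equivalently any) $r\ge0$. *)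

(* Defs.v *)
From HB Require Import structures.
From mathcomp Require Import all_boot all_order all_algebra.
From mathcomp Require Import all_classical all_reals all_analysis.

Set Implicit Arguments.
Unset Strict Implicit.
Unset Printing Implicit Defensive.

Import Order.TTheory GRing.Theory Num.Theory numFieldNormedType.Exports.
Local Open Scope classical_set_scope.
Local Open Scope ring_scope.

(* A function on the torus [0, 2 pi]^2 is a function on the plane R * R that is
   2 pi-periodic in each coordinate; it is integrated over the closed square. *)
Definition periodic (R : realType) (v : R * R -> R) : Prop :=
  forall x y : R, v (x + 2 * pi, y) = v (x, y) /\ v (x, y + 2 * pi) = v (x, y).

Definition square (R : realType) : set (R * R) :=
  `[0, 2 * pi] `*` `[0, 2 * pi].
Arguments square R : clear implicits.

Notation leb R := (@lebesgue_measure R) (only parsing).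
Notation leb2 R := (leb R \x leb R)%E (only parsing).

Definition torus_int (R : realType) (v : R * R -> R) : R :=
  \int[leb2 R]_(z in square R) v z.

Definition square_integrable (R : realType) (v : R * R -> R) : Prop :=
  measurable_fun [set: R * R] v /\
  (leb2 R).-integrable (square R) (fun z => (v z ^+ 2)%:E).

Definition mean_free (R : realType) (v : R * R -> R) : Prop :=
  torus_int v = 0.

(* Real and imaginary parts of
   hat v_k = (2 pi)^-2 int_{[0, 2 pi]^2} v(x) e^{- i k.x} dx. *)
Definition phase (R : realType) (k : int * int) (z : R * R) : R :=
  k.1%:~R * z.1 + k.2%:~R * z.2.

Definition fourier_re (R : realType) (v : R * R -> R) (k : int * int) : R :=
  (2 * pi) ^- 2 * torus_int (fun z => v z * cos (phase k z)).

Definition fourier_im (R : realType) (v : R * R -> R) (k : int * int) : R :=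
  - ((2 * pi) ^- 2 * torus_int (fun z => v z * sin (phase k z))).

Definition fourier_sq (R : realType) (v : R * R -> R) (k : int * int) : R :=
  fourier_re v k ^+ 2 + fourier_im v k ^+ 2.

Definition freq_norm (R : realType) (k : int * int) : R :=
  Num.sqrt (k.1%:~R ^+ 2 + k.2%:~R ^+ 2).

(* || Lambda^r e^{tau Lambda^{1/s}} v ||_{L^2}^2.  Mind that 0 `^ 0 = 1; the
   mode k = 0 is irrelevant, since it vanishes for mean-free v. *)
Definition gevrey_sqnorm (R : realType) (r tau s : R) (v : R * R -> R) : \bar R :=
  (((2 * pi) ^+ 2)%:E *
   \esum_(k in [set: int * int])
     (freq_norm R k `^ (2 * r) * expR (2 * tau * freq_norm R k `^ s^-1)
        * fourier_sq v k)%:E)%E.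

(* Finite (hence meaningful) only on [gevrey_dom r tau s]. *)
Definition gevrey_norm (R : realType) (r tau s : R) (v : R * R -> R) : R :=
  Num.sqrt (fine (gevrey_sqnorm r tau s v)).

(* v belongs to D(Lambda^r e^{tau Lambda^{1/s}}). *)
Definition gevrey_dom (R : realType) (r tau s : R) (v : R * R -> R) : Prop :=
  [/\ periodic v, square_integrable v, mean_free v
    & (gevrey_sqnorm r tau s v < +oo)%E].

Definition gevrey_class (R : realType) (s : R) (v : R * R -> R) : Prop :=
  exists r tau : R, [/\ 0 <= r, 0 < tau & gevrey_dom r tau s v].

Definition d1 (R : realType) (v : R * R -> R) (z : R * R) : R :=
  'D_((1, 0) : R * R) v z.

Definition d2 (R : realType) (v : R * R -> R) (z : R * R) : R :=
  'D_((0, 1) : R * R) v z.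

Definition laplacian (R : realType) (v : R * R -> R) (z : R * R) : R :=
  d1 (d1 v) z + d2 (d2 v) z.

Definition C1 (R : realType) (v : R * R -> R) : Prop :=
  [/\ forall z, derivable v z ((1, 0) : R * R),
      forall z, derivable v z ((0, 1) : R * R),
      continuous (d1 v) & continuous (d2 v)].

Definition C2 (R : realType) (v : R * R -> R) : Prop :=
  [/\ C1 v, C1 (d1 v) & C1 (d2 v)].

(* phi = (I - alpha^2 Delta)^{-1} w on the torus. *)
Definition helmholtz_inverse (R : realType) (alpha : R) (w phi : R * R -> R)
    : Prop :=
  [/\ periodic phi, mean_free phi, C2 phi
    & forall z, phi z - alpha ^+ 2 * laplacian phi z = w z].

(* (u1, u2) = K_alpha w, in terms of phi = (I - alpha^2 Delta)^{-1} w. *)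
Definition velocity (R : realType) (phi u1 u2 : R * R -> R) : Prop :=
  [/\ periodic u1 /\ periodic u2,
      mean_free u1 /\ mean_free u2,
      C1 u1 /\ C1 u2,
      forall z, d1 u1 z + d2 u2 z = 0
    & forall z, d1 u2 z - d2 u1 z = phi z].

Definition dt (R : realType) (w : R -> R * R -> R) (t : R) (z : R * R) : R :=
  derive1 (fun sigma => w sigma z) t.

(* The regularity required in (t, x) is that of a classical solution: continuous
   for t >= 0 and C^1 for t > 0, jointly in time and space.  Values w t with
   t < 0 are irrelevant. *)
Definition classical_regularity (R : realType) (w : R -> R * R -> R) : Prop :=
  [/\ {within [set p : R * (R * R) | 0 <= p.1],
         continuous (fun p : R * (R * R) => w p.1 p.2)},
      forall t z, 0 < t ->
        [/\ derivable (fun sigma => w sigma z) t 1,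
            derivable (w t) z ((1, 0) : R * R)
          & derivable (w t) z ((0, 1) : R * R)]
    & forall t z, 0 < t ->
        [/\ {for (t, z), continuous (fun p : R * (R * R) => dt w p.1 p.2)},
            {for (t, z), continuous (fun p : R * (R * R) => d1 (w p.1) p.2)}
          & {for (t, z), continuous (fun p : R * (R * R) => d2 (w p.1) p.2)}]].

(* The datum w0 is an element of L^2, defined up to a null set only, hence the
   almost-everywhere equality at t = 0. *)
Definition gevrey_solution (R : realType) (nu alpha s : R) (w0 : R * R -> R)
    (w : R -> R * R -> R) : Prop :=
  [/\ forall t, 0 <= t -> gevrey_class s (w t),
      classical_regularity w,
      w 0 = w0 %[ae leb2 R]
    & forall t, 0 < t -> exists phi u1 u2 : R * R -> R,
        [/\ helmholtz_inverse alpha (w t) phi,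
            velocity phi u1 u2
          & forall z, dt w t z - nu * laplacian phi z
                      + (u1 z * d1 (w t) z + u2 z * d2 (w t) z) = 0]].

(* Main.v *)
Require Import Defs.
From HB Require Import structures.
From mathcomp Require Import all_boot all_order all_algebra.
From mathcomp Require Import all_classical all_reals all_analysis.
From mathcomp Require Import measurable_realfun.
From mathcomp Require Import ring lra zify.
Set Implicit Arguments.
Unset Strict Implicit.
Unset Printing Implicit Defensive.
Import Order.TTheory GRing.Theory Num.Theory numFieldNormedType.Exports.
Local Open Scope classical_set_scope.
Local Open Scope ring_scope.

Definition ultra_nat : set_system nat :=
  sval (cid (ultraFilterLemma (@eventually_filter))).

Instance ultra_nat_ultra : UltraFilter ultra_nat.
Proof. by rewrite /ultra_nat; case: cid => G []. Qed.

Lemma ultra_nat_oo : \oo `<=` ultra_nat.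
Proof. by rewrite /ultra_nat; case: cid => G []. Qed.

Lemma cvg_ultra_nat (T : topologicalType) (u : nat -> T) (l : T) :
  u @ \oo --> l -> u @ ultra_nat --> l.
Proof. by move=> ul A /ul; exact: ultra_nat_oo. Qed.

Lemma ultra_fmap (T U : Type) (f : T -> U) (F : set_system T) :
  UltraFilter F -> UltraFilter (f @ F).
Proof.
move=> FU; constructor; first exact: fmap_proper_filter.
move=> G GF FG; apply/seteqP; split => A; last exact: FG.
move=> GA; have [//|] := in_ultra_setVsetC (f @^-1` A) FU.
move=> /(FG (~` A)) GCA; have : G set0 by rewrite -(setICr A); exact: filterI.
by move=> G0; case: (@filter_not_empty _ G _ G0).
Qed.

Definition ulim {R : realType} (u : nat -> R) : R := lim (u @ ultra_nat).

Lemma ulim_cvg (R : realType) (M : R) (u : nat -> R) :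
  (forall n, `|u n| <= M) -> u @ ultra_nat --> ulim u.
Proof.
move=> uM; have : compact (`[- M, M] : set R) by exact: segment_compact.
rewrite compact_ultra => cM.
case: (cM (u @ ultra_nat) (ultra_fmap u ultra_nat_ultra)).
  by apply: (@filterE _ ultra_nat) => n; rewrite /= in_itv /= -ler_norml.
by move=> x [_ ux]; apply/cvg_ex; exists x.
Qed.

Lemma ulim_eq (R : realType) (u : nat -> R) (l : R) :
  u @ ultra_nat --> l -> ulim u = l.
Proof. by move=> ul; exact/cvg_lim. Qed.

Lemma ulim_le (R : realType) (u v : nat -> R) (a b : R) :
  u @ ultra_nat --> a -> v @ ultra_nat --> b -> (forall n, u n <= v n) ->
  a <= b.
Proof. by move=> ua vb uv; apply: (ler_cvg_to ua vb); exact: nearW. Qed.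

Lemma ulim_norm_le (R : realType) (u : nat -> R) (a M : R) :
  u @ ultra_nat --> a -> (forall n, `|u n| <= M) -> `|a| <= M.
Proof.
by move=> ua uM; apply: (ulim_le (cvg_norm ua) (@cvg_cst _ M _ _ _)) => n.
Qed.

Lemma cvg_sumr (R : realType) (T I : Type) (F : set_system T) (FF : Filter F)
    (s : seq I) (f : I -> T -> R) (l : I -> R) :
  (forall j, f j @ F --> l j) ->
  (fun n => \sum_(j <- s) f j n) @ F --> \sum_(j <- s) l j.
Proof.
move=> fl; elim: s => [|j s IH].
  rewrite big_nil (_ : (fun n => _) = cst 0); first exact: cvg_cst.
  by apply/funext => n; rewrite big_nil.
rewrite big_cons (_ : (fun n => _) = f j \+ (fun n => \sum_(i <- s) f i n)).
  by apply: cvgD.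
by apply/funext => n; rewrite big_cons.
Qed.

(** A quadratic remainder is how all derivatives below are computed: unlike a
    limit of difference quotients, it survives a pointwise limit. *)
Lemma is_derive_quadratic (R : realType) (F : R -> R) (x G K e : R) :
  0 < e ->
  (forall y, `|y - x| < e -> `|F y - F x - (y - x) * G| <= K * (y - x) ^+ 2) ->
  is_derive x 1 F G.
Proof.
move=> e0 FK.
have K0 : 0 <= K.
  have := FK (x + e / 2); rewrite addrAC subrr add0r gtr0_norm ?divr_gt0//.
  rewrite ltr_pdivrMr // ltr_pMr // ltr1n => /(_ isT).
  move/(le_trans (normr_ge0 _)); rewrite pmulr_lge0 //.
  by rewrite exprn_gt0 // divr_gt0.
have H : (fun h => h^-1 *: ((F \o shift x) (h *: 1) - F x)) @ 0^' --> G.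
  apply/cvgrPdist_le => eps eps0.
  near=> h.
  have h0 : h != 0 by near: h; exact: nbhs_dnbhs_neq.
  have -> : G - h^-1 *: ((F \o shift x) (h *: 1) - F x) =
     - (h^-1 * (F (h + x) - F x - h * G)).
    rewrite /shift /= -[h *: 1]/(h * 1) mulr1.
    rewrite -[h^-1 *: (_ - _)]/(h^-1 * (F (h + x) - F x)).
    by field.
  rewrite normrN normrM normfV ler_pdivrMl ?normr_gt0//.
  have := FK (h + x); rewrite addrK => /(_ _)/le_trans -> //.
    by near: h; apply: dnbhs0_lt.
  have hK : `|h| * (K + 1) <= eps.
    rewrite -ler_pdivlMr ?ltr_wpDl // ltW //.
    by near: h; apply: dnbhs0_lt; rewrite divr_gt0 // ltr_wpDl.
  have := normr_ge0 h; rewrite -(real_normK (num_real h)).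
  by move: hK; set a := `|h| => *; nra.
by split; [apply/cvg_ex; exists G | exact/cvg_lim].
Unshelve. all: by end_near. Qed.

Lemma MVT_derive (R : realType) (f df : R -> R) (a b : R) : a <= b ->
  (forall x, a <= x <= b -> is_derive x 1 f (df x)) ->
  exists2 c, a <= c <= b & f b - f a = df c * (b - a).
Proof.
move=> ab fdf; case: (@MVT_segment R f df a b ab) => [x||c].
- by rewrite in_itv /= => /andP[ax xb]; apply: fdf; rewrite !ltW.
- apply: derivable_within_continuous => x; rewrite in_itv /=.
  by move=> /fdf/@ex_derive.
- by rewrite in_itv /= => cab ->; exists c.
Qed.

Lemma is_derive_lim (R : realType) (U : set_system nat) (UF : ProperFilter U)
    (f g : nat -> R -> R) (F : R -> R) (G x K e : R) :
  0 < e ->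
  (forall n y, `|y - x| < e -> is_derive y 1 (f n) (g n y)) ->
  (forall n y, `|y - x| < e -> `|g n y - g n x| <= K * `|y - x|) ->
  (forall y, `|y - x| < e -> f n y @[n --> U] --> F y) ->
  g n x @[n --> U] --> G ->
  is_derive x 1 F G.
Proof.
move=> e0 fg gK fF gG; apply: (is_derive_quadratic (K := K) e0) => y yx.
have K0 : 0 <= K.
  have := gK 0%N (x + e / 2); rewrite addrAC subrr add0r gtr0_norm ?divr_gt0//.
  rewrite ltr_pdivrMr // ltr_pMr // ltr1n => /(_ isT).
  by move/(le_trans (normr_ge0 _)); rewrite pmulr_lge0 // divr_gt0.
have quad n : `|f n y - f n x - (y - x) * g n x| <= K * (y - x) ^+ 2.
  have [c [cx ->]] : exists c, `|c - x| <= `|y - x| /\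
      f n y - f n x = g n c * (y - x).
    have [xy|/ltW xy] := leP x y.
      have [c|c cxy ->] := @MVT_derive R (f n) (g n) x y xy.
        by move=> cxy; apply: fg; move: yx; rewrite !ltr_norml; lra.
      by exists c; split=> //; rewrite !ger0_norm ?subr_ge0 //; lra.
    have [c|c cxy fE] := @MVT_derive R (f n) (g n) y x xy.
      by move=> cxy; apply: fg; move: yx; rewrite !ltr_norml; lra.
    exists c; split; first by rewrite !ler0_norm ?subr_le0 //; lra.
    by apply: oppr_inj; rewrite opprB fE; ring.
  rewrite mulrC -mulrBr normrM -(real_normK (num_real (y - x))) expr2.
  rewrite mulrA [leRHS]mulrC ler_wpM2l //.
  by apply: le_trans (gK n c _) _; [exact: le_lt_trans yx | rewrite ler_wpM2l].
have xx : `|x - x| < e by rewrite subrr normr0.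
have cl : (fun n => f n y - f n x - (y - x) * g n x) @ U -->
    F y - F x - (y - x) * G.
  by apply: cvgB; [apply: cvgB; exact: fF | exact: cvgMl_tmp].
apply: (ler_cvg_to (cvg_norm cl) (@cvg_cst _ _ _ _ _)).
exact: nearW.
Qed.

Lemma is_derive_sumr (R : realType) (V : normedModType R) (I : Type) (s : seq I)
    (f : I -> V -> R) (df : I -> R) (x v : V) :
  (forall i, is_derive x v (f i) (df i)) ->
  is_derive x v (fun y => \sum_(i <- s) f i y) (\sum_(i <- s) df i).
Proof.
move=> fdf; elim: s => [|i s IH].
  rewrite big_nil (_ : (fun n => _) = cst 0); first exact: is_derive_cst.
  by apply/funext => n; rewrite big_nil.
rewrite big_cons (_ : (fun n => _) = f i \+ (fun n => \sum_(j <- s) f j n)).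
  exact: is_deriveD.
by apply/funext => n; rewrite big_cons.
Qed.

Lemma is_derive_cvg (R : realType) (f : R -> R) (x d : R) :
  is_derive x 1 f d -> f @ x --> f x.
Proof.
by move=> /@ex_derive; rewrite derivable1_diffP => /differentiable_continuous.
Qed.

Lemma barrier (R : realType) (Q dQ : R -> R) (B B' : R) : B < B' -> Q 0 <= B ->
  (forall t : R, 0 <= t -> is_derive t 1 Q (dQ t)) ->
  (forall t, 0 <= t -> Q t < B' -> dQ t <= 0) ->
  forall t, 0 <= t -> Q t <= B.
Proof.
move=> BB' Q0 QdQ dQ0 t1 t10; rewrite leNgt; apply/negP => Qt1.
have Qc (t : R) : 0 <= t -> Q @ t --> Q t.
  by move=> /QdQ/is_derive_cvg.
pose S := [set t | 0 <= t <= t1 /\ Q t <= B].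
have S0 : S 0 by split; rewrite ?lexx.
have supS : has_sup S by split; [exists 0|exists t1 => t [/andP[]]].
pose t0 := sup S.
have t00 : 0 <= t0 by apply: sup_upper_bound.
have t01 : t0 <= t1 by apply: ge_sup => //; [exists 0|move=> t [/andP[]]].
have Qt0 : Q t0 <= B.
  rewrite leNgt; apply/negP => /(cvgr_gt _ (Qc _ t00)) /nbhs_ballP[e /= e0 eQ].
  have [t St] := sup_adherent e0 supS; rewrite -/t0 => tt0.
  have tt : t <= t0 by apply: sup_upper_bound.
  have /= : B < Q t by apply: eQ; rewrite /ball/= ger0_norm; lra.
  by case: St => _ Qt; rewrite ltNge Qt.
have {}t01 : t0 < t1 by rewrite lt_neqAle t01 andbT; apply: contraTneq Qt1 => <-; rewrite -leNgt.
have /(cvgr_lt _ (Qc _ t00)) /nbhs_ballP[e /= e0 eQ] := le_lt_trans Qt0 BB'.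
pose t2 := Num.min (t0 + e / 2) t1.
have t02 : t0 < t2 by rewrite lt_min t01 andbT ltrDl divr_gt0.
have t21 : t2 <= t1 by rewrite ge_min lexx orbT.
have t2e : t2 <= t0 + e / 2 by rewrite ge_min lexx.
have Qt2 : B < Q t2.
  rewrite ltNge; apply/negP => Qt2.
  have : t2 <= t0 by apply: sup_upper_bound => //; split=> //; lra.
  by rewrite leNgt t02.
have [c|c ct] := @MVT_derive R Q dQ t0 t2 (ltW t02).
  by move=> /andP[tc _]; apply: QdQ; exact: le_trans tc.
have : dQ c <= 0.
  apply: dQ0; first by lra.
  by apply: eQ; rewrite /ball/= ler0_norm; lra.
by nra.
Qed.

Section euler.
Variables (R : realType) (T : eqType) (r : seq T).
Variables (F : (T -> R) -> T -> R) (B L : R) (x0 : T -> R).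
Hypothesis FB : forall x i, `|F x i| <= B.
Hypothesis FL : forall x y i, `|F x i - F y i| <= L * \sum_(j <- r) `|x j - y j|.
Hypothesis L0 : 0 <= L.

Let euler (h : R) (n : nat) := iter n (fun x i => x i + h * F x i) x0.

Let B0 : x0 = x0 -> T -> 0 <= B.
Proof. by move=> _ i; apply: le_trans (FB x0 i). Qed.

Let eulerD h n m i : 0 <= h ->
  `|euler h (n + m) i - euler h n i| <= m%:R * h * B.
Proof.
move=> h0; elim: m => [|m IH]; first by rewrite addn0 subrr normr0 !mul0r.
rewrite addnS /= -/(euler h _) addrAC; apply: le_trans (ler_normD _ _) _.
rewrite -natr1 !mulrDl mul1r lerD // normrM ger0_norm // ler_wpM2l //.
Qed.

Let C := L * ((size r)%:R * B).

Let eulerT h n m i : 0 <= h ->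
  `|euler h (n + m) i - euler h n i - m%:R * h * F (euler h n) i| <=
    C * (m%:R * h) ^+ 2.
Proof.
move=> h0; have B0i := B0 erefl i; have C0 : 0 <= C by rewrite !mulr_ge0.
elim: m => [|m IH]; first by rewrite addn0 !(subrr, mul0r) normr0 expr0n mulr0.
rewrite addnS /= -/(euler h _).
have -> : euler h (n + m) i + h * F (euler h (n + m)) i - euler h n i -
    m.+1%:R * h * F (euler h n) i =
  (euler h (n + m) i - euler h n i - m%:R * h * F (euler h n) i) +
  h * (F (euler h (n + m)) i - F (euler h n) i).
  by rewrite -natr1; ring.
apply: le_trans (ler_normD _ _) _.
have FE : `|h * (F (euler h (n + m)) i - F (euler h n) i)| <= h * (C * (m%:R * h)).
  rewrite normrM ger0_norm // ler_wpM2l // (le_trans (FL _ _ _)) //.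
  rewrite /C -!mulrA ler_wpM2l // (le_trans (ler_sum _ (fun j _ => eulerD n m j h0))) //.
  by rewrite big_const_seq count_predT iter_addr_0 -mulr_natl; lra.
apply: le_trans (lerD IH FE) _; rewrite -natr1.
have : 0 <= m%:R :> R by [].
move: (m%:R : R) => a a0.
rewrite -subr_ge0.
have -> : C * ((a + 1) * h) ^+ 2 - (C * (a * h) ^+ 2 + h * (C * (a * h))) =
  C * h ^+ 2 * (a + 1) by ring.
by rewrite !mulr_ge0 // ?exprn_ge0 ?addr_ge0.
Qed.

(** The Euler polygons of step [1 / (n + 1)] are equi-Lipschitz up to their step,
    so that they converge pointwise along the ultrafilter, and their quadratic
    Taylor estimate carries over to the limit. *)
Let mesh (n : nat) : R := n.+1%:R^-1.
Let polygon n (t : R) := euler (mesh n) (Num.truncn (t * n.+1%:R)).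

Let mesh_cvg : mesh @ ultra_nat --> 0.
Proof. exact/cvg_ultra_nat/cvg_harmonic. Qed.

Let polygon_steps n s t : 0 <= s -> s <= t -> exists m : nat,
  (Num.truncn (t * n.+1%:R) = Num.truncn (s * n.+1%:R) + m)%N /\
  `|m%:R * mesh n - (t - s)| <= mesh n.
Proof.
move=> s0 st; pose N : R := n.+1%:R; have N0 : 0 < N by rewrite /N.
have sN : s * N <= t * N by rewrite ler_wpM2r // ltW.
have /subnKC E := le_truncn sN.
exists (Num.truncn (t * N) - Num.truncn (s * N))%N; rewrite E; split=> //.
have /andP[t1 t2] := truncn_itv (le_trans (mulr_ge0 s0 (ltW N0)) sN).
have /andP[s1 s2] := truncn_itv (mulr_ge0 s0 (ltW N0)).
rewrite natrB; last exact: le_truncn.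
move: t1 t2 s1 s2; rewrite -!natr1.
set a := (Num.truncn (t * N))%:R; set b := (Num.truncn (s * N))%:R => t1 t2 s1 s2.
have -> : (a - b) * mesh n - (t - s) = (a - b - (t * N - s * N)) / N.
  by rewrite /mesh -/N; field; rewrite gt_eqF.
have Ni : 0 <= N^-1 by rewrite invr_ge0 ltW.
rewrite normrM [`|N^-1|]ger0_norm // -[leRHS]mul1r ler_wpM2r // ler_norml; lra.
Qed.

Let polygonD n s t i : 0 <= s -> s <= t ->
  `|polygon n t i - polygon n s i| <= (t - s + mesh n) * B.
Proof.
move=> s0 st; have [m [E]] := polygon_steps n s0 st.
rewrite /polygon E ler_norml => /andP[m1 m2].
have h0 : 0 <= mesh n by rewrite invr_ge0.
apply: le_trans (eulerD _ _ _ h0) _.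
by rewrite ler_wpM2r ?B0 //; lra.
Qed.

Let polygonT n s t i : 0 <= s -> s <= t ->
  `|polygon n t i - polygon n s i - (t - s) * F (polygon n s) i| <=
    C * (t - s + mesh n) ^+ 2 + mesh n * B.
Proof.
move=> s0 st; have [m [E mE]] := polygon_steps n s0 st.
have h0 : 0 <= mesh n by rewrite invr_ge0.
have B0i := B0 erefl i; have C0 : 0 <= C by rewrite !mulr_ge0.
rewrite /polygon E; set x := euler _ (Num.truncn (s * _)).
have -> : euler (mesh n) (Num.truncn (s * n.+1%:R) + m) i - x i - (t - s) * F x i
 = (euler (mesh n) (Num.truncn (s * n.+1%:R) + m) i - x i - m%:R * mesh n * F x i)
   + (m%:R * mesh n - (t - s)) * F x i by ring.
apply: le_trans (ler_normD _ _) _; apply: lerD.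
  apply: le_trans (eulerT _ _ _ h0) _; rewrite ler_wpM2l //.
  rewrite ler_sqr ?nnegrE ?mulr_ge0 //; move: mE; rewrite ler_norml; lra.
by rewrite normrM ler_pM.
Qed.

Let sol (t : R) (i : T) :=
  if 0 <= t then ulim (fun n => polygon n t i) else x0 i + t * F x0 i.

Let polygon0 n : polygon n 0 = x0.
Proof. by rewrite /polygon mul0r truncn0. Qed.

Let sol_cvg t i : 0 <= t -> polygon n t i @[n --> ultra_nat] --> sol t i.
Proof.
move=> t0; rewrite /sol t0; apply: (ulim_cvg (M := (t + 1) * B + `|x0 i|)) => n.
rewrite -[polygon n t i](subrK (polygon n 0 i)).
apply: le_trans (ler_normD _ _) _; rewrite polygon0 lerD2r.
rewrite -{1}(polygon0 n).
apply: le_trans (polygonD n i (lexx 0) t0) _; rewrite subr0 ler_wpM2r ?B0 //.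
by rewrite lerD2l invf_le1 // ler1n.
Qed.

Let sol0 : sol 0 = x0.
Proof.
apply/funext => i; rewrite /sol lexx; apply: ulim_eq.
by under eq_fun do rewrite polygon0; exact: cvg_cst.
Qed.

Let solD s t i : 0 <= s -> s <= t -> `|sol t i - sol s i| <= (t - s) * B.
Proof.
move=> s0 st; have t0 := le_trans s0 st.
apply: (ulim_le (u := fun n => `|polygon n t i - polygon n s i|)
                (v := fun n => (t - s + mesh n) * B)).
- by apply: cvg_norm; apply: cvgB; exact: sol_cvg.
- apply: cvgMr_tmp; rewrite -[X in _ --> X]addr0.
  by apply: cvgD; [exact: cvg_cst | exact: mesh_cvg].
- by move=> n; exact: polygonD.
Qed.

Let F_cvg t i : 0 <= t -> F (polygon n t) i @[n --> ultra_nat] --> F (sol t) i.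
Proof.
move=> t0; apply/cvgrPdist_le => eps eps0.
have sum0 : L * (\sum_(j <- r) `|polygon n t j - sol t j|) @[n --> ultra_nat] -->
    L * \sum_(j <- r) `|sol t j - sol t j|.
  apply: cvgMl_tmp; apply: cvg_sumr => j; apply: cvg_norm.
  by apply: cvgB; [exact: sol_cvg | exact: cvg_cst].
have Z0 : L * \sum_(j <- r) `|sol t j - sol t j| = 0.
  by rewrite big1 ?mulr0 // => j _; rewrite subrr normr0.
rewrite Z0 in sum0; have /cvgrPdist_le /(_ _ eps0) := sum0.
apply: filterS => n; rewrite sub0r normrN => sumn.
by rewrite distrC; apply: le_trans (le_trans (FL _ _ _) _) sumn; exact: ler_norm.
Qed.

Let solT s t i : 0 <= s -> s <= t ->
  `|sol t i - sol s i - (t - s) * F (sol s) i| <= C * (t - s) ^+ 2.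
Proof.
move=> s0 st; have t0 := le_trans s0 st.
apply: (ulim_le (u := fun n => `|polygon n t i - polygon n s i
                                 - (t - s) * F (polygon n s) i|)
                (v := fun n => C * (t - s + mesh n) ^+ 2 + mesh n * B)).
- apply: cvg_norm; apply: cvgB; first by apply: cvgB; exact: sol_cvg.
  by apply: cvgMl_tmp; exact: F_cvg.
- rewrite -[X in _ --> X]addr0 -(mul0r B); apply: cvgD; last exact: cvgMr_tmp.
  apply: cvgMl_tmp; rewrite -{2}[t - s]addr0 !expr2.
  by apply: cvgM; apply: cvgD => //; exact: cvg_cst.
- by move=> n; exact: polygonT.
Qed.

Lemma ode_lipschitz : exists x : R -> T -> R, x 0 = x0 /\
  forall (t : R) i, 0 <= t -> is_derive t 1 (x^~ i) (F (x t) i).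
Proof.
exists sol; split=> // t i t0; have B0i := B0 erefl i.
have C0 : 0 <= C by rewrite !mulr_ge0.
have [tp|tn] := ltrP 0 t; last first.
  have {t0 tn}-> : t = 0 by apply/eqP; rewrite eq_le tn t0.
  apply: (@is_derive_quadratic R _ 0 _ C 1) => // y _; rewrite subr0 sol0.
  have [y0|y0] := leP 0 y.
    by have := solT i (lexx 0) y0; rewrite sol0 subr0.
  rewrite /sol (leNgt 0 y) y0 /=.
  have -> : x0 i + y * F x0 i - x0 i - y * F x0 i = 0 by ring.
  rewrite normr0.
  by rewrite mulr_ge0 // sqr_ge0.
apply: (@is_derive_quadratic R _ t _ (2 * C) t) => // y yt.
have [ty|/ltW ty] := leP t y.
  apply: le_trans (solT i t0 ty) _; rewrite -mulrA ler_peMl ?ler1n //.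
  by rewrite mulr_ge0 // sqr_ge0.
have y0 : 0 <= y by move: yt; rewrite ltr_norml; lra.
have -> : sol y i - sol t i - (y - t) * F (sol t) i =
  - (sol t i - sol y i - (t - y) * F (sol y) i)
  + (t - y) * (F (sol t) i - F (sol y) i) by ring.
apply: le_trans (ler_normD _ _) _; rewrite normrN -mulrA mulr_natl mulr2n.
have -> : (y - t) ^+ 2 = (t - y) ^+ 2 by ring.
apply: lerD; first exact: solT.
rewrite normrM ger0_norm ?subr_ge0 // expr2 mulrCA ler_wpM2l ?subr_ge0 //.
apply: le_trans (FL _ _ _) _; rewrite /C -!mulrA ler_wpM2l //.
apply: le_trans (ler_sum _ (fun j _ => solD j y0 ty)) _.
by rewrite big_const_seq count_predT iter_addr_0 -mulr_natl; lra.
Qed.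
End euler.

(** The truncation of the vector field to a large cube makes it bounded and
    Lipschitz; the dissipation of the Euclidean norm then keeps the solution
    inside the cube, where the truncation does nothing. *)
Lemma ode_dissipative (R : realType) (T : eqType) (r : seq T)
    (G : (T -> R) -> T -> R) (x0 : T -> R) :
  (forall M : R, exists2 L, 0 <= L & forall x y i,
    (forall j, j \in r -> `|x j| <= M) -> (forall j, j \in r -> `|y j| <= M) ->
    `|G x i - G y i| <= L * \sum_(j <- r) `|x j - y j|) ->
  (forall i, G (fun=> 0) i = 0) ->
  (forall x, \sum_(i <- r) x i * G x i <= 0) ->
  exists x : R -> T -> R, [/\ x 0 = x0,
    forall (t : R) i, 0 <= t -> is_derive t 1 (x^~ i) (G (x t) i) &
    forall t : R, 0 <= t ->
      \sum_(i <- r) x t i ^+ 2 <= \sum_(i <- r) x0 i ^+ 2].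
Proof.
move=> GL G0 Gdis; pose B := \sum_(i <- r) x0 i ^+ 2; pose M := B + 1.
have B0 : 0 <= B by apply: sumr_ge0 => i _; exact: sqr_ge0.
have M0 : 0 <= M by rewrite addr_ge0.
have [L L0 {}GL] := GL M.
pose clip (x : T -> R) j := if x j < - M then - M else if M < x j then M else x j.
have clipM x j : `|clip x j| <= M.
  rewrite /clip ler_norml; case: (ltP (x j) (- M)) => ?; first lra.
  by case: (ltP M (x j)) => ?; lra.
have clipL x y j : `|clip x j - clip y j| <= `|x j - y j|.
  rewrite /clip ler_norml; case: (ltP (x j) (- M)) => ?;
    case: (ltP (y j) (- M)) => ?; case: (ltP M (x j)) => ?;
    case: (ltP M (y j)) => ?; case: (ler0P (x j - y j)) => ?; lra.
have clip_id x j : `|x j| <= M -> clip x j = x j.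
  rewrite /clip ler_norml => /andP[? ?]; case: (ltP (x j) (- M)) => ?; first lra.
  by case: (ltP M (x j)) => ?; lra.
pose F x := G (clip x).
have FL x y i : `|F x i - F y i| <= L * \sum_(j <- r) `|x j - y j|.
  apply: le_trans (GL _ _ _ _ _) _ => //.
  by rewrite ler_wpM2l // ler_sum.
have FB x i : `|F x i| <= L * ((size r)%:R * M).
  rewrite -[F x i]subr0 -(G0 i); apply: le_trans (GL _ _ _ _ _) _ => // [j _|].
    by rewrite normr0.
  rewrite ler_wpM2l //; apply: (@le_trans _ _ (\sum_(j <- r) M)).
    by apply: ler_sum => j _; rewrite subr0.
  by rewrite big_const_seq count_predT iter_addr_0 mulr_natl.
have [x [x00 xF]] := ode_lipschitz x0 FB FL L0.
have small t : \sum_(i <- r) x t i ^+ 2 < B + 1 -> forall j, j \in r -> `|x t j| <= M.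
  move=> xB j jr; rewrite -(ler_sqr (normr_ge0 _) M0) real_normK ?num_real //.
  apply: (@le_trans _ _ (\sum_(i <- r) x t i ^+ 2)).
    by rewrite (big_rem j) //= lerDl sumr_ge0 // => i _; exact: sqr_ge0.
  by apply: le_trans (ltW xB) _; rewrite /M; nra.
have FG t : \sum_(i <- r) x t i ^+ 2 < B + 1 -> F (x t) =1 G (x t).
  move=> /small xM i; apply/eqP; rewrite -subr_eq0 -normr_le0.
  apply: le_trans (GL _ _ _ _ _) _ => //.
  rewrite big1_seq ?mulr0 // => j /andP[_ jr].
  by rewrite clip_id ?subrr ?normr0 // xM.
have xB t : 0 <= t -> \sum_(i <- r) x t i ^+ 2 <= B.
  have B1 : B < B + 1 by rewrite ltrDl.
  apply: (barrier (Q := fun t => \sum_(i <- r) x t i ^+ 2)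
     (dQ := fun t => \sum_(i <- r) 2 * x t i * F (x t) i) B1).
  - by rewrite x00.
  - move=> t0 t00; apply: is_derive_sumr => i.
    have := xF t0 i t00; move: (F (x t0) i) => d xd.
    rewrite (_ : (fun y => _) = (x^~ i) * (x^~ i)); last first.
      by apply/funext => y; rewrite expr2.
    by apply: is_derive_eq; rewrite /GRing.scale /=; ring.
  - move=> t0 t00 /FG xFG; have := Gdis (x t0).
    under [X in _ -> X <= _]eq_bigr do rewrite xFG -mulrA.
    by rewrite -mulr_sumr; lra.
exists x; split=> // t i t0; rewrite -FG; first exact: xF.
by apply: le_lt_trans (xB t t0) _; rewrite ltrDl.
Qed.

Notation Z2 := (int * int)%type.

Fixpoint line (n : nat) : seq int :=
  if n is m.+1 then (Posz m.+1) :: - (Posz m.+1) :: line m else [:: 0].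

Lemma mem_line n i : (i \in line n) = (`|i| <= n%:Z).
Proof.
elim: n => [|n IH] /=; first by rewrite inE; lia.
by rewrite !inE IH; lia.
Qed.

Lemma line_uniq n : uniq (line n).
Proof. by elim: n => //= n ->; rewrite !inE !mem_line; lia. Qed.

(** The nonzero frequencies of the Galerkin truncation of order [n]. *)
Definition box (n : nat) : seq Z2 :=
  [seq k <- [seq (i, j) | i <- line n, j <- line n] | k != 0].

Lemma box_uniq n : uniq (box n).
Proof. by rewrite filter_uniq // allpairs_uniq ?line_uniq // => -[? ?] [? ?]. Qed.

Lemma mem_box n (k : Z2) :
  (k \in box n) = [&& k != 0, `|k.1| <= n%:Z & `|k.2| <= n%:Z].
Proof.
case: k => i j; rewrite mem_filter; congr andb; rewrite -!mem_line.
by apply/allpairsP/andP => [[[a b] /= [? ? [-> ->]]] | [? ?]]; last exists (i, j).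
Qed.

Lemma box_neq0 n k : k \in box n -> k != 0.
Proof. by rewrite mem_box => /and3P[]. Qed.

Lemma sum_box_le (R : realType) (f : Z2 -> R) (g : int -> R) n :
  (forall k, 0 <= f k) -> (forall k, f k <= g k.1 * g k.2) ->
  \sum_(k <- box n) f k <= (\sum_(i <- line n) g i) ^+ 2.
Proof.
move=> f0 fg; rewrite big_filter big_mkcond /=.
apply: (@le_trans _ _ (\sum_(k <- [seq (i, j) | i <- line n, j <- line n]) g k.1 * g k.2)).
  apply: ler_sum => k _; case: ifP => _ //; exact: le_trans (f0 k) (fg k).
by rewrite big_allpairs expr2 big_distrlr.
Qed.

Lemma sum_line_le (R : realType) (a : R) n : 0 < a ->
  \sum_(i <- line n) (1 + (a * i%:~R) ^+ 2)^-1 <= 1 + 4 / a.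
Proof.
move=> a0.
suff : \sum_(i <- line n) (1 + (a * i%:~R) ^+ 2)^-1 <= 1 + 4 / a * (1 - (1 + a * n%:R)^-1).
  move=> /le_trans; apply; rewrite lerD2l ler_piMr //; first by rewrite divr_ge0 // ltW.
  by rewrite lerBlDr lerDl invr_ge0 addr_ge0 // mulr_ge0 // ltW.
elim: n => [|n IH].
  by rewrite /= big_seq1 /= !mulr0 expr0n addr0 invr1 subrr mulr0 addr0.
rewrite /= !big_cons rmorphN /= mulrN sqrrN -pmulrn addrA -(natr1 n).
set x : R := n%:R in IH *; have x0 : 0 <= x by rewrite /x.
have ax : 0 <= a * x by rewrite mulr_ge0 // ltW.
have a1 : 0 < 1 + a * (x + 1) by nra.
have a2 : 0 < 1 + a * x by lra.
suff : (1 + (a * (x + 1)) ^+ 2)^-1 + (1 + (a * (x + 1)) ^+ 2)^-1 <=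
   4 / a * ((1 + a * x)^-1 - (1 + a * (x + 1))^-1) by lra.
have -> : 4 / a * ((1 + a * x)^-1 - (1 + a * (x + 1))^-1) =
  4 / ((1 + a * x) * (1 + a * (x + 1))).
  by field; rewrite !gt_eqF.
have axy : a * x <= a * (x + 1) by rewrite ler_wpM2l ?lerDl // ltW.
set y := a * (x + 1) in a1 axy *.
have q : (1 + a * x) * (1 + y) <= 2 * (1 + y ^+ 2).
  apply: (@le_trans _ _ ((1 + y) * (1 + y))); last by have := sqr_ge0 (1 - y); lra.
  by rewrite ler_wpM2r ?lerD2l // ltW.
have q0 : 0 < (1 + a * x) * (1 + y) by rewrite mulr_gt0.
have y0 : 0 < 1 + y ^+ 2 by rewrite ltr_pwDl ?sqr_ge0.
rewrite ler_pdivlMr //.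
have : (1 + a * x) * (1 + y) / (1 + y ^+ 2) <= 2 by rewrite ler_pdivrMr.
by rewrite mulrDl mulrC; lra.
Qed.

Section frequencies.
Variable R : realType.
Implicit Types j k l : Z2.
Notation fn := (freq_norm R).

Definition freq_sq (k : Z2) : R := k.1%:~R ^+ 2 + k.2%:~R ^+ 2.
Definition cross (j k : Z2) : R := j.1%:~R * k.2%:~R - j.2%:~R * k.1%:~R.

Lemma freq_sq_ge0 k : 0 <= freq_sq k.
Proof. by rewrite addr_ge0 // sqr_ge0. Qed.

Lemma fn_sqr k : fn k ^+ 2 = freq_sq k.
Proof. by rewrite sqr_sqrtr // freq_sq_ge0. Qed.

Lemma fn_ge0 k : 0 <= fn k.
Proof. exact: sqrtr_ge0. Qed.

Lemma freq_sq_ge1 k : k != 0 -> 1 <= freq_sq k.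
Proof.
case: k => a b; rewrite -pair_eqE /= negb_and /freq_sq /= => ab.
have : (1 <= a ^+ 2 + b ^+ 2)%R by nia.
by rewrite -(ler_int R) rmorphD !rmorphXn.
Qed.

Lemma fn_ge1 k : k != 0 -> 1 <= fn k.
Proof. by move=> /freq_sq_ge1; rewrite -fn_sqr; have := fn_ge0 k; nra. Qed.

Lemma fn0 : fn 0 = 0.
Proof. by rewrite /freq_norm /= expr0n addr0 sqrtr0. Qed.

Lemma fnN k : fn (- k) = fn k.
Proof. by rewrite /freq_norm /= !rmorphN !sqrrN. Qed.

Lemma cross_le j k : `|cross j k| <= fn j * fn k.
Proof.
rewrite -(@ler_pXn2r _ 2) ?nnegrE ?mulr_ge0 ?fn_ge0 // real_normK ?num_real //.
rewrite exprMn !fn_sqr /cross /freq_sq -subr_ge0.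
set a := _%:~R; set b := _%:~R; set c := _%:~R; set d := _%:~R.
by rewrite (_ : _ - _ = (a * c + b * d) ^+ 2) ?sqr_ge0 //; ring.
Qed.

Lemma fnD j k : fn (j + k) <= fn j + fn k.
Proof.
have hj := fn_sqr j; have hk := fn_sqr k.
rewrite -(@ler_pXn2r _ 2) ?nnegrE ?addr_ge0 ?fn_ge0 // fn_sqr.
rewrite /freq_sq /= !rmorphD /=.
have : j.1%:~R * k.1%:~R + j.2%:~R * k.2%:~R <= fn j * fn k.
  apply: le_trans (ler_norm _) _.
  rewrite -(@ler_pXn2r _ 2) ?nnegrE ?mulr_ge0 ?fn_ge0 // real_normK ?num_real //.
  rewrite exprMn !fn_sqr /freq_sq -subr_ge0.
  set a := _%:~R; set b := _%:~R; set c := _%:~R; set d := _%:~R.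
  by rewrite (_ : _ - _ = (a * d - b * c) ^+ 2) ?sqr_ge0 //; ring.
by move: hj hk; rewrite /freq_sq; lra.
Qed.

Lemma normr_freq1_le k : `|k.1%:~R| <= fn k.
Proof.
rewrite -(@ler_pXn2r _ 2) ?nnegrE ?fn_ge0 // fn_sqr real_normK ?num_real //.
by rewrite lerDl sqr_ge0.
Qed.

Lemma normr_freq2_le k : `|k.2%:~R| <= fn k.
Proof.
rewrite -(@ler_pXn2r _ 2) ?nnegrE ?fn_ge0 // fn_sqr real_normK ?num_real //.
by rewrite lerDr sqr_ge0.
Qed.

Lemma crossDr j k l : cross j (k + l) = cross j k + cross j l.
Proof. by rewrite /cross /= !rmorphD /=; ring. Qed.

Lemma crossNr j k : cross j (- k) = - cross j k.
Proof. by rewrite /cross /= !rmorphN /=; ring. Qed.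

Lemma crossxx j : cross j j = 0.
Proof. by rewrite /cross; ring. Qed.

Lemma box_compl n k : k != 0 -> k \notin box n -> n%:R <= fn k.
Proof.
move=> k0; rewrite mem_box k0 /= negb_and -!ltNge => /orP[nk|nk].
  apply: le_trans (normr_freq1_le k).
  by rewrite -intr_norm pmulrn ler_int ltW.
apply: le_trans (normr_freq2_le k).
by rewrite -intr_norm pmulrn ler_int ltW.
Qed.

Lemma box_freq n k : fn k <= n%:R -> k != 0 -> k \in box n.
Proof.
move=> kn k0; rewrite mem_box k0 /= -!(ler_int R) !intr_norm -pmulrn.
rewrite (le_trans (normr_freq1_le k) kn) //=.
exact: le_trans (normr_freq2_le k) kn.
Qed.

Lemma sum_helmholtz_le (alpha : R) n : 0 < alpha ->
  \sum_(k <- box n) (1 + alpha ^+ 2 * freq_sq k) ^- 2 <= 25 / alpha ^+ 2.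
Proof.
have key (a : R) k : (1 + a ^+ 2 * freq_sq k) ^- 2 <=
    (1 + (a * k.1%:~R) ^+ 2)^-1 * (1 + (a * k.2%:~R) ^+ 2)^-1.
  rewrite -invfM lef_pV2 ?posrE.
  - rewrite !exprMn /freq_sq; set x := _ ^+ 2; set y := _ ^+ 2; set z := _ ^+ 2.
    have : 0 <= x * y by rewrite mulr_ge0 ?sqr_ge0.
    have : 0 <= x * z by rewrite mulr_ge0 ?sqr_ge0.
    by rewrite expr2; nra.
  - by rewrite exprn_gt0 // ltr_pwDl // mulr_ge0 ?sqr_ge0 ?freq_sq_ge0.
  - by rewrite mulr_gt0 // ltr_pwDl ?sqr_ge0.
have small (a : R) : 0 < a -> a <= 1 ->
    \sum_(k <- box n) (1 + a ^+ 2 * freq_sq k) ^- 2 <= 25 / a ^+ 2.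
  move=> a0 a1.
  have pos k : 0 <= (1 + a ^+ 2 * freq_sq k) ^- 2.
    by rewrite invr_ge0 exprn_ge0 // addr_ge0 // mulr_ge0 ?sqr_ge0 ?freq_sq_ge0.
  apply: le_trans (sum_box_le (g := fun i => (1 + (a * i%:~R) ^+ 2)^-1) n pos (key a)) _.
  have -> : 25 / a ^+ 2 = (5 / a) ^+ 2 by field; rewrite gt_eqF.
  have s0 : 0 <= \sum_(i <- line n) (1 + (a * i%:~R) ^+ 2)^-1.
    by apply: sumr_ge0 => i _; rewrite invr_ge0 addr_ge0 // sqr_ge0.
  have a50 : 0 <= 5 / a by rewrite divr_ge0 // ltW.
  rewrite ler_sqr ?nnegrE //.
  apply: le_trans (sum_line_le n a0) _.
  by have : 1 <= a^-1 by [rewrite invf_ge1]; lra.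
move=> a0; have [a1|a1] := leP alpha 1; first exact: small.
have ai : 0 <= alpha ^- 2 by rewrite invr_ge0 sqr_ge0.
have := small 1 ltr01 (lexx 1); rewrite expr1n divr1 => s1.
rewrite mulrC; apply: le_trans (ler_wpM2l ai s1); rewrite mulr_sumr big_seq [leRHS]big_seq.
apply: ler_sum => k /box_neq0/freq_sq_ge1; rewrite mul1r => k1.
have h : alpha * (1 + freq_sq k) <= 1 + alpha ^+ 2 * freq_sq k.
  rewrite -subr_ge0 [leRHS](_ : _ = (alpha - 1) * (alpha * freq_sq k - 1)); last by ring.
  by rewrite mulr_ge0 // subr_ge0 ?(ltW a1) // -[1]mulr1 ler_pM // ltW.
have p1 : 0 < alpha * (1 + freq_sq k) by rewrite mulr_gt0 //; lra.
rewrite -invfM -exprMn lef_pV2 ?posrE ?exprn_gt0 //; last exact: lt_le_trans h.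
by rewrite lerXn2r ?nnegrE // ltW //; exact: lt_le_trans h.
Qed.
End frequencies.

HB.lock Definition gw (R : realType) (sg tau : R) (k : Z2) : R :=
  expR (tau * freq_norm R k `^ sg).

Section gevrey_weight.
Variables (R : realType) (sg : R).
Hypotheses (sg0 : 0 < sg) (sg1 : sg <= 1).

Lemma powR_min_le (a b : R) : 0 <= b <= a -> 0 < a -> b * a `^ (sg - 1) <= b `^ sg.
Proof.
move=> /andP[b0 ba] a0; have [->|bn0] := eqVneq b 0; first by rewrite mul0r powR_ge0.
have bp : 0 < b by rewrite lt_neqAle eq_sym bn0.
have -> : b `^ sg = b * b `^ (sg - 1).
  by rewrite mulr_powRB1.
rewrite ler_wpM2l // -[sg - 1]opprB !powRN lef_pV2 ?posrE ?powR_gt0 //.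
by rewrite ge0_ler_powR // ?nnegrE ?subr_ge0 // ltW.
Qed.

Lemma powR_subadd (a b : R) : 0 <= a -> 0 <= b -> (a + b) `^ sg <= a `^ sg + b `^ sg.
Proof.
move=> a0 b0; have [ab|ab] := eqVneq (a + b) 0.
  by rewrite ab powR0 ?gt_eqF // addr_ge0 ?powR_ge0.
have abp : 0 < a + b by rewrite lt_neqAle eq_sym ab addr_ge0.
have -> : (a + b) `^ sg = (a + b) * (a + b) `^ (sg - 1).
  by rewrite mulr_powRB1 // ltW.
by rewrite mulrDl lerD // powR_min_le // ?a0 ?b0 /= ?lerDl ?lerDr.
Qed.

(** The gain behind the commutator estimate: [x^sg] is Lipschitz with constant
    [max ^ (sg - 1)], and the cross product, which is controlled by the smaller
    frequency, turns this into [min ^ sg]. *)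
Lemma powR_sub_le (a b d : R) : 0 <= b <= a -> 0 < a -> a - b <= d ->
  (a `^ sg - b `^ sg) * b <= d * b `^ sg.
Proof.
move=> bab a0 abd; have /andP[b0 ba] := bab.
have aE : a `^ sg = a * a `^ (sg - 1).
  by rewrite mulr_powRB1 // ltW.
have h1 := powR_min_le bab a0; have p0 := powR_ge0 a (sg - 1).
apply: (@le_trans _ _ ((a - b) * a `^ (sg - 1) * b)).
  by rewrite ler_wpM2r // aE mulrBl lerB.
rewrite -mulrA [X in _ * X]mulrC.
by apply: ler_pM => //; rewrite ?subr_ge0 // mulr_ge0.
Qed.

Notation gw := (gw sg).

Lemma gw_gt0 tau k : 0 < gw tau k. Proof. by rewrite gw.unlock expR_gt0. Qed.

Lemma gw_ge0 tau k : 0 <= gw tau k. Proof. exact/ltW/gw_gt0. Qed.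

Lemma gw_ge1 tau k : 0 <= tau -> 1 <= gw tau k.
Proof. by move=> t0; rewrite gw.unlock -expR0 ler_expR mulr_ge0 // powR_ge0. Qed.

Lemma gw_le tau k l : 0 <= tau -> freq_norm R k <= freq_norm R l ->
  gw tau k <= gw tau l.
Proof.
move=> t0 kl; rewrite gw.unlock ler_expR ler_wpM2l //.
by rewrite ge0_ler_powR // ?nnegrE ?fn_ge0 // ltW.
Qed.

Lemma gw_submul tau (j k l : Z2) : 0 <= tau ->
  freq_norm R l <= freq_norm R j + freq_norm R k ->
  gw tau l <= gw tau j * gw tau k.
Proof.
move=> t0 ljk; rewrite gw.unlock -expRD ler_expR -mulrDr ler_wpM2l //.
apply: le_trans (powR_subadd _ _); rewrite ?fn_ge0 //.
by rewrite ge0_ler_powR // ?nnegrE ?addr_ge0 ?fn_ge0 // ltW.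
Qed.

Lemma expR_sub_le (x y : R) : y <= x -> expR x - expR y <= (x - y) * expR x.
Proof.
move=> yx; have h : 1 - (x - y) <= expR (y - x).
  by have := expR_ge1Dx (y - x); lra.
have -> : expR y = expR (y - x) * expR x by rewrite -expRD subrK.
by have := expR_gt0 x; nra.
Qed.

Lemma gw_sub_le tau (j k l : Z2) : 0 <= tau -> k != 0 -> l != 0 -> j != 0 ->
  `|freq_norm R l - freq_norm R k| <= freq_norm R j ->
  freq_norm R l <= freq_norm R k ->
  `|gw tau l - gw tau k| * freq_norm R l <=
     tau * freq_norm R j * freq_norm R l `^ sg * (gw tau j * gw tau l).
Proof.
move=> t0 k0 l0 j0 lkj lk; have l1 := fn_ge1 R l0; have k1 := fn_ge1 R k0.
have lkp : freq_norm R l `^ sg <= freq_norm R k `^ sg.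
  by rewrite ge0_ler_powR // ?nnegrE ?fn_ge0 // ltW.
have gkl : gw tau l <= gw tau k by exact: gw_le.
rewrite ler0_norm ?subr_le0 // opprB.
have kjl : freq_norm R k <= freq_norm R j + freq_norm R l.
  by rewrite -lerBlDr; apply: le_trans lkj; rewrite distrC ler_norm.
have h1 := gw_submul t0 kjl.
have h2 : gw tau k - gw tau l <=
    tau * (freq_norm R k `^ sg - freq_norm R l `^ sg) * gw tau k.
  rewrite gw.unlock mulrBr; apply: expR_sub_le; exact: ler_wpM2l.
have h3 : (freq_norm R k `^ sg - freq_norm R l `^ sg) * freq_norm R l <=
   freq_norm R j * freq_norm R l `^ sg.
  by apply: powR_sub_le; [rewrite fn_ge0 | exact: lt_le_trans k1 | rewrite lerBlDr].
have l00 : 0 <= freq_norm R l by rewrite fn_ge0.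
apply: le_trans (ler_wpM2r l00 h2) _.
rewrite [leLHS](_ : _ = tau * ((freq_norm R k `^ sg - freq_norm R l `^ sg) * freq_norm R l) * gw tau k); last by ring.
apply: ler_pM h1 => //.
- by rewrite !mulr_ge0 // subr_ge0.
- exact: gw_ge0.
- by rewrite -mulrA ler_wpM2l.
Qed.
End gevrey_weight.

(** Exponential weights beat every power of the frequency. *)
Lemma sum_gevrey_le (R : realType) (sg tau : R) (m : nat) : 0 < sg -> 0 < tau ->
  exists2 K, 0 <= K & forall n,
    \sum_(k <- box n) (1 + freq_norm R k) ^+ m * (gw sg tau k)^-1 <= K.
Proof.
move=> sg0 tau0.
have [p pm] : exists p : nat, (m + 4)%:R / sg <= p.+1%:R.
  by exists (Num.truncn ((m + 4)%:R / sg)); apply/ltW; exact: truncnS_gt.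
pose b : R := p.+1`!%:R / tau ^+ p.+1; pose c : R := 2 ^+ m * b.
have b0 : 0 <= b by rewrite divr_ge0 // exprn_ge0 // ltW.
have c0 : 0 <= c by rewrite mulr_ge0 // exprn_ge0.
exists (c * (4 * 25)); first by rewrite mulr_ge0.
move=> n; have := sum_helmholtz_le n (@ltr01 R); rewrite expr1n divr1 => s1.
have c4 : 0 <= c * 4 by rewrite mulr_ge0.
rewrite mulrA; apply: le_trans (ler_wpM2l c4 s1).
rewrite mulr_sumr big_seq [leRHS]big_seq; apply: ler_sum => k /box_neq0 k0.
rewrite mul1r -fn_sqr; have k1 := fn_ge1 R k0; set x := freq_norm R k in k1 *.
have x0 : 0 < x by exact: lt_le_trans k1.
have xp : 0 < x `^ sg by rewrite powR_gt0.
have e1 : x ^+ (m + 4) <= b * gw sg tau k.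
  have h2 : x ^+ (m + 4) <= (x `^ sg) ^+ p.+1.
    rewrite -!powR_mulrn ?powR_ge0 ?(ltW x0) // -powRrM ler_powR //.
    by rewrite mulrC -ler_pdivrMr.
  apply: le_trans h2 _; rewrite /b mulrAC ler_pdivlMr ?exprn_gt0 //.
  rewrite mulrC -exprMn -ler_pdivrMl ?ltr0n ?fact_gt0 // mulrC.
  have y0 : 0 <= tau * x `^ sg by rewrite mulr_ge0 // ltW.
  by rewrite gw.unlock; apply: le_trans (expR_ge1Dxn p y0); rewrite lerDr.
have e2 : (1 + x) ^+ m <= 2 ^+ m * x ^+ m.
  have xx : 1 + x <= 2 * x by rewrite mulr_natl mulr2n lerD2r.
  by rewrite -exprMn lerXn2r ?nnegrE ?addr_ge0 ?mulr_ge0 // ltW.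
have g0 := gw_gt0 sg tau k.
have q0 : 0 < (1 + x ^+ 2) ^+ 2 by rewrite exprn_gt0 // ltr_pwDl // sqr_ge0.
rewrite ler_pdivrMr // mulrAC ler_pdivlMr //.
have e3 : (1 + x ^+ 2) ^+ 2 <= 4 * x ^+ 4.
  have -> : 4 * x ^+ 4 = (x ^+ 2 + x ^+ 2) ^+ 2 by ring.
  have x21 : 1 <= x ^+ 2 by rewrite exprn_ege1.
  by rewrite lerXn2r ?nnegrE ?addr_ge0 ?sqr_ge0 // lerD2r.
apply: (@le_trans _ _ ((2 ^+ m * x ^+ m) * (4 * x ^+ 4))).
  by apply: ler_pM => //; rewrite exprn_ge0 // addr_ge0 ?sqr_ge0 ?(ltW x0).
have -> : (2 ^+ m * x ^+ m) * (4 * x ^+ 4) = 2 ^+ m * 4 * (x ^+ (m + 4)).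
  by rewrite exprD; ring.
have -> : c * 4 * gw sg tau k = 2 ^+ m * 4 * (b * gw sg tau k).
  by rewrite /c; ring.
by rewrite ler_wpM2l // mulr_ge0 // exprn_ge0.
Qed.

Lemma sum_eq_le (R : realType) (T : eqType) (r : seq T) (g : T -> R) (e : T) :
  uniq r -> (forall l, 0 <= g l) -> \sum_(l <- r) g l * (l == e)%:R <= g e.
Proof.
move=> ur g0; have [er|er] := boolP (e \in r).
  rewrite (bigD1_seq e) //= eqxx mulr1 big1 ?addr0 // => l /negPf ->.
  by rewrite mulr0.
rewrite big1_seq // => l /andP[_ lr]; case: eqP => [le|]; rewrite ?mulr0 //.
by rewrite -le lr in er.
Qed.

Lemma ler_norm_sub (R : realType) (a b c : R) :
  a <= c + b -> b <= c + a -> `|a - b| <= c.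
Proof. by rewrite ler_norml; lra. Qed.

Lemma cauchy_schwarz (R : realType) (T : Type) (r : seq T) (a b : T -> R) :
  (\sum_(i <- r) a i * b i) ^+ 2 <=
  (\sum_(i <- r) a i ^+ 2) * (\sum_(i <- r) b i ^+ 2).
Proof.
have : 0 <= \sum_(i <- r) \sum_(j <- r) (a i * b j - a j * b i) ^+ 2.
  by apply: sumr_ge0 => i _; apply: sumr_ge0 => j _; exact: sqr_ge0.
have E i j : (a i * b j - a j * b i) ^+ 2 = (a i ^+ 2 * b j ^+ 2 + b i ^+ 2 * a j ^+ 2)
    - 2 * (a i * b i) * (a j * b j) by ring.
under eq_bigr => i _ do under eq_bigr => j _ do rewrite E.
under eq_bigr do rewrite sumrB big_split /=.
rewrite sumrB big_split /= -!big_distrlr /=.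
rewrite -mulr_sumr expr2.
set A := \sum_(i <- r) a i ^+ 2; set B := \sum_(i <- r) b i ^+ 2.
by set S := \sum_(i <- r) a i * b i; lra.
Qed.

Section interaction.
Variable R : realType.
Implicit Types j k l : Z2.
Notation fn := (freq_norm R).
Notation cross := (cross R).

(** With [cas x = cos x + sin x], the product [cas (- j.z) * cas (- k.z)] is half
    the combination of [cas (l.z)] with coefficients [sel j k l]. *)
Definition sel j k l : R :=
  (l == - j - k)%:R - (l == j + k)%:R + (l == j - k)%:R + (l == k - j)%:R.

Definition asel j k l : R :=
  (l == - j - k)%:R + (l == j + k)%:R + (l == j - k)%:R + (l == k - j)%:R.

Lemma sel_swap j k l :
  [/\ (k == - j - l) = (l == - j - k), (k == j + l) = (l == k - j),
      (k == j - l) = (l == j - k) & (k == l - j) = (l == j + k)].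
Proof.
case: j k l => [a b] [c d] [e f]; rewrite -!pair_eqE /=.
by split; apply/andP/andP => -[/eqP ? /eqP ?]; split; apply/eqP; lia.
Qed.

Lemma asel_sym j k l : asel j k l = asel j l k.
Proof. by rewrite /asel; have [-> -> -> ->] := sel_swap j k l; ring. Qed.

Lemma sel_skew j k l : cross j k * sel j k l = - (cross j l * sel j l k).
Proof.
have E (e : Z2) : cross j l * (l == e)%:R = cross j e * (l == e)%:R.
  by case: eqP => [->//|_]; rewrite !mulr0.
rewrite /sel; have [-> -> -> ->] := sel_swap j k l.
rewrite !(mulrDr, mulrN, mulrBr) !E !crossDr !crossNr crossxx.
by ring.
Qed.

Lemma sel_le j k l : `|sel j k l| <= asel j k l.
Proof.
rewrite /sel /asel ler_norml.
by case: (l == _); case: (l == _); case: (l == _); case: (l == _) => /=; lra.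
Qed.

Lemma asel_ge0 j k l : 0 <= asel j k l.
Proof. exact: le_trans (sel_le j k l). Qed.

Lemma asel_freq j k l : asel j k l != 0 -> fn l <= fn j + fn k.
Proof.
have e1 : l = - j - k -> fn l <= fn j + fn k.
  by move=> ->; rewrite -(fnN R j) -(fnN R k) fnD.
have e2 : l = j + k -> fn l <= fn j + fn k by move=> ->; rewrite fnD.
have e3 : l = j - k -> fn l <= fn j + fn k by move=> ->; rewrite -(fnN R k) fnD.
have e4 : l = k - j -> fn l <= fn j + fn k.
  by move=> ->; rewrite -(fnN R j) addrC fnD.
rewrite /asel; case: (l =P - j - k) => [/e1//|_].
case: (l =P j + k) => [/e2//|_]; case: (l =P j - k) => [/e3//|_].
case: (l =P k - j) => [/e4//|_].
by rewrite !addr0 eqxx.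
Qed.

Lemma asel_cross j k l : asel j k l != 0 -> `|cross j l| = `|cross j k|.
Proof.
have e1 : l = - j - k -> `|cross j l| = `|cross j k|.
  by move=> ->; rewrite crossDr !crossNr crossxx oppr0 add0r normrN.
have e2 : l = j + k -> `|cross j l| = `|cross j k|.
  by move=> ->; rewrite crossDr crossxx add0r.
have e3 : l = j - k -> `|cross j l| = `|cross j k|.
  by move=> ->; rewrite crossDr crossNr crossxx add0r normrN.
have e4 : l = k - j -> `|cross j l| = `|cross j k|.
  by move=> ->; rewrite crossDr crossNr crossxx oppr0 addr0.
rewrite /asel; case: (l =P - j - k) => [/e1//|_].
case: (l =P j + k) => [/e2//|_]; case: (l =P j - k) => [/e3//|_].
case: (l =P k - j) => [/e4//|_].
by rewrite !addr0 eqxx.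
Qed.

Lemma sum_asel_le (r : seq Z2) (g : Z2 -> R) (M : R) j k : uniq r ->
  (forall l, 0 <= g l) -> (forall l, asel j k l != 0 -> g l <= M) ->
  \sum_(l <- r) g l * asel j k l <= 4 * M.
Proof.
move=> ur g0 gM; rewrite /asel.
under eq_bigr do rewrite !mulrDr.
have H e : asel j k e != 0 -> \sum_(l <- r) g l * (l == e)%:R <= M.
  by move=> /gM; apply: le_trans; exact: sum_eq_le.
rewrite !big_split /=.
have -> : 4 * M = M + M + M + M by ring.
have P e : [|| e == - j - k, e == j + k, e == j - k | e == k - j] ->
    asel j k e != 0.
  by rewrite /asel; case: (e == _); case: (e == _); case: (e == _);
    case: (e == _) => //= _; rewrite gt_eqF //; lra.
by rewrite !lerD // H // P // eqxx ?orbT.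
Qed.

Variable r : seq Z2.
Hypothesis ur : uniq r.

(** The Hartley coefficients of [u . grad w] when [psi] and [b] are those of the
    stream function of [u] and of [w]. *)
Definition NL (psi b : Z2 -> R) (l : Z2) : R :=
  2^-1 * \sum_(j <- r) \sum_(k <- r) psi j * b k * cross j k * sel j k l.

(** The interaction matrix is skew for each fixed [j], so that symmetric weights
    drop out and only the commutator [w l - w k] survives. *)
Lemma NL_weighted (w psi b : Z2 -> R) :
  \sum_(l <- r) w l ^+ 2 * b l * NL psi b l =
  2^-1 * \sum_(j <- r) psi j * \sum_(k <- r) \sum_(l <- r)
    w l * (w l - w k) * (b l * b k) * (cross j k * sel j k l).
Proof.
have skew0 j : \sum_(k <- r) \sum_(l <- r)
    (w l * w k) * (b l * b k) * (cross j k * sel j k l) = 0.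
  set S := LHS; suff : S = - S by lra.
  rewrite {1}/S exchange_big /= /S -sumrN; apply: eq_bigr => k _.
  rewrite -sumrN; apply: eq_bigr => l _.
  by rewrite sel_skew; ring.
rewrite /NL.
transitivity (\sum_(l <- r) 2^-1 * \sum_(j <- r) \sum_(k <- r)
    w l ^+ 2 * b l * (psi j * b k * cross j k * sel j k l)).
  apply: eq_bigr => l _; rewrite mulrCA; congr (_ * _); rewrite mulr_sumr.
  by apply: eq_bigr => j _; rewrite mulr_sumr.
rewrite -mulr_sumr exchange_big /=; congr (_ * _); apply: eq_bigr => j _.
have -> : \sum_(k <- r) \sum_(l <- r)
      w l * (w l - w k) * (b l * b k) * (cross j k * sel j k l) =
    \sum_(k <- r) \sum_(l <- r) w l ^+ 2 * (b l * b k) * (cross j k * sel j k l).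
  rewrite -[LHS]addr0 -[X in _ + X = _](skew0 j) -big_split /=; apply: eq_bigr => k _.
  by rewrite -big_split /=; apply: eq_bigr => l _; ring.
rewrite exchange_big /= mulr_sumr; apply: eq_bigr => k _.
by rewrite mulr_sumr; apply: eq_bigr => l _; ring.
Qed.

Lemma NL_skew (psi b : Z2 -> R) : \sum_(l <- r) b l * NL psi b l = 0.
Proof.
have := NL_weighted (fun=> 1) psi b.
under eq_bigr do rewrite expr1n mul1r.
move=> ->; rewrite big1 ?mulr0 // => j _; rewrite big1 ?mulr0 // => k _.
by rewrite big1 // => l _; rewrite subrr !(mulr0, mul0r).
Qed.

Section gevrey_estimate.
Variables (sg tau : R).
Hypotheses (sg0 : 0 < sg) (sg1 : sg <= 1) (tau0 : 0 <= tau).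
Hypothesis r0 : forall k, k \in r -> k != 0.
Notation g := (gw sg tau).

Let aux (x x' y z D c f e p : R) :
  [/\ 0 <= y, 0 <= z, 0 <= D, 0 <= f & 0 <= p] ->
  D * e <= tau * f * p * (z * x) -> c <= f * e -> x <= x' ->
  y * D * c <= tau * f ^+ 2 * z * (y * x' * p).
Proof.
move=> [y0 z0 D0 f0 p0] H cfe xx.
have yD : 0 <= y * D by rewrite mulr_ge0.
have yf : 0 <= y * f by rewrite mulr_ge0.
have q0 : 0 <= tau * f ^+ 2 * z * y * p by rewrite !mulr_ge0 ?sqr_ge0.
have h1 := ler_wpM2l yD cfe; have h2 := ler_wpM2l yf H.
have h3 := ler_wpM2l q0 xx.
apply: le_trans h1 _; rewrite [leLHS](_ : _ = y * f * (D * e)); last by ring.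
apply: le_trans h2 _; rewrite [leLHS](_ : _ = tau * f ^+ 2 * z * y * p * x); last by ring.
by apply: le_trans h3 _; rewrite [leLHS](_ : _ = tau * f ^+ 2 * z * (y * x' * p)); last by ring.
Qed.

Lemma commutator_le j k l : j != 0 -> k != 0 -> l != 0 -> asel j k l != 0 ->
  g l * `|g l - g k| * `|cross j k| <=
  tau * fn j ^+ 2 * g j * (g l * g k * Num.min (fn l `^ sg) (fn k `^ sg)).
Proof.
move=> j0 k0 l0 a0.
have lkj : `|fn l - fn k| <= fn j.
  have ljk := asel_freq a0; rewrite asel_sym in a0; have kjl := asel_freq a0.
  exact: ler_norm_sub.
have cc := asel_cross a0; have cjk := cross_le R j k; have cjl := cross_le R j l.
have gk := ltW (gw_gt0 sg tau k); have gl := ltW (gw_gt0 sg tau l).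
have gj := ltW (gw_gt0 sg tau j).
have k00 := fn_ge0 R k; have l00 := fn_ge0 R l; have j00 := fn_ge0 R j.
have [lk|/ltW kl] := leP (fn l) (fn k).
  have H := gw_sub_le sg0 sg1 tau0 k0 l0 j0 lkj lk.
  have pl : fn l `^ sg <= fn k `^ sg by rewrite ge0_ler_powR // ?nnegrE // ltW.
  have gkl : g l <= g k by exact: gw_le.
  rewrite (min_idPl pl) -cc; apply: aux H cjl gkl.
  by split=> //; exact: powR_ge0.
rewrite distrC in lkj; rewrite (distrC (g l)).
have H := gw_sub_le sg0 sg1 tau0 l0 k0 j0 lkj kl.
have pl : fn k `^ sg <= fn l `^ sg by rewrite ge0_ler_powR // ?nnegrE // ltW.
by rewrite (min_idPr pl); apply: aux H cjk (lexx _); split=> //; exact: powR_ge0.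
Qed.

Lemma gevrey_NL (psi b : Z2 -> R) :
  `|\sum_(l <- r) g l ^+ 2 * b l * NL psi b l| <=
  2 * tau * (\sum_(j <- r) `|psi j| * (fn j ^+ 2 * g j)) *
    \sum_(l <- r) fn l `^ sg * (g l * b l) ^+ 2.
Proof.
set Z := \sum_(l <- r) _ `^ _ * _.
have P0 (l : Z2) : 0 <= fn l `^ sg by exact: powR_ge0.
pose z l := fn l `^ sg * (g l * b l) ^+ 2.
have z0 l : 0 <= z l by rewrite mulr_ge0 // sqr_ge0.
have term j k l : j \in r -> k \in r -> l \in r ->
    `|g l * (g l - g k) * (b l * b k) * (cross j k * sel j k l)| <=
    tau * fn j ^+ 2 * g j * (2^-1 * (z l * asel j k l + z k * asel j l k)).
  move=> /r0 j0 /r0 k0 /r0 l0; rewrite (asel_sym j l k).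
  have c0 : 0 <= tau * fn j ^+ 2 * g j.
    by rewrite mulr_ge0 ?gw_ge0 // mulr_ge0 ?sqr_ge0.
  have [a0|a0] := eqVneq (asel j k l) 0.
    have := sel_le j k l; rewrite a0 normr_le0 => /eqP ->.
    by rewrite !mulr0 normr0 addr0 !mulr0.
  have C := commutator_le j0 k0 l0 a0.
  have -> : `|g l * (g l - g k) * (b l * b k) * (cross j k * sel j k l)| =
      (g l * `|g l - g k| * `|cross j k|) * (`|b l| * `|b k|) * `|sel j k l|.
    by rewrite !normrM (gtr0_norm (gw_gt0 _ _ _)); ring.
  rewrite [leRHS](_ : _ = tau * fn j ^+ 2 * g j * (2^-1 * (z l + z k)) * asel j k l);
    last by ring.
  have bb : 0 <= `|b l| * `|b k| by rewrite mulr_ge0.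
  apply: ler_pM (sel_le j k l) => //; first by rewrite !mulr_ge0 ?gw_ge0.
  apply: le_trans (ler_wpM2r bb C) _.
  rewrite -[leLHS]mulrA; apply: ler_wpM2l => //.
  set m := Num.min _ _.
  have m0 : 0 <= m by rewrite le_min !P0.
  have ml : m <= fn l `^ sg by rewrite ge_min lexx.
  have mk : m <= fn k `^ sg by rewrite ge_min lexx orbT.
  apply: (@le_trans _ _ (m * (2^-1 * ((g l * b l) ^+ 2 + (g k * b k) ^+ 2)))).
    rewrite [leLHS](_ : _ = m * ((g l * `|b l|) * (g k * `|b k|))); last by ring.
    rewrite ler_wpM2l // -(real_normK (num_real (g l * b l))).
    rewrite -(real_normK (num_real (g k * b k))) !normrM !(gtr0_norm (gw_gt0 _ _ _)).
    by set x := g l * _; set y := g k * _; have := sqr_ge0 (x - y); lra.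
  rewrite mulrCA ler_wpM2l // mulrDr lerD // ler_wpM2r ?sqr_ge0 //.
rewrite NL_weighted normrM ger0_norm //.
have Z0 : 0 <= Z by apply: sumr_ge0 => l _; exact: z0.
apply: (@le_trans _ _ (2^-1 * \sum_(j <- r) `|psi j| * (tau * fn j ^+ 2 * g j * (4 * Z)))).
  rewrite ler_wpM2l //; apply: le_trans (ler_norm_sum _ _ _) _.
  rewrite big_seq [leRHS]big_seq; apply: ler_sum => j jr; rewrite normrM.
  rewrite ler_wpM2l //.
  have c0 : 0 <= tau * fn j ^+ 2 * g j.
    by rewrite mulr_ge0 ?gw_ge0 // mulr_ge0 ?sqr_ge0.
  apply: (@le_trans _ _ (\sum_(k <- r) \sum_(l <- r) tau * fn j ^+ 2 * g j *
      (2^-1 * (z l * asel j k l + z k * asel j l k)))).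
    apply: le_trans (ler_norm_sum _ _ _) _.
    rewrite big_seq [leRHS]big_seq; apply: ler_sum => k kr.
    apply: le_trans (ler_norm_sum _ _ _) _.
    rewrite big_seq [leRHS]big_seq; apply: ler_sum => l lr; exact: term.
  under eq_bigr do rewrite -mulr_sumr -mulr_sumr big_split /=.
  rewrite -mulr_sumr -mulr_sumr ler_wpM2l // big_split /=.
  have S1 : \sum_(k <- r) \sum_(l <- r) z k * asel j l k <= 4 * Z.
    rewrite mulr_sumr; apply: ler_sum => k _; rewrite -mulr_sumr mulrC.
    rewrite ler_wpM2r //; under eq_bigr do rewrite asel_sym -[asel _ _ _]mul1r.
    by rewrite -[4]mulr1; exact: sum_asel_le.
  have S2 : \sum_(k <- r) \sum_(l <- r) z l * asel j k l <= 4 * Z.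
    by rewrite exchange_big.
  by lra.
rewrite le_eqVlt; apply/orP; left; apply/eqP.
have E j : `|psi j| * (tau * fn j ^+ 2 * g j * (4 * Z)) =
    (4 * tau * Z) * (`|psi j| * (fn j ^+ 2 * g j)) by ring.
under eq_bigr do rewrite E; rewrite -mulr_sumr.
by move: (\sum_(j <- r) _) => S; field.
Qed.
End gevrey_estimate.
End interaction.

Lemma is_derive_expR_comp (R : realType) (f : R -> R) (x df : R) :
  is_derive x 1 f df -> is_derive x 1 (fun t => expR (f t)) (expR (f x) * df).
Proof. by move=> fdf; apply: is_derive1_comp. Qed.

Section galerkin.
Variables (R : realType) (nu alpha : R).
Hypotheses (nu0 : 0 < nu) (alpha0 : 0 < alpha).
Notation fsq := (freq_sq R).
Notation fn := (freq_norm R).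

Definition helm (k : Z2) : R := 1 + alpha ^+ 2 * fsq k.
Definition stream (a : Z2 -> R) (k : Z2) : R := - a k / (fsq k * helm k).
Definition damping (k : Z2) : R := nu * fsq k / helm k.

Lemma helm_ge1 k : 1 <= helm k.
Proof. by rewrite lerDl mulr_ge0 ?sqr_ge0 ?freq_sq_ge0. Qed.

Lemma helm_gt0 k : 0 < helm k.
Proof. exact: lt_le_trans (helm_ge1 k). Qed.

Lemma damping_ge0 k : 0 <= damping k.
Proof. by rewrite divr_ge0 ?mulr_ge0 ?freq_sq_ge0 // ltW // helm_gt0. Qed.

Lemma damping_ge k : k != 0 -> nu / (2 + 2 * alpha ^+ 2) <= damping k.
Proof.
move=> /(freq_sq_ge1 R) k1; have a2 : 0 <= alpha ^+ 2 by exact: sqr_ge0.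
rewrite ler_pdivlMr ?helm_gt0 // mulrAC ler_pdivrMr; last lra.
rewrite -mulrA ler_wpM2l ?(ltW nu0) // /helm.
by move: (alpha ^+ 2) (fsq k) a2 k1 => x y x0 y1; nra.
Qed.

Lemma damping_le k : damping k <= nu / alpha ^+ 2.
Proof.
rewrite ler_pdivrMr ?helm_gt0 // mulrAC ler_pdivlMr ?exprn_gt0 //.
by rewrite -mulrA ler_wpM2l ?(ltW nu0) // mulrC /helm lerDr.
Qed.

Lemma stream_le (a : Z2 -> R) k : k != 0 ->
  `|stream a k| * fsq k = `|a k| / helm k.
Proof.
move=> /(freq_sq_ge1 R) k1; have k0 : 0 < fsq k by exact: lt_le_trans k1.
rewrite /stream normrM normrN normfV (gtr0_norm (mulr_gt0 k0 (helm_gt0 k))).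
by field; rewrite !gt_eqF ?helm_gt0.
Qed.

Section truncated.
Variable N : nat.

Definition galerkin (h : Z2 -> R) (l : Z2) : R :=
  if l \in box N then - damping l * h l - NL (box N) (stream h) h l else 0.

Lemma galerkin_lipschitz (M : R) : exists2 L, 0 <= L & forall x y i,
  (forall j, j \in box N -> `|x j| <= M) ->
  (forall j, j \in box N -> `|y j| <= M) ->
  `|galerkin x i - galerkin y i| <= L * \sum_(j <- box N) `|x j - y j|.
Proof.
pose c j k l := `|(fsq j * helm j)^-1| * `|cross R j k * sel R j k l|.
pose L1 := nu / alpha ^+ 2.
pose D := \sum_(l <- box N) \sum_(j <- box N) \sum_(k <- box N) c j k l.
have D0 : 0 <= D.
  by do 3 (apply: sumr_ge0 => ? _); rewrite mulr_ge0.
have L10 : 0 <= L1 by rewrite divr_ge0 ?sqr_ge0 // ltW.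
exists (L1 + 2^-1 * (`|M| * 2 * D)).
  by rewrite addr_ge0 // !mulr_ge0.
move=> x y i xM yM; pose S := \sum_(j <- box N) `|x j - y j|.
have S0 : 0 <= S by apply: sumr_ge0.
have xyS j : j \in box N -> `|x j - y j| <= S.
  by move=> jN; rewrite /S (big_rem j) //= lerDl sumr_ge0.
have MM : M <= `|M| by exact: ler_norm.
rewrite /galerkin; case: ifP => iN; last first.
  by rewrite subrr normr0 !mulr_ge0 // addr_ge0 // !mulr_ge0.
rewrite -/S mulrDl.
rewrite (_ : _ - _ = - damping i * (x i - y i) -
  (NL (box N) (stream x) x i - NL (box N) (stream y) y i)); last by ring.
apply: le_trans (ler_normB _ _) _; apply: lerD.
  rewrite normrM normrN (ger0_norm (damping_ge0 i)).
  by apply: ler_pM; [exact: damping_ge0|exact: normr_ge0|exact: damping_le|exact: xyS].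
rewrite /NL -mulrBr normrM (@ger0_norm _ 2^-1) // -[leRHS]mulrA.
apply: ler_wpM2l => //.
rewrite -sumrB; apply: le_trans (ler_norm_sum _ _ _) _.
apply: (@le_trans _ _ (\sum_(j <- box N) \sum_(k <- box N) c j k i * (`|M| * 2 * S))).
  rewrite big_seq [leRHS]big_seq; apply: ler_sum => j jN; rewrite -sumrB.
  apply: le_trans (ler_norm_sum _ _ _) _.
  rewrite big_seq [leRHS]big_seq; apply: ler_sum => k kN.
  rewrite /stream (_ : _ - _ = - (((fsq j * helm j)^-1 * (cross R j k * sel R j k i)) *
     (x j * (x k - y k) + (x j - y j) * y k))); last by ring.
  rewrite normrN normrM normrM; apply: ler_wpM2l; first by rewrite mulr_ge0.
  apply: le_trans (ler_normD _ _) _; rewrite !normrM -mulrA mulrCA mulr_natl mulr2n.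
  rewrite [X in _ + X]mulrC; apply: lerD; apply: ler_pM => //; rewrite ?xyS //.
    exact: le_trans (xM _ jN) MM.
  exact: le_trans (yM _ kN) MM.
rewrite (eq_bigr (fun j => (\sum_(k <- box N) c j k i) * (`|M| * 2 * S))); last first.
  by move=> j _; rewrite mulr_suml.
rewrite -mulr_suml mulrC -!mulrA; do 2 (apply: ler_wpM2l => //).
rewrite mulrC; apply: ler_wpM2r => //.
rewrite /D [leRHS](big_rem i) //= lerDl.
by do 3 (apply: sumr_ge0 => ? _); rewrite mulr_ge0.
Qed.

Lemma galerkin_solution (a : Z2 -> R) : exists h : R -> Z2 -> R,
  [/\ forall k, h 0 k = if k \in box N then a k else 0,
      forall (t : R) k, 0 <= t -> is_derive t 1 (h^~ k) (galerkin (h t) k),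
      forall t k, 0 <= t -> k \notin box N -> h t k = 0 &
      forall t : R, 0 <= t ->
        \sum_(k <- box N) h t k ^+ 2 <= \sum_(k <- box N) a k ^+ 2].
Proof.
have [|x|h [h0 hG hE]] := @ode_dissipative R _ (box N) galerkin
    (fun k => if k \in box N then a k else 0) galerkin_lipschitz.
- move=> i; rewrite /galerkin; case: ifP => // _.
  by rewrite mulr0 sub0r /NL big1 ?mulr0 ?oppr0 // => j _; rewrite big1 // => k _; rewrite mulr0 !mul0r.
- rewrite (eq_big_seq (fun i => - damping i * x i ^+ 2 - x i * NL (box N) (stream x) x i)).
    rewrite sumrB NL_skew ?box_uniq // subr0; apply: sumr_le0 => i _.
    by rewrite mulNr oppr_le0 mulr_ge0 ?damping_ge0 // sqr_ge0.
  by move=> i iN; rewrite /galerkin iN; ring.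
exists h; split=> //.
- by move=> k; rewrite h0.
- move=> t k t0 kN.
  have [c|c /andP[c0 _]] := @MVT_derive R (h^~ k) (fun s => galerkin (h s) k) 0 t t0.
    by move=> /andP[c0 _]; exact: hG.
  by rewrite /galerkin (negPf kN) mul0r h0 (negPf kN) subr0.
- move=> t /hE/le_trans; apply; rewrite big_seq [leRHS]big_seq.
  by apply: ler_sum => k ->.
Qed.
End truncated.

(** The radius of Gevrey regularity: it solves
    [tau' = - (20 M / alpha) exp (- lm t) tau], where [exp (- lm t)] is the decay
    of the Gevrey norm itself. *)
Definition lm : R := nu / (2 + 2 * alpha ^+ 2).
Definition radius (tau0 M t : R) : R :=
  tau0 * expR (- (20 * M / alpha * ((1 - expR (- (lm * t))) / lm))).

Lemma lm_gt0 : 0 < lm.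
Proof. by rewrite divr_gt0 // ltr_wpDr // mulr_ge0 // sqr_ge0. Qed.

Lemma radius_gt0 tau0 M t : 0 < tau0 -> 0 < radius tau0 M t.
Proof. by move=> t0; rewrite mulr_gt0 // expR_gt0. Qed.

Lemma is_derive_radius (tau0 M t : R) : is_derive t 1 (radius tau0 M)
  (- (20 * M / alpha * expR (- (lm * t))) * radius tau0 M t).
Proof.
have lm0 := lm_gt0.
have d1 : is_derive t 1 (fun t => - (lm * t)) (- lm).
  by apply: is_derive_eq; rewrite /GRing.scale /=; ring.
have d2 := is_derive_expR_comp d1.
have d3 : is_derive t 1 (fun t => - (20 * M / alpha * ((1 - expR (- (lm * t))) / lm)))
    (- (20 * M / alpha * expR (- (lm * t)))).
  rewrite (_ : (fun t => _) = (20 * M / alpha / lm) \*: (fun t => expR (- (lm * t)))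
    + cst (- (20 * M / alpha / lm))); last first.
    apply/funext => u; rewrite -[RHS]/(20 * M / alpha / lm * expR (- (lm * u))
     - 20 * M / alpha / lm); field; rewrite !gt_eqF //.
  apply: is_derive_eq; rewrite /GRing.scale /=; field; rewrite !gt_eqF //.
have d4 := is_derive_expR_comp d3.
by rewrite /radius; apply: is_derive_eq; rewrite /GRing.scale /=; ring.
Qed.

Lemma sum_stream_le N (h g : Z2 -> R) (B : R) : 0 <= B ->
  (forall k, 0 <= g k) -> \sum_(k <- box N) (g k * h k) ^+ 2 <= B ^+ 2 ->
  \sum_(j <- box N) `|stream h j| * (fn j ^+ 2 * g j) <= 5 / alpha * B.
Proof.
move=> B0 g0 YB.
have E j : j \in box N -> `|stream h j| * (fn j ^+ 2 * g j) =
    (helm j)^-1 * (`|h j| * g j).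
  by move=> /box_neq0 j0; rewrite mulrA fn_sqr (stream_le h j0) mulrAC mulrC.
rewrite (eq_big_seq _ E).
have c0 : 0 <= 5 / alpha * B by rewrite mulr_ge0 // divr_ge0 // ltW.
rewrite -(@ler_pXn2r _ 2) ?nnegrE //; last first.
  apply: sumr_ge0 => j _.
  by apply: mulr_ge0; [rewrite invr_ge0 ltW ?helm_gt0 | exact: mulr_ge0].
apply: le_trans (cauchy_schwarz _ _ _) _; rewrite exprMn; apply: ler_pM.
- by apply: sumr_ge0 => j _; exact: sqr_ge0.
- by apply: sumr_ge0 => j _; exact: sqr_ge0.
- rewrite expr_div_n (_ : 5 ^+ 2 = 25 :> R); last by ring.
  apply: le_trans (sum_helmholtz_le N alpha0).
  by under eq_bigr do rewrite exprVn.
- apply: le_trans YB; apply: ler_sum => j _.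
  by rewrite exprMn real_normK ?num_real // -exprMn mulrC.
Qed.

Section gevrey_bound.
Variables (sg tau0 M : R) (N : nat) (a : Z2 -> R) (h : R -> Z2 -> R).
Hypotheses (sg0 : 0 < sg) (sg1 : sg <= 1) (tau00 : 0 < tau0) (M0 : 0 <= M).
Hypothesis h0 : forall k, h 0 k = if k \in box N then a k else 0.
Hypothesis hG : forall (t : R) k, 0 <= t ->
  is_derive t 1 (h^~ k) (galerkin N (h t) k).
Hypothesis hE : forall t : R, 0 <= t ->
  \sum_(k <- box N) h t k ^+ 2 <= \sum_(k <- box N) a k ^+ 2.
Hypothesis aM : \sum_(k <- box N) (gw sg tau0 k * a k) ^+ 2 <= M ^+ 2.

Let tau := radius tau0 M.
Let g t := gw sg (tau t).
Let Q t := \sum_(k <- box N) (expR (lm * t) * (g t k * h t k)) ^+ 2.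
Let rate t := - (20 * M / alpha * expR (- (lm * t))) * tau t.
Let dQ t := \sum_(k <- box N) 2 * (expR (lm * t) * (g t k * h t k)) *
  (expR (lm * t) * (g t k * ((lm + rate t * fn k `^ sg) * h t k + galerkin N (h t) k))).

Let is_derive_Q (t : R) : 0 <= t -> is_derive t 1 Q (dQ t).
Proof.
move=> t0; apply: is_derive_sumr => k; set p := fn k `^ sg.
have d1 : is_derive t 1 (fun t => lm * t + tau t * p) (lm + rate t * p).
  have d := is_derive_radius tau0 M t.
  by apply: is_derive_eq; rewrite /rate /tau /GRing.scale /=; ring.
have d2 := is_derive_expR_comp d1.
have d3 := hG k t0.
rewrite (_ : (fun y => _) = (fun t => expR (lm * t + tau t * p)) * (h^~ k) *
   ((fun t => expR (lm * t + tau t * p)) * (h^~ k))); last first.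
  apply/funext => y; rewrite /g gw.unlock -/p.
  rewrite -[RHS]/((expR (lm * y + tau y * p) * h y k) *
    (expR (lm * y + tau y * p) * h y k)).
  by rewrite expRD; ring.
have d4 : is_derive t 1 ((fun t => expR (lm * t + tau t * p)) * (h^~ k))
   (expR (lm * t) * (g t k * ((lm + rate t * p) * h t k + galerkin N (h t) k))).
  move: (galerkin N (h t) k) d3 => c d3.
  apply: is_derive_eq; rewrite /g gw.unlock -/p expRD /GRing.scale /=; ring.
apply: is_derive_eq; rewrite /g gw.unlock -/p -[_ t]/(expR (lm * t + tau t * p) * h t k).
rewrite expRD /GRing.scale /=; ring.
Qed.

Let dQ_le0 (t : R) : 0 <= t -> 0 < M -> Q t < 4 * M ^+ 2 -> dQ t <= 0.
Proof.
move=> t0 M0' QM; set e := expR (lm * t); have e0 : 0 < e by exact: expR_gt0.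
have tau_ge0 : 0 <= tau t by exact/ltW/radius_gt0.
pose Z := \sum_(k <- box N) fn k `^ sg * (g t k * h t k) ^+ 2.
have Z0 : 0 <= Z.
  by apply: sumr_ge0 => k _; rewrite mulr_ge0 ?powR_ge0 ?sqr_ge0.
pose S := \sum_(j <- box N) `|stream (h t) j| * (fn j ^+ 2 * g t j).
have SB : S <= 5 / alpha * (2 * M / e).
  apply: sum_stream_le => [|k|]; first by rewrite divr_ge0 ?mulr_ge0 // ltW.
    exact: gw_ge0.
  rewrite expr_div_n ler_pdivlMr ?exprn_gt0 // exprMn (_ : 2 ^+ 2 = 4 :> R); last by ring.
  apply: le_trans (ltW QM); rewrite /Q -/e mulrC mulr_sumr.
  by apply: ler_sum => k _; rewrite -exprMn.
pose I := \sum_(k <- box N) g t k ^+ 2 * h t k * NL (box N) (stream (h t)) (h t) k.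
have IB : `|I| <= 2 * tau t * S * Z.
  by apply: gevrey_NL; rewrite ?box_uniq // => k; exact: box_neq0.
have dQE : dQ t <= 2 * e ^+ 2 * (rate t * Z - I).
  rewrite /dQ -/e mulrBr /Z !mulr_sumr -sumrB big_seq [leRHS]big_seq.
  apply: ler_sum => k kN; rewrite /galerkin kN -subr_ge0.
  set p := _ `^ _; set c := NL _ _ _ _.
  rewrite (_ : _ - _ = 2 * (e * (g t k * h t k)) ^+ 2 * (damping k - lm)); last first.
    by move: (g t k) (h t k) (rate t) (damping k) => *; ring.
  apply: mulr_ge0; first by rewrite mulr_ge0 ?sqr_ge0.
  by rewrite subr_ge0; exact/damping_ge/(box_neq0 kN).
apply: le_trans dQE _; rewrite pmulr_rle0 ?mulr_gt0 ?exprn_gt0 //.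
rewrite subr_le0; apply: (@le_trans _ _ (- `|I|)); last first.
  by rewrite lerNl -normrN ler_norm.
rewrite lerNr; apply: le_trans IB _.
rewrite -mulNr ler_wpM2r // /rate mulNr opprK expRN -/e.
rewrite [leRHS](_ : _ = 2 * tau t * (5 / alpha * (2 * M / e))).
  by rewrite ler_wpM2l // mulr_ge0.
by field; rewrite !gt_eqF.
Qed.

(** The constant [20] leaves a factor [4] between the initial size of [Q] and the
    size below which [Q] decreases, so that [Q] never leaves its initial range. *)
Lemma galerkin_gevrey (t : R) : 0 <= t ->
  \sum_(k <- box N) (gw sg (radius tau0 M t) k * h t k) ^+ 2 <= M ^+ 2.
Proof.
move=> t0; have [M00|Mp] := eqVneq M 0.
  have a0 k : k \in box N -> a k = 0.
    move=> kN; have : (gw sg tau0 k * a k) ^+ 2 <= 0.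
      have M2 : M ^+ 2 = 0 by rewrite M00 expr0n.
      rewrite -[leRHS]M2.
      apply: le_trans aM; rewrite (big_rem k) //= lerDl.
      by apply: sumr_ge0 => i _; exact: sqr_ge0.
    rewrite le_eqVlt ltNge sqr_ge0 orbF sqrf_eq0 mulf_eq0.
    by rewrite (gt_eqF (gw_gt0 _ _ _)) => /eqP.
  have hk k : k \in box N -> h t k = 0.
    move=> kN; have : h t k ^+ 2 <= 0.
      have A0 : \sum_(k <- box N) a k ^+ 2 = 0.
        by rewrite big1_seq // => i /andP[_ iN]; rewrite a0 // expr0n.
      rewrite -[leRHS]A0; apply: le_trans (hE t0).
      by rewrite (big_rem k) //= lerDl; apply: sumr_ge0 => i _; exact: sqr_ge0.
    by rewrite le_eqVlt ltNge sqr_ge0 orbF sqrf_eq0 => /eqP.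
  rewrite big1_seq ?sqr_ge0 // => k /andP[_ kN].
  by rewrite hk // mulr0 expr0n.
have {}Mp : 0 < M by rewrite lt_neqAle eq_sym Mp.
have M2 : 0 < M ^+ 2 by rewrite exprn_gt0.
have QM : Q t <= M ^+ 2.
  apply: (@barrier R Q dQ (M ^+ 2) (4 * M ^+ 2)) => //.
  - by rewrite ltr_pMl // ltr1n.
  - apply: le_trans aM; rewrite /Q mulr0 expR0 big_seq [leRHS]big_seq.
    apply: ler_sum => k kN; rewrite mul1r h0 kN /g /tau /radius mulr0 oppr0 expR0.
    by rewrite subrr mul0r mulr0 oppr0 expR0 mulr1.
  - by move=> u u0; exact: dQ_le0.
apply: le_trans QM; apply: ler_sum => k _.
rewrite [leRHS]exprMn ler_peMl ?sqr_ge0 // exprn_ege1 //.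
by rewrite -expR0 ler_expR mulr_ge0 // ltW // lm_gt0.
Qed.
End gevrey_bound.
End galerkin.

Lemma continuous_measurable2 (R : realType) (v : R * R -> R) :
  continuous v -> measurable_fun [set: R * R] v.
Proof.
move=> cv; apply: (measurability _ (RGenOpens.measurableE R)).
move=> _ [_ [l [r ->]] <-]; rewrite setTI.
have oV : open (v @^-1` `]l, r[%classic).
  by apply: open_comp => [z _|]; [exact: cv | exact: interval_open].
move: `]l, r[%classic oV => U oV; set V := v @^-1` U in oV *.
pose D (a b e : rat) : set (R * R) :=
  `]ratr a - ratr e, ratr a + ratr e[%classic `*`
  `]ratr b - ratr e, ratr b + ratr e[%classic.
have -> : V = \bigcup_(a : rat) \bigcup_(b : rat) \bigcup_(e : rat)
    (if `[< D a b e `<=` V >] then D a b e else set0).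
  apply/seteqP; split=> z.
    move=> Vz; have /nbhs_ballP[e /= e0 eV] : nbhs z V by exact: open_nbhs_nbhs.
    have [q /andP[q0 qe]] : exists q : rat, 0 < (ratr q : R) < e / 2.
      have /rat_in_itvoo[q] : 0 < e / 2 by rewrite divr_gt0.
      by rewrite in_itv /=; exists q.
    have near x : exists a : rat, `|x - ratr a| < ratr q :> R.
      have /rat_in_itvoo[a] : x - ratr q < x + ratr q by rewrite ltrD2l gtrN.
      by rewrite in_itv /= => aq; exists a; rewrite ltr_norml; lra.
    have [a za] := near z.1; have [b zb] := near z.2.
    exists a => //; exists b => //; exists q => //; case: asboolP.
      by move=> _; split; rewrite /= in_itv /=; move: za zb; rewrite !ltr_norml; lra.
    case=> -[x y] [/=]; rewrite !in_itv /= => ax by_; apply: eV; split => /=;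
      rewrite /ball /= ltr_norml; move: za zb; rewrite !ltr_norml; lra.
  by case=> a _ [b _ [e _]]; case: asboolP => // DV; exact: DV.
apply: bigcupT_measurable_rat => a; apply: bigcupT_measurable_rat => b.
apply: bigcupT_measurable_rat => e; case: ifP => _; last exact: measurable0.
by apply: measurableX; exact: measurable_itv.
Qed.

Lemma cvg_pair2 (T : Type) (U V : topologicalType) (F : set_system T)
    (FF : Filter F) (f : T -> U) (g : T -> V) (a : U) (b : V) :
  f @ F --> a -> g @ F --> b -> (fun x => (f x, g x)) @ F --> (a, b).
Proof. exact: (@cvg_pair T U V F (nbhs a) (nbhs b) _ _ _ f g). Qed.

Section torus.
Variable R : realType.
Implicit Types v w : R * R -> R.
Notation mu := (leb2 R).
Notation Q := (square R).

Lemma measurable_square : measurable (Q : set (R * R)).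
Proof. by apply: measurableX; exact: measurable_itv. Qed.

Lemma measure_square : mu Q = ((2 * pi) ^+ 2)%:E.
Proof.
rewrite /square product_measure1E; [|exact: measurable_itv|exact: measurable_itv].
have p0 : (0 : R) < 2 * pi by rewrite mulr_gt0 // pi_gt0.
have L : lebesgue_measure (`[0%R, 2 * pi]%classic : set R) = (2 * pi)%:E.
  by rewrite lebesgue_measure_itv /= lte_fin p0 oppr0 adde0.
by rewrite expr2 EFinM; exact: (congr2 (fun a b => a * b)%E L L).
Qed.

(** Bounded measurable functions: a class of integrands closed under all the
    operations met below. *)
Definition tame v : Prop :=
  measurable_fun [set: R * R] v /\ exists M, forall z, Q z -> `|v z| <= M.

Lemma tame_integrable v : tame v -> mu.-integrable Q (fun z => (v z)%:E).
Proof.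
move=> [mv [M vM]]; apply: measurable_bounded_integrable.
- exact: measurable_square.
- by rewrite [X in (X < _)%E]measure_square ltry.
- exact: measurable_funTS.
- exists M; split; first exact: num_real.
  by move=> M' MM' z Qz; apply: le_trans (vM z Qz) (ltW MM').
Qed.

Lemma tameD v w : tame v -> tame w -> tame (fun z => v z + w z).
Proof.
move=> [mv [M vM]] [mw [N wN]]; split; first exact: measurable_funD.
exists (M + N) => z Qz; apply: le_trans (ler_normD _ _) _.
by rewrite lerD ?vM ?wN.
Qed.

Lemma tameM v w : tame v -> tame w -> tame (fun z => v z * w z).
Proof.
move=> [mv [M vM]] [mw [N wN]]; split; first exact: measurable_funM.
by exists (M * N) => z Qz; rewrite normrM ler_pM ?vM ?wN.
Qed.

Lemma tame_cst (c : R) : tame (fun=> c).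
Proof. by split; [exact: measurable_cst | exists `|c|]. Qed.

Lemma tameN v : tame v -> tame (fun z => - v z).
Proof.
move=> tv; rewrite (_ : (fun z => _) = (fun z => (-1) * v z)).
  by apply: tameM => //; exact: tame_cst.
by apply/funext => z; rewrite mulN1r.
Qed.

Lemma tameB v w : tame v -> tame w -> tame (fun z => v z - w z).
Proof. by move=> tv tw; apply: tameD => //; exact: tameN. Qed.

Lemma compact_square : compact (Q : set (R * R)).
Proof. by apply: compact_setX; exact: segment_compact. Qed.

Lemma continuous_tame v : continuous v -> tame v.
Proof.
move=> cv; split; first exact: continuous_measurable2.
have : compact (v @` Q).
  apply: continuous_compact compact_square.
  exact: continuous_subspaceT.
move=> /compact_bounded[M [_ vM]]; exists (M + 1) => z Qz.
by apply: vM; [rewrite ltrDl | exists z].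
Qed.

Lemma tame_sum (I : Type) (s : seq I) (f : I -> R * R -> R) :
  (forall i, tame (f i)) -> tame (fun z => \sum_(i <- s) f i z).
Proof.
move=> tf; elim: s => [|i s IH].
  rewrite (_ : (fun z => _) = (fun=> 0)); first exact: tame_cst.
  by apply/funext => z; rewrite big_nil.
rewrite (_ : (fun z => _) = (fun z => f i z + \sum_(j <- s) f j z)).
  exact: tameD.
by apply/funext => z; rewrite big_cons.
Qed.

Lemma torus_intD v w : tame v -> tame w ->
  torus_int (fun z => v z + w z) = torus_int v + torus_int w.
Proof.
move=> /tame_integrable iv /tame_integrable iw.
by apply: RintegralD => //; exact: measurable_square.
Qed.

Lemma torus_intB v w : tame v -> tame w ->
  torus_int (fun z => v z - w z) = torus_int v - torus_int w.
Proof.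
move=> /tame_integrable iv /tame_integrable iw.
by apply: RintegralB => //; exact: measurable_square.
Qed.

Lemma torus_intZ (c : R) v : tame v -> torus_int (fun z => c * v z) = c * torus_int v.
Proof.
move=> /tame_integrable iv.
by apply: RintegralZl => //; exact: measurable_square.
Qed.

Lemma torus_int_cst (c : R) : torus_int (fun=> c) = (2 * pi) ^+ 2 * c.
Proof.
rewrite /torus_int Rintegral_cst; last exact: measurable_square.
by rewrite [X in fine X]measure_square mulrC.
Qed.

Lemma torus_int_sum (I : Type) (s : seq I) (f : I -> R * R -> R) :
  (forall i, tame (f i)) ->
  torus_int (fun z => \sum_(i <- s) f i z) = \sum_(i <- s) torus_int (f i).
Proof.
move=> tf; elim: s => [|i s IH].
  rewrite big_nil (_ : (fun z => _) = (fun=> 0)); first by rewrite torus_int_cst mulr0.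
  by apply/funext => z; rewrite big_nil.
rewrite big_cons -IH -torus_intD //; last exact: tame_sum.
by congr torus_int; apply/funext => z; rewrite big_cons.
Qed.

Lemma torus_int_le v w : tame v -> tame w -> (forall z, Q z -> v z <= w z) ->
  torus_int v <= torus_int w.
Proof.
move=> /tame_integrable iv /tame_integrable iw vw.
by apply: le_Rintegral => //; exact: measurable_square.
Qed.

Lemma torus_int_eq v w : (forall z, Q z -> v z = w z) -> torus_int v = torus_int w.
Proof. by move=> vw; apply: eq_Rintegral => z; rewrite inE; exact: vw. Qed.

Lemma torus_int_norm_le v (M : R) : tame v -> (forall z, Q z -> `|v z| <= M) ->
  `|torus_int v| <= (2 * pi) ^+ 2 * M.
Proof.
move=> tv vM; rewrite ler_norml; apply/andP; split.
  rewrite -mulrN -torus_int_cst; apply: torus_int_le => //; first exact: tame_cst.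
  by move=> z Qz; rewrite lerNl; apply: le_trans (vM z Qz); rewrite -normrN ler_norm.
rewrite -torus_int_cst; apply: torus_int_le => //; first exact: tame_cst.
by move=> z Qz; apply: le_trans (vM z Qz); rewrite ler_norm.
Qed.

Let shift1 (h x y : R) : h *: ((1, 0) : R * R) + (x, y) = (h *: (1 : R) + x, y).
Proof. by apply: injective_projections => //=; rewrite scaler0 add0r. Qed.

Let shift2 (h x y : R) : h *: ((0, 1) : R * R) + (x, y) = (x, h *: (1 : R) + y).
Proof. by apply: injective_projections => //=; rewrite scaler0 add0r. Qed.

Lemma is_derive_slice1 v (x y d : R) :
  is_derive (x, y) ((1, 0) : R * R) v d <-> is_derive x 1 (fun x => v (x, y)) d.
Proof.
have E : (fun h : R => h^-1 *: ((v \o shift (x, y)) (h *: ((1, 0) : R * R)) - v (x, y))) =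
  (fun h : R => h^-1 *: (((fun x => v (x, y)) \o shift x) (h *: (1 : R)) - v (x, y))).
  by apply/funext => h /=; rewrite shift1.
split=> -[dv vE]; split.
- by rewrite /derivable -E.
- by rewrite -vE /derive -E.
- by rewrite /derivable E.
- by rewrite -vE /derive E.
Qed.

Lemma is_derive_slice2 v (x y d : R) :
  is_derive (x, y) ((0, 1) : R * R) v d <-> is_derive y 1 (fun y => v (x, y)) d.
Proof.
have E : (fun h : R => h^-1 *: ((v \o shift (x, y)) (h *: ((0, 1) : R * R)) - v (x, y))) =
  (fun h : R => h^-1 *: (((fun y => v (x, y)) \o shift y) (h *: (1 : R)) - v (x, y))).
  by apply/funext => h /=; rewrite shift2.
split=> -[dv vE]; split.
- by rewrite /derivable -E.
- by rewrite -vE /derive -E.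
- by rewrite /derivable E.
- by rewrite -vE /derive E.
Qed.

(** Fubini's theorem, the fundamental theorem of calculus and periodicity. *)
Lemma torus_int_d1 v dv : Defs.periodic v -> continuous dv ->
  (forall z, is_derive z ((1, 0) : R * R) v (dv z)) -> torus_int dv = 0.
Proof.
move=> pv cdv vdv.
have tdv := continuous_tame cdv.
have idv := tame_integrable tdv.
have p0 : (0 : R) < 2 * pi by rewrite mulr_gt0 // pi_gt0.
have sec (y : R) : (\int[leb R]_(x in `[0%R, (2 * pi)%R]) (dv (x, y))%:E)%E = 0%E.
  have dE (x : R) : is_derive x 1 (fun x => v (x, y)) (dv (x, y)).
    exact/is_derive_slice1.
  have cv (x : R) : (fun x => v (x, y)) @ x --> v (x, y) by exact: is_derive_cvg (dE x).
  rewrite (@continuous_FTC2 R (fun x => dv (x, y)) (fun x => v (x, y)) 0 (2 * pi)) //.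
  - by have [E _] := pv 0 y; rewrite add0r in E; rewrite E subee.
  - apply: continuous_subspaceT => x.
    apply: (@continuous_comp R (R * R)%type R (fun x => (x, y)) dv x); last exact: cdv.
    by apply: cvg_pair2; [exact: cvg_id | exact: cvg_cst].
  - split.
    + by move=> x _; have [] := dE x.
    + by apply: cvg_at_right_filter; exact: cv.
    + by apply: cvg_at_left_filter; exact: cv.
  - by move=> x _; rewrite derive1E; case: (dE x).
pose f := ((fun z => (dv z)%:E) \_ Q)%E.
have If := (@integrable_mkcond _ _ R mu Q (fun z => (dv z)%:E) measurable_square).1 idv.
rewrite /torus_int /Rintegral integral_mkcond -/f.
rewrite -(integral21_prod_meas1 If) (_ : (fun y => _) = cst 0%E).
  by rewrite integral0.
apply/funext => y /=.
have [yI|yI] := boolP (y \in `[0, 2 * pi]); last first.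
  apply: integral0_eq => x _; rewrite /f patchE ifF //; apply/negbTE/negP.
  by rewrite inE => -[_] /=; apply/negP.
transitivity (\int[leb R]_(x in `[0%R, (2 * pi)%R]) (dv (x, y))%:E)%E.
  rewrite [RHS]integral_mkcond; apply: eq_integral => x _.
  rewrite /f !patchE; congr (if _ then _ else _).
  by apply/idP/idP; rewrite !inE; [case | move=> xI; split].
exact: sec.
Qed.
Lemma torus_int_d2 v dv : Defs.periodic v -> continuous dv ->
  (forall z, is_derive z ((0, 1) : R * R) v (dv z)) -> torus_int dv = 0.
Proof.
move=> pv cdv vdv.
have tdv := continuous_tame cdv.
have idv := tame_integrable tdv.
have p0 : (0 : R) < 2 * pi by rewrite mulr_gt0 // pi_gt0.
have sec (x : R) : (\int[leb R]_(y in `[0%R, (2 * pi)%R]) (dv (x, y))%:E)%E = 0%E.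
  have dE (y : R) : is_derive y 1 (fun y => v (x, y)) (dv (x, y)).
    exact/is_derive_slice2.
  have cv (y : R) : (fun y => v (x, y)) @ y --> v (x, y) by exact: is_derive_cvg (dE y).
  rewrite (@continuous_FTC2 R (fun y => dv (x, y)) (fun y => v (x, y)) 0 (2 * pi)) //.
  - by have [_ E] := pv x 0; rewrite add0r in E; rewrite E subee.
  - apply: continuous_subspaceT => y.
    apply: (@continuous_comp R (R * R)%type R (fun y => (x, y)) dv y); last exact: cdv.
    by apply: cvg_pair2; [exact: cvg_cst | exact: cvg_id].
  - split.
    + by move=> y _; have [] := dE y.
    + by apply: cvg_at_right_filter; exact: cv.
    + by apply: cvg_at_left_filter; exact: cv.
  - by move=> y _; rewrite derive1E; case: (dE y).
pose f := ((fun z => (dv z)%:E) \_ Q)%E.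
have If := (@integrable_mkcond _ _ R mu Q (fun z => (dv z)%:E) measurable_square).1 idv.
rewrite /torus_int /Rintegral integral_mkcond -/f.
rewrite -(integral12_prod_meas1 If) (_ : (fun x => _) = cst 0%E).
  by rewrite integral0.
apply/funext => x /=.
have [xI|xI] := boolP (x \in `[0, 2 * pi]); last first.
  apply: integral0_eq => y _; rewrite /f patchE ifF //; apply/negbTE/negP.
  by rewrite inE => -[+ _] /=; apply/negP.
transitivity (\int[leb R]_(y in `[0%R, (2 * pi)%R]) (dv (x, y))%:E)%E.
  rewrite [RHS]integral_mkcond; apply: eq_integral => y _.
  rewrite /f !patchE; congr (if _ then _ else _).
  by apply/idP/idP; rewrite !inE; [case | move=> yI; split].
exact: sec.
Qed.
End torus.

Section cas.
Variable R : realType.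
Implicit Types (k j l : Z2) (z : R * R) (v w : R * R -> R).
Notation fn := (freq_norm R).

(** The real orthogonal basis [cos + sin] of the torus (Hartley's): indexed by
    all of Z^2 without any symmetry constraint, and permuted by differentiation
    up to constants. *)
Definition cas k z : R := cos (phase k z) + sin (phase k z).

Lemma phaseN k z : phase (- k) z = - phase k z.
Proof. by rewrite /phase /= !rmorphN /=; ring. Qed.

Lemma phaseD j k z : phase (j + k) z = phase j z + phase k z.
Proof. by rewrite /phase /= !rmorphD /=; ring. Qed.

Lemma casN k z : cas (- k) z = cos (phase k z) - sin (phase k z).
Proof. by rewrite /cas phaseN cosN sinN. Qed.

Lemma cas0 z : cas 0 z = 1.
Proof. by rewrite /cas /phase /= !mul0r addr0 cos0 sin0 addr0. Qed.

Lemma cos_cas k z : cos (phase k z) = 2^-1 * (cas k z + cas (- k) z).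
Proof. by rewrite casN /cas; field. Qed.

Lemma sin_cas k z : sin (phase k z) = 2^-1 * (cas k z - cas (- k) z).
Proof. by rewrite casN /cas; field. Qed.

Lemma cas_mul j k z : cas j z * cas k z =
  2^-1 * (cas (j + k) z - cas (- j - k) z + cas (k - j) z + cas (j - k) z).
Proof.
rewrite /cas !phaseD !phaseN; move: (phase j z) (phase k z) => p q.
by rewrite !(cosD, sinD) !cosN !sinN; field.
Qed.

Lemma cas_le2 k z : `|cas k z| <= 2.
Proof.
apply: le_trans (ler_normD _ _) _; have := cos_max (phase k z).
by have := sin_max (phase k z); lra.
Qed.

Lemma phase_continuous k : continuous (fun z : R * R => phase k z).
Proof.
move=> z; apply: cvgD; apply: cvgMl_tmp; [exact: cvg_fst | exact: cvg_snd].
Qed.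

Lemma cas_continuous k : continuous (cas k).
Proof.
move=> z; apply: cvgD.
  apply: (@continuous_comp _ _ _ (fun z => phase k z) cos z); first exact: phase_continuous.
  exact: continuous_cos.
apply: (@continuous_comp _ _ _ (fun z => phase k z) sin z); first exact: phase_continuous.
exact: continuous_sin.
Qed.

Lemma cas_tame k : tame (cas k).
Proof. exact/continuous_tame/cas_continuous. Qed.

Let is_derive_cas (f : R -> R) (x df : R) : is_derive x 1 f df ->
  is_derive x 1 (fun x => cos (f x) + sin (f x)) (df * (cos (f x) - sin (f x))).
Proof.
move=> fdf; have dc : is_derive x 1 (fun x => cos (f x)) (- sin (f x) * df).
  exact: is_derive1_comp.
have ds : is_derive x 1 (fun x => sin (f x)) (cos (f x) * df).
  exact: is_derive1_comp.
by apply: is_derive_eq; ring.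
Qed.

Lemma is_derive_cas1 k z : is_derive z ((1, 0) : R * R) (cas k) (k.1%:~R * cas (- k) z).
Proof.
case: z => x y; apply/is_derive_slice1; rewrite casN; apply: is_derive_cas.
by rewrite /phase /=; apply: is_derive_eq; rewrite /GRing.scale /=; ring.
Qed.

Lemma is_derive_cas2 k z : is_derive z ((0, 1) : R * R) (cas k) (k.2%:~R * cas (- k) z).
Proof.
case: z => x y; apply/is_derive_slice2; rewrite casN; apply: is_derive_cas.
by rewrite /phase /=; apply: is_derive_eq; rewrite /GRing.scale /=; ring.
Qed.

Lemma trig_shift (m : int) (x : R) :
  cos (x + m%:~R * (2 * pi)) = cos x /\ sin (x + m%:~R * (2 * pi)) = sin x.
Proof.
have E n : n%:R * (2 * pi) = (pi *+ 2) *+ n :> R by rewrite !mulr_natl.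
case: m => n; first by rewrite -pmulrn E (periodicn (@cosD2pi R)) (periodicn (@sinD2pi R)).
rewrite NegzE rmorphN /= -pmulrn mulNr E.
by rewrite -{2 4}[x](subrK (pi *+ 2 *+ n.+1)) (periodicn (@cosD2pi R)) (periodicn (@sinD2pi R)).
Qed.

Lemma cas_periodic k : Defs.periodic (cas k).
Proof.
move=> x y; rewrite /cas /phase /=; split.
  rewrite mulrDr addrAC; have [-> ->] := trig_shift k.1 (k.1%:~R * x + k.2%:~R * y).
  by [].
by rewrite mulrDr addrA; have [-> ->] := trig_shift k.2 (k.1%:~R * x + k.2%:~R * y).
Qed.

Lemma torus_int_cas k : torus_int (cas k) = (2 * pi) ^+ 2 * (k == 0)%:R.
Proof.
have [->|k0] := eqVneq k 0.
  rewrite mulr1 (torus_int_eq (w := fun=> 1)) ?torus_int_cst ?mulr1 //.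
  by move=> z _; rewrite cas0.
rewrite mulr0; have [k1|k1] := eqVneq k.1 0.
  have k2 : k.2 != 0 by move: k0; rewrite -pair_eqE /= k1 eqxx.
  have kR : (k.2%:~R : R) != 0 by rewrite intr_eq0.
  apply: (mulfI kR); rewrite mulr0 -torus_intZ; last exact: cas_tame.
  apply/oppr_inj; rewrite oppr0 -mulN1r -torus_intZ.
    apply: (torus_int_d2 (@cas_periodic (- k))) => [|z].
      move=> z; apply: cvgMl_tmp; apply: cvgMl_tmp; exact: cas_continuous.
    have := is_derive_cas2 (- k) z; rewrite opprK /= rmorphN /=.
    by rewrite mulN1r mulNr.
  by apply: tameM; [exact: tame_cst | exact: cas_tame].
have kR : (k.1%:~R : R) != 0 by rewrite intr_eq0.
apply: (mulfI kR); rewrite mulr0 -torus_intZ; last exact: cas_tame.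
apply/oppr_inj; rewrite oppr0 -mulN1r -torus_intZ.
  apply: (torus_int_d1 (@cas_periodic (- k))) => [|z].
    move=> z; apply: cvgMl_tmp; apply: cvgMl_tmp; exact: cas_continuous.
  have := is_derive_cas1 (- k) z; rewrite opprK /= rmorphN /=.
  by rewrite mulN1r mulNr.
by apply: tameM; [exact: tame_cst | exact: cas_tame].
Qed.

Lemma torus_int_cas_mul j k :
  torus_int (fun z => cas j z * cas k z) = (2 * pi) ^+ 2 * (j == k)%:R.
Proof.
rewrite (torus_int_eq (w := fun z => 2^-1 * (cas (j + k) z - cas (- j - k) z
    + cas (k - j) z + cas (j - k) z))); last by move=> z _; rewrite cas_mul.
have T := cas_tame.
have T1 := tameB (T (j + k)) (T (- j - k)); have T2 := tameD T1 (T (k - j)).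
rewrite torus_intZ; last exact: (tameD T2 (T _)).
rewrite (torus_intD T2 (T _)) (torus_intD T1 (T _)) (torus_intB (T _) (T _)) !torus_int_cas.
rewrite -opprD oppr_eq0 !subr_eq0 [k == j]eq_sym.
by move: ((2 * pi) ^+ 2) => p; field.
Qed.

Lemma tame_cas v k : tame v -> tame (fun z => v z * cas k z).
Proof. by move=> tv; apply: tameM => //; exact: cas_tame. Qed.

Definition hartley v k : R := (2 * pi) ^- 2 * torus_int (fun z => v z * cas k z).

Lemma two_pi_gt0 : 0 < 2 * pi :> R.
Proof. by rewrite mulr_gt0 // pi_gt0. Qed.

Lemma hartley_cas j k : hartley (cas j) k = (j == k)%:R.
Proof.
by rewrite /hartley torus_int_cas_mul mulKf // expf_neq0 // gt_eqF // two_pi_gt0.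
Qed.

Lemma hartleyB v w k : tame v -> tame w ->
  hartley (fun z => v z - w z) k = hartley v k - hartley w k.
Proof.
move=> tv tw; rewrite /hartley -mulrBr -torus_intB; try exact: tame_cas.
by congr (_ * _); apply: torus_int_eq => z _; rewrite mulrBl.
Qed.

Lemma hartleyD v w k : tame v -> tame w ->
  hartley (fun z => v z + w z) k = hartley v k + hartley w k.
Proof.
move=> tv tw; rewrite /hartley -mulrDr -torus_intD; try exact: tame_cas.
by congr (_ * _); apply: torus_int_eq => z _; rewrite mulrDl.
Qed.

Lemma hartleyZ (c : R) v k : tame v -> hartley (fun z => c * v z) k = c * hartley v k.
Proof.
move=> tv; rewrite /hartley mulrCA -[c * _]torus_intZ; last exact: tame_cas.
by congr (_ * _); apply: torus_int_eq => z _; rewrite mulrA.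
Qed.

Lemma hartley_sum (r : seq Z2) (c : Z2 -> R) k : uniq r ->
  hartley (fun z => \sum_(j <- r) c j * cas j z) k = if k \in r then c k else 0.
Proof.
move=> ur; have T j : tame (fun z => c j * cas j z).
  by apply: tameM; [exact: tame_cst | exact: cas_tame].
transitivity (\sum_(j <- r) c j * (j == k)%:R).
  rewrite /hartley (torus_int_eq (w := fun z => \sum_(j <- r) c j * cas j z * cas k z)).
    rewrite torus_int_sum; last by move=> j; exact: tame_cas.
    rewrite mulr_sumr; apply: eq_bigr => j _; rewrite -(hartley_cas j k).
    by rewrite -hartleyZ //; exact: cas_tame.
  by move=> z _; rewrite mulr_suml.
case: ifPn => kr.
  rewrite (bigD1_seq k) //= eqxx mulr1 big1 ?addr0 // => j /negPf ->.
  by rewrite mulr0.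
by rewrite big1_seq // => j /andP[_ jr]; case: eqP => [jk|]; rewrite ?mulr0 //; rewrite jk (negPf kr) in jr.
Qed.

Lemma hartley_d1 v dv k : Defs.periodic v -> continuous v -> continuous dv ->
  (forall z, is_derive z ((1, 0) : R * R) v (dv z)) ->
  hartley dv k = - (k.1%:~R * hartley v (- k)).
Proof.
move=> pv cv cdv dE.
have tv := continuous_tame cv; have tdv := continuous_tame cdv.
have T1 : tame (fun z => dv z * cas k z) by exact: tame_cas.
have T2 : tame (fun z => v z * (k.1%:~R * cas (- k) z)).
  by apply: tameM => //; apply: tameM; [exact: tame_cst | exact: cas_tame].
have : torus_int (fun z => dv z * cas k z + v z * (k.1%:~R * cas (- k) z)) = 0.
  apply: (@torus_int_d1 _ (fun z => v z * cas k z)).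
  - move=> x y; have [-> ->] := pv x y; have [-> ->] := cas_periodic k x y.
    by [].
  - move=> z; apply: cvgD; first by apply: cvgM; [exact: cdv | exact: cas_continuous].
    by apply: cvgM; [exact: cv | apply: cvgMl_tmp; exact: cas_continuous].
  - move=> z; have := dE z; have := is_derive_cas1 k z.
    move: (_ * cas (- k) z) (dv z) => a b d1 d2.
    by apply: is_derive_eq; rewrite /GRing.scale /=; ring.
rewrite torus_intD // => /eqP; rewrite addr_eq0 => /eqP E.
rewrite /hartley E mulrN; congr (- _); rewrite mulrCA; congr (_ * _).
rewrite -torus_intZ; last by apply: tameM => //; exact: cas_tame.
by apply: torus_int_eq => z _; rewrite mulrCA.
Qed.

Lemma hartley_d2 v dv k : Defs.periodic v -> continuous v -> continuous dv ->
  (forall z, is_derive z ((0, 1) : R * R) v (dv z)) ->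
  hartley dv k = - (k.2%:~R * hartley v (- k)).
Proof.
move=> pv cv cdv dE.
have tv := continuous_tame cv; have tdv := continuous_tame cdv.
have T1 : tame (fun z => dv z * cas k z) by exact: tame_cas.
have T2 : tame (fun z => v z * (k.2%:~R * cas (- k) z)).
  by apply: tameM => //; apply: tameM; [exact: tame_cst | exact: cas_tame].
have : torus_int (fun z => dv z * cas k z + v z * (k.2%:~R * cas (- k) z)) = 0.
  apply: (@torus_int_d2 _ (fun z => v z * cas k z)).
  - move=> x y; have [-> ->] := pv x y; have [-> ->] := cas_periodic k x y.
    by [].
  - move=> z; apply: cvgD; first by apply: cvgM; [exact: cdv | exact: cas_continuous].
    by apply: cvgM; [exact: cv | apply: cvgMl_tmp; exact: cas_continuous].
  - move=> z; have := dE z; have := is_derive_cas2 k z.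
    move: (_ * cas (- k) z) (dv z) => a b d1 d2.
    by apply: is_derive_eq; rewrite /GRing.scale /=; ring.
rewrite torus_intD // => /eqP; rewrite addr_eq0 => /eqP E.
rewrite /hartley E mulrN; congr (- _); rewrite mulrCA; congr (_ * _).
rewrite -torus_intZ; last by apply: tameM => //; exact: cas_tame.
by apply: torus_int_eq => z _; rewrite mulrCA.
Qed.

Lemma bessel v (r : seq Z2) : uniq r -> tame v ->
  \sum_(k <- r) hartley v k ^+ 2 <= (2 * pi) ^- 2 * torus_int (fun z => v z ^+ 2).
Proof.
move=> ur tv; have p0 := two_pi_gt0.
have p2 : 0 < (2 * pi) ^- 2 :> R by rewrite invr_gt0 exprn_gt0.
pose P z := \sum_(k <- r) hartley v k * cas k z.
have T k : tame (fun z => hartley v k * cas k z).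
  by apply: tameM; [exact: tame_cst | exact: cas_tame].
have tP : tame P by exact: tame_sum.
have IP w : tame w -> (2 * pi) ^- 2 * torus_int (fun z => w z * P z) =
    \sum_(k <- r) hartley v k * hartley w k.
  move=> tw; rewrite (torus_int_eq (w := fun z => \sum_(k <- r) hartley v k * (w z * cas k z))).
    rewrite torus_int_sum; last first.
      by move=> k; apply: tameM; [exact: tame_cst | exact: tame_cas].
    rewrite mulr_sumr; apply: eq_bigr => k _; rewrite torus_intZ; first by rewrite mulrCA.
    by apply: tameM => //; exact: cas_tame.
  by move=> z _; rewrite mulr_sumr; apply: eq_bigr => k _; rewrite mulrCA.
have PP : (2 * pi) ^- 2 * torus_int (fun z => P z * P z) = \sum_(k <- r) hartley v k ^+ 2.
  rewrite IP // big_seq [RHS]big_seq; apply: eq_bigr => k kr.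
  by rewrite hartley_sum // kr expr2.
have := IP v tv; set S := \sum_(k <- r) _ * _ => vP.
have SE : S = \sum_(k <- r) hartley v k ^+ 2 by apply: eq_bigr => k _; rewrite expr2.
have tvv : tame (fun z => v z ^+ 2).
  by under eq_fun do rewrite expr2; exact: tameM.
have : 0 <= torus_int (fun z => (v z ^+ 2 - 2 * (v z * P z)) + P z * P z).
  rewrite -(mulr0 ((2 * pi) ^+ 2)) -torus_int_cst; apply: torus_int_le.
  - exact: tame_cst.
  - apply: tameD; last exact: tameM.
    by apply: tameB => //; apply: tameM; [exact: tame_cst | exact: tameM].
  - by move=> z _; have := sqr_ge0 (v z - P z); lra.
rewrite torus_intD; [|by apply: tameB => //; apply: tameM; [exact: tame_cst | exact: tameM]|exact: tameM].
rewrite torus_intB //; last by apply: tameM; [exact: tame_cst | exact: tameM].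
rewrite torus_intZ; last exact: tameM.
move=> /(ler_wpM2l (ltW p2)); rewrite mulr0 mulrDr mulrBr PP -SE mulrCA vP.
by lra.
Qed.
End cas.

Section threshold.
Variable R : realType.

(** Polynomials that converge on [0, 1], boundedly and everywhere, to the
    indicator of [t > 1/2]: with [u = t ^ (n^2)] and [K = 2 ^ (n^2 - n)], the
    product [K * u] tends to [0] or to infinity according to the side of [1/2],
    and [1 - K u <= (1 - u) ^ K <= 1 / (1 + K u)]. *)
Definition step (n : nat) (t : R) : R := 1 - (1 - t ^+ (n * n)) ^+ (2 ^ (n * n - n)).

Lemma step_bound n t : 0 <= t <= 1 -> 0 <= step n t <= 1.
Proof.
move=> /andP[t0 t1]; have u0 : 0 <= t ^+ (n * n) by exact: exprn_ge0.
have u1 : t ^+ (n * n) <= 1 by exact: exprn_ile1.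
have v0 : 0 <= 1 - t ^+ (n * n) by rewrite subr_ge0.
have v1 : 1 - t ^+ (n * n) <= 1 by rewrite gerBl.
by rewrite /step subr_ge0 gerBl exprn_ge0 // andbT exprn_ile1.
Qed.

Lemma bernoulli_sub (u : R) (K : nat) : 0 <= u <= 1 -> 1 - K%:R * u <= (1 - u) ^+ K.
Proof.
move=> /andP[u0 u1]; elim: K => [|K IH]; first by rewrite mul0r subr0 expr0.
rewrite exprS -natr1; have v0 : 0 <= 1 - u by rewrite subr_ge0.
apply: le_trans (ler_wpM2l v0 IH).
have : 0 <= K%:R * u * u by rewrite !mulr_ge0.
by lra.
Qed.

Lemma bernoulli_add (u : R) (K : nat) : 0 <= u -> 1 + K%:R * u <= (1 + u) ^+ K.
Proof.
move=> u0; elim: K => [|K IH]; first by rewrite mul0r addr0 expr0.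
rewrite exprS -natr1; have v0 : 0 <= 1 + u by rewrite addr_ge0.
apply: le_trans (ler_wpM2l v0 IH).
have : 0 <= K%:R * u * u by rewrite !mulr_ge0.
by lra.
Qed.

Lemma step_cvg (t : R) : 0 <= t <= 1 -> step n t @[n --> \oo] --> ((2^-1 < t)%R%:R : R).
Proof.
move=> t01; have /andP[t0 t1] := t01.
have g_cvg : (2^-1 : R) ^+ n @[n --> \oo] --> 0.
  by apply: cvg_expr; rewrite gtr0_norm // invf_lt1 // ltr1n.
have nn n : (n <= n * n)%N by case: n => // n; rewrite leq_pmulr.
have u0 n : 0 <= t ^+ n by exact: exprn_ge0.
have u1 n : t ^+ n <= 1 by exact: exprn_ile1.
have u01 n : 0 <= t ^+ n <= 1 by rewrite u0 u1.
have [th|th] := ltP 2^-1 t.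
- have [e e0 te] : exists2 e, 0 < e & t = 2^-1 * (1 + e) by exists (2 * t - 1); lra.
  suff H : \forall n \near \oo, 1 - (2^-1) ^+ n <= step n t <= 1.
    apply: (squeeze_cvgr H); last exact: cvg_cst.
    by rewrite -[X in _ --> X]subr0; apply: cvgB; [exact: cvg_cst | exact: g_cvg].
  near=> n; have /andP[_ ->] := step_bound n t01; rewrite andbT /step lerD2l lerN2.
  pose K := (2 ^ (n * n - n))%N; rewrite -/K.
  have KE : K%:R * t ^+ (n * n) = ((1 + e) ^+ n / 2) ^+ n.
    rewrite /K natrX te exprMn.
    have -> : (2^-1 : R) ^+ (n * n) = (2^-1) ^+ (n * n - n) * (2^-1) ^+ n.
      by rewrite -exprD subnK.
    rewrite !mulrA -exprMn mulfV // expr1n mul1r [RHS]exprMn -exprM.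
    by rewrite mulrC.
  have big : 2 <= (1 + e) ^+ n / 2.
    rewrite ler_pdivlMr //; apply: le_trans (bernoulli_add _ (ltW e0)).
    have : 3 / e <= n%:R by near: n; exact: nbhs_infty_ger.
    by rewrite ler_pdivrMr //; lra.
  have Ku : 2 ^+ n <= K%:R * t ^+ (n * n).
    by rewrite KE lerXn2r ?nnegrE // (le_trans _ big).
  have p2 : 0 < (2 : R) ^+ n by exact: exprn_gt0.
  rewrite exprVn -[leRHS]mul1r ler_pdivlMr //.
  have v0 : 0 <= 1 - t ^+ (n * n) by rewrite subr_ge0.
  apply: (@le_trans _ _ ((1 - t ^+ (n * n)) ^+ K * (1 + t ^+ (n * n)) ^+ K)).
    apply: ler_wpM2l; first exact: exprn_ge0.
    apply: le_trans Ku _; apply: le_trans (bernoulli_add _ (u0 _)).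
    by rewrite lerDr.
  rewrite -exprMn exprn_ile1 //; first by rewrite mulr_ge0 // addr_ge0.
  by have := sqr_ge0 (t ^+ (n * n)); lra.
- suff H : \forall n \near \oo, 0 <= step n t <= (2^-1) ^+ n.
    by apply: (squeeze_cvgr H); [exact: cvg_cst | exact: g_cvg].
  near=> n; have /andP[-> _] /= := step_bound n t01.
  rewrite /step lerBlDr addrC -lerBlDr.
  apply: le_trans (bernoulli_sub _ (u01 _)); rewrite lerD2l lerN2.
  have h : t ^+ (n * n) <= (2^-1) ^+ (n * n) by rewrite lerXn2r ?nnegrE.
  have := ler_wpM2l (ler0n R (2 ^ (n * n - n))) h => /le_trans; apply.
  have -> : (2^-1 : R) ^+ (n * n) = (2^-1) ^+ (n * n - n) * (2^-1) ^+ n.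
    by rewrite -exprD subnK.
  by rewrite natrX mulrA -exprMn mulfV // expr1n mul1r.
Unshelve. all: by end_near. Qed.

(** For [x] inside the period, [x > c] is a strict inequality between values of
    trigonometric polynomials, as
    [cos (c/2) - cos (x - c/2) = 2 sin (x/2) sin ((x - c)/2)]. *)
Definition ray (c x : R) : R :=
  (1 + (cos (c / 2) - (cos x * cos (c / 2) + sin x * sin (c / 2))) / 2) / 2.

Lemma ray_bound c x : 0 <= ray c x <= 1.
Proof.
rewrite /ray -cosB; have := cos_le1 (c / 2); have := cos_geN1 (c / 2).
have := cos_le1 (x - c / 2); have := cos_geN1 (x - c / 2).
by move: (cos _) (cos _) => a b *; apply/andP; split; lra.
Qed.

Lemma ray_gt c x : 0 <= c <= 2 * pi -> 0 < x < 2 * pi ->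
  (2^-1 < ray c x) = (c < x).
Proof.
move=> /andP[c0 c1] /andP[x0 x1].
have E : cos (c / 2) - cos (x - c / 2) = 2 * sin (x / 2) * sin ((x - c) / 2).
  have -> : c / 2 = x / 2 - (x - c) / 2 by field.
  have -> : x - (x / 2 - (x - c) / 2) = x / 2 + (x - c) / 2 by field.
  by rewrite cosB cosD; ring.
have s0 : 0 < sin (x / 2) by apply: sin_gt0_pi; lra.
have -> : (2^-1 < ray c x) = (0 < sin ((x - c) / 2)).
  rewrite -(pmulr_rgt0 (sin ((x - c) / 2)) (mulr_gt0 (ltr0n R 2) s0)) -E /ray -cosB.
  by move: (cos _ - cos _) => a; apply/idP/idP; lra.
have [cx|xc] := ltP c x; first by apply: sin_gt0_pi; lra.
have -> : (x - c) / 2 = - ((c - x) / 2) by lra.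
rewrite sinN oppr_gt0; apply/negbTE; rewrite -leNgt.
by apply: sin_ge0_pi; lra.
Qed.
End threshold.

Section fourier_uniqueness.
Variable R : realType.
Notation mu := (leb2 R).

Definition open_square : set (R * R) :=
  `]0%R, (2 * pi)%R[%classic `*` `]0%R, (2 * pi)%R[%classic.
Notation D := open_square.

Lemma measurable_open_square : measurable (D : set (R * R)).
Proof. by apply: measurableX; exact: measurable_itv. Qed.

Definition bmeas (g : R * R -> R) : Prop :=
  measurable_fun [set: R * R] g /\ exists M, forall z, `|g z| <= M.

Lemma bmeasD g h : bmeas g -> bmeas h -> bmeas (fun z => g z + h z).
Proof.
move=> [mg [M gM]] [mh [N hN]]; split; first exact: measurable_funD.
by exists (M + N) => z; apply: le_trans (ler_normD _ _) _; rewrite lerD.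
Qed.

Lemma bmeasM g h : bmeas g -> bmeas h -> bmeas (fun z => g z * h z).
Proof.
move=> [mg [M gM]] [mh [N hN]]; split; first exact: measurable_funM.
by exists (M * N) => z; rewrite normrM ler_pM.
Qed.

Lemma bmeas_cst (c : R) : bmeas (fun=> c).
Proof. by split; [exact: measurable_cst | exists `|c|]. Qed.

Lemma bmeas_cas k : bmeas (@cas R k).
Proof.
split; first by apply: continuous_measurable2; exact: cas_continuous.
by exists 2 => z; exact: cas_le2.
Qed.

Section annihilator.
Variable f : R * R -> R.
Hypothesis intf : mu.-integrable D (fun z => (f z)%:E).

Let I (g : R * R -> R) : \bar R := (\int[mu]_(z in D) (f z * g z)%:E)%E.

Lemma integrable_bmeas g : bmeas g -> mu.-integrable D (fun z => (f z * g z)%:E).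
Proof.
move=> [mg [M gM]].
have := @integrableMl _ _ R mu D measurable_open_square (fun z => (f z)%:E) g intf.
apply; first exact: measurable_funTS.
by exists M; split; [exact: num_real | move=> M' MM' z _; apply: le_trans (gM z) (ltW MM')].
Qed.

Let I_eq g h : g =1 h -> I g = I h.
Proof. by move=> gh; apply: eq_integral => z _; rewrite gh. Qed.

Let ID g h : bmeas g -> bmeas h -> I g = 0%E -> I h = 0%E -> I (fun z => g z + h z) = 0%E.
Proof.
move=> bg bh g0 h0.
transitivity (I g + I h)%E; last by rewrite g0 h0 adde0.
rewrite /I -integralD; [|exact: measurable_open_square|exact: integrable_bmeas|exact: integrable_bmeas].
by apply: eq_integral => z _; rewrite -EFinD mulrDr.
Qed.

Let IZ (c : R) g : bmeas g -> I g = 0%E -> I (fun z => c * g z) = 0%E.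
Proof.
move=> bg g0; transitivity (c%:E * I g)%E; last by rewrite g0 mule0.
rewrite /I -integralZl; [|exact: measurable_open_square|exact: integrable_bmeas].
by apply: eq_integral => z _; rewrite -EFinM mulrCA.
Qed.

Definition annihilates (g : R * R -> R) : Prop :=
  bmeas g /\ forall k, I (fun z => g z * cas k z) = 0%E.

(** The multipliers form an algebra; [cos] and [sin] of [x] and [y] belong to it
    because multiplication by them shifts the frequencies. *)
Definition multiplier (m : R * R -> R) : Prop :=
  bmeas m /\ forall g, annihilates g -> annihilates (fun z => m z * g z).

Lemma annihilatesD g h : annihilates g -> annihilates h -> annihilates (fun z => g z + h z).
Proof.
move=> [bg g0] [bh h0]; split; first exact: bmeasD.
move=> k; rewrite (@I_eq _ (fun z => g z * cas k z + h z * cas k z)).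
  by apply: ID => //; apply: bmeasM => //; exact: bmeas_cas.
by move=> z; rewrite mulrDl.
Qed.

Lemma multiplierD m n : multiplier m -> multiplier n -> multiplier (fun z => m z + n z).
Proof.
move=> [bm Hm] [bn Hn]; split; first exact: bmeasD.
move=> g ag; have := annihilatesD (Hm g ag) (Hn g ag).
by under eq_fun do rewrite -mulrDl.
Qed.

Lemma multiplierM m n : multiplier m -> multiplier n -> multiplier (fun z => m z * n z).
Proof.
move=> [bm Hm] [bn Hn]; split; first exact: bmeasM.
by move=> g ag; have := Hm _ (Hn _ ag); under eq_fun do rewrite mulrA.
Qed.

Lemma multiplier_cst (c : R) : multiplier (fun=> c).
Proof.
split; first exact: bmeas_cst.
move=> g [bg g0]; split; first by apply: bmeasM => //; exact: bmeas_cst.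
move=> k; rewrite (@I_eq _ (fun z => c * (g z * cas k z))).
  by apply: IZ => //; apply: bmeasM => //; exact: bmeas_cas.
by move=> z; rewrite mulrA.
Qed.

Lemma multiplierX m n : multiplier m -> multiplier (fun z => m z ^+ n).
Proof.
move=> Mm; elim: n => [|n IH]; first exact: multiplier_cst.
by under eq_fun do rewrite exprS; exact: multiplierM.
Qed.

Lemma multiplier_cas e : multiplier (@cas R e).
Proof.
split; first exact: bmeas_cas.
move=> g [bg g0]; split; first by apply: bmeasM => //; exact: bmeas_cas.
move=> k; rewrite (@I_eq _ (fun z => 2^-1 * ((g z * cas (e + k) z + (-1) * (g z * cas (- e - k) z))
   + (g z * cas (k - e) z + g z * cas (e - k) z)))).
  have B j : bmeas (fun z => g z * cas j z) by apply: bmeasM => //; exact: bmeas_cas.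
  have B1 j : bmeas (fun z => (-1) * (g z * cas j z)).
    by apply: bmeasM => //; exact: bmeas_cst.
  apply: IZ; first by apply: bmeasD; exact: bmeasD.
  apply: ID; [exact: bmeasD|exact: bmeasD| |exact: ID].
  by apply: ID => //; exact: IZ.
by move=> z; rewrite mulrAC -mulrA [cas k z * _]mulrC; rewrite mulrCA cas_mul; ring.
Qed.

Lemma multiplier_cos e : multiplier (fun z : R * R => cos (phase e z)).
Proof.
under eq_fun do rewrite cos_cas.
apply: multiplierM; first exact: multiplier_cst.
by apply: multiplierD; exact: multiplier_cas.
Qed.

Lemma multiplier_sin e : multiplier (fun z : R * R => sin (phase e z)).
Proof.
under eq_fun do rewrite sin_cas.
apply: multiplierM; first exact: multiplier_cst.
apply: multiplierD; first exact: multiplier_cas.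
under eq_fun do rewrite -mulN1r.
by apply: multiplierM; [exact: multiplier_cst | exact: multiplier_cas].
Qed.

Lemma multiplierB m n : multiplier m -> multiplier n -> multiplier (fun z => m z - n z).
Proof.
move=> Mm Mn; apply: multiplierD => //; under eq_fun do rewrite -mulN1r.
by apply: multiplierM => //; exact: multiplier_cst.
Qed.

Lemma multiplier_step (x : R * R -> R) n (c : R) :
  multiplier (fun z => cos (x z)) -> multiplier (fun z => sin (x z)) ->
  multiplier (fun z => step n (ray c (x z))).
Proof.
move=> Mc Ms; have C := multiplier_cst.
rewrite /step /ray; apply: multiplierB; first exact: C.
apply: multiplierX; apply: multiplierB; first exact: C.
apply: multiplierX; apply: multiplierM; last exact: C.
apply: multiplierD; first exact: C.
apply: multiplierM; last exact: C.
apply: multiplierB; first exact: C.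
by apply: multiplierD; apply: multiplierM.
Qed.

Hypothesis f0 : forall k, I (cas k) = 0%E.

Let ann1 : annihilates (fun=> 1).
Proof.
split; first exact: bmeas_cst.
by move=> k; rewrite -(f0 k); apply: I_eq => z; rewrite mul1r.
Qed.

Let I_multiplier m : multiplier m -> I m = 0%E.
Proof.
move=> [_ /(_ _ ann1) [_ /(_ 0) <-]]; apply: I_eq => z.
by rewrite cas0 !mulr1.
Qed.

Let clamp (c : R) := if c < 0 then 0 else if 2 * pi < c then 2 * pi else c.

Let ray_lt (c x : R) : 0 < x < 2 * pi -> (2^-1 < ray (clamp c) x) = (c < x).
Proof.
move=> /andP[x0 x1]; have p0 := two_pi_gt0 R.
rewrite ray_gt ?x0 ?x1 //; last first.
  by rewrite /clamp; case: (ltP c 0) => ?; [|case: (ltP (2 * pi) c) => ?]; apply/andP; split; lra.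
rewrite /clamp; case: (ltP c 0) => ?; [|case: (ltP (2 * pi) c) => ? //].
  by rewrite x0; apply/esym; lra.
by apply/idP/idP; lra.
Qed.

Let quadrant (c d : R) : set (R * R) := `]c, +oo[%classic `*` `]d, +oo[%classic.

Lemma integral_quadrant c d : (\int[mu]_(z in D `&` quadrant c d) (f z)%:E)%E = 0%E.
Proof.
pose g n (z : R * R) := step n (ray (clamp c) z.1) * step n (ray (clamp d) z.2).
have Mg n : multiplier (g n).
  apply: multiplierM.
    apply: multiplier_step.
      have := multiplier_cos (1, 0); congr multiplier; apply/funext => z.
      by rewrite /phase /= mul1r mul0r addr0.
    have := multiplier_sin (1, 0); congr multiplier; apply/funext => z.
    by rewrite /phase /= mul1r mul0r addr0.
  apply: multiplier_step.
    have := multiplier_cos (0, 1); congr multiplier; apply/funext => z.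
    by rewrite /phase /= mul1r mul0r add0r.
  have := multiplier_sin (0, 1); congr multiplier; apply/funext => z.
  by rewrite /phase /= mul1r mul0r add0r.
have g0 n : I (g n) = 0%E by exact: I_multiplier.
have bg n : bmeas (g n) by have [] := Mg n.
have cvg_int : (\int[mu]_(z in D) (f z * g n z)%:E)%E @[n --> \oo] -->
    (\int[mu]_(z in D) ((fun z => (f z)%:E) \_ (quadrant c d)) z)%E.
  apply: (@dominated_cvg _ _ R mu D measurable_open_square _ _ (fun z => `|f z|%:E)).
  - by move=> n; apply: measurable_int (integrable_bmeas _); exact: bg.
  - move=> z [zx zy]; have {zx}zx : 0 < z.1 < 2 * pi by move: zx; rewrite /= in_itv.
    have {zy}zy : 0 < z.2 < 2 * pi by move: zy; rewrite /= in_itv.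
    have -> : ((fun z => (f z)%:E) \_ (quadrant c d)) z =
        if (c < z.1) && (d < z.2) then (f z)%:E else 0%E.
      rewrite patchE; congr (if _ then _ else _).
      apply/idP/andP => [/set_mem[]|[cz dz]]; first by rewrite /= !in_itv /= !andbT.
      by rewrite inE; split; rewrite /= in_itv /= andbT.
    rewrite -(ray_lt c zx) -(ray_lt d zy).
    have -> : (if (2^-1 < ray (clamp c) z.1) && (2^-1 < ray (clamp d) z.2)
        then (f z)%:E else 0%E) =
      (f z * ((2^-1 < ray (clamp c) z.1)%R%:R * (2^-1 < ray (clamp d) z.2)%R%:R))%:E.
      by case: (_ < _); case: (_ < _); rewrite ?(mulr1, mulr0, mul0r).
    apply: cvg_EFin; first exact: nearW.
    by apply: cvgMl_tmp; apply: cvgM; apply: step_cvg; exact: ray_bound.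
  - by move=> z _.
  - exact: integrable_norm.
  - move=> n z _; rewrite lee_fin normrM ler_piMr // normrM.
    have /andP[s0 s1] := step_bound n (ray_bound (clamp c) z.1).
    have /andP[t0 t1] := step_bound n (ray_bound (clamp d) z.2).
    by rewrite !ger0_norm // mulr_ile1.
rewrite integral_mkcondr; apply: (cvg_unique _ cvg_int) => //.
rewrite (_ : (fun n => _) = cst 0%E); first exact: cvg_cst.
by apply/funext => n; exact: g0.
Qed.

Let quadrants : set (set (R * R)) := [set A | exists c d, A = quadrant c d].

Let measurable_quadrants : @measurable _ (R * R)%type = <<s quadrants >>.
Proof.
apply/seteqP; split; last first.
  apply: smallest_sub; first exact: sigma_algebra_measurable.
  by move=> _ [c [d ->]]; apply: measurableX; exact: measurable_itv.
rewrite measurable_prod_measurableType.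
apply: smallest_sub; first exact: smallest_sigma_algebra.
pose T := g_sigma_algebraType quadrants.
have cover1 (c : R) : `]c, +oo[%classic `*` [set: R] =
    \bigcup_(n : nat) quadrant c (- n%:R).
  apply/seteqP; split=> z; last by case=> n _ [].
  case=> zc _; exists (Num.truncn `|z.2|).+1 => //; split => //=.
  rewrite in_itv /= andbT ltrNl; apply: le_lt_trans (truncnS_gt _).
  by rewrite -normrN ler_norm.
have cover2 (c : R) : [set: R] `*` `]c, +oo[%classic =
    \bigcup_(n : nat) quadrant (- n%:R) c.
  apply/seteqP; split=> z; last by case=> n _ [].
  case=> _ zc; exists (Num.truncn `|z.1|).+1 => //; split => //=.
  rewrite in_itv /= andbT ltrNl; apply: le_lt_trans (truncnS_gt _).
  by rewrite -normrN ler_norm.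
have m1 : measurable_fun [set: T] (fst : T -> R).
  apply: (measurability _ (RGenOInfty.measurableE R)).
  move=> _ [_ [c ->] <-]; rewrite setTI.
  rewrite (_ : _ @^-1` _ = \bigcup_(n : nat) quadrant c (- n%:R)); last first.
    by rewrite -cover1; apply/seteqP; split => z //= [].
  by apply: bigcupT_measurable => n; apply: sub_sigma_algebra; exists c, (- n%:R).
have m2 : measurable_fun [set: T] (snd : T -> R).
  apply: (measurability _ (RGenOInfty.measurableE R)).
  move=> _ [_ [c ->] <-]; rewrite setTI.
  rewrite (_ : _ @^-1` _ = \bigcup_(n : nat) quadrant (- n%:R) c); last first.
    by rewrite -cover2; apply/seteqP; split => z //= [].
  by apply: bigcupT_measurable => n; apply: sub_sigma_algebra; exists (- n%:R), c.
move=> _ [A mA] [B mB] <-.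
have -> : A `*` B = (setT `&` (fst @^-1` A)) `&` (setT `&` (snd @^-1` B)) :> set (R * R).
  by apply/seteqP; split => z /=; tauto.
have := @measurableI _ T _ _ (m1 measurableT A mA) (m2 measurableT B mB).
by [].
Qed.

Let integral_measurable (A : set (R * R)) : measurable A ->
  (\int[mu]_(z in D `&` A) (f z)%:E)%E = 0%E.
Proof.
have I1 : (\int[mu]_(z in D) (f z)%:E)%E = 0%E.
  by rewrite -(f0 0); apply: eq_integral => z _; rewrite cas0 mulr1.
have mD := measurable_open_square.
rewrite measurable_quadrants; move: A; apply: dynkin_induction.
- exact: measurable_quadrants.
- move=> _ _ [a [b ->]] [c [d ->]]; exists (Num.max a c), (Num.max b d).
  apply/seteqP; split => z /=; rewrite /quadrant /= !in_itv /= !andbT !gt_max.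
    by case=> -[-> ->] [-> ->].
  by case=> /andP[-> ->] /andP[-> ->].
- by rewrite setIT.
- by move=> _ [c [d ->]]; exact: integral_quadrant.
- move=> S mS S0.
  have := I1; rewrite -{1}(setIT D) -(setUv S) setIUr integral_setU.
  + by rewrite S0 add0e.
  + exact: measurableI.
  + by apply: measurableI => //; exact: measurableC.
  + rewrite -setIUr setUv setIT; exact: measurable_int intf.
  + by rewrite disj_set2E -setIIr setICr setI0.
- move=> F mF tF F0; rewrite setI_bigcupr integral_bigcup.
  + by apply: eseries0 => k _ _; exact: F0.
  + by apply: trivIset_setIl.
  + by move=> k; apply: measurableI; [exact: mD | exact: mF].
  + apply: (@integrableS _ _ R mu D _ (fun z => (f z)%:E) mD) => //; last by move=> z [k _ []].
    by apply: bigcupT_measurable => k; apply: measurableI; [exact: mD | exact: mF].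
Qed.

Lemma fourier_zero_ae : ae_eq mu D (fun z => (f z)%:E) (cst 0%E).
Proof.
apply: integral_ae_eq => //; first exact: measurable_open_square.
move=> E ED mE; rewrite integral0 -(integral_measurable mE).
by rewrite (_ : D `&` E = E) //; exact/setIidPr.
Qed.
End annihilator.
End fourier_uniqueness.
Arguments open_square R : clear implicits.

Section translation.
Variable R : realType.
Notation mu := (leb2 R).
Notation Q := (square R).
Notation D := (open_square R).

Lemma lebesgue_measure_shift (a : R) (A : set R) : measurable A ->
  lebesgue_measure ((fun x => x + a) @^-1` A) = lebesgue_measure A.
Proof.
pose h (x : measurableTypeR R) : measurableTypeR R := x + a.
have mh : measurable_fun setT h.
  by apply: measurable_funD; [exact: measurable_id | exact: measurable_cst].
have := @lebesgue_measure_unique R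
  (measure_function_pushforward__canonical__measure_function_Measure (@lebesgue_measure R) mh).
move=> H mA; apply/esym; apply: H mA => _ [[x y] _ <-] /=.
have E : h @^-1` `]x, y]%classic = `](x - a), (y - a)]%classic.
  by apply/seteqP; split => z; rewrite /h /= !in_itv /=; lra.
rewrite /pushforward; transitivity (lebesgue_measure (`](x - a), (y - a)]%classic : set R)).
  rewrite !lebesgue_measure_itv /= !lte_fin ltrD2r; case: ifP => // _.
  by rewrite -!EFinD; congr (_%:E); ring.
by congr lebesgue_measure.
Qed.

Lemma measure_shift (a b : R) (A : set (R * R)) : measurable A ->
  mu ((fun z => (z.1 + a, z.2 + b)) @^-1` A) = mu A.
Proof.
pose T := (measurableTypeR R * measurableTypeR R)%type.
pose h (z : T) : T := (z.1 + a, z.2 + b).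
have mh : measurable_fun setT h.
  apply: measurable_fun_pair; apply: measurable_funD;
    by [exact: measurable_fst | exact: measurable_snd | exact: measurable_cst].
have H := @product_measure_unique _ _ _ _ R (@lebesgue_measure R) (@lebesgue_measure R)
  (measure_function_pushforward__canonical__measure_function_Measure mu mh).
move=> mA; apply/esym; apply: H mA => B C mB mC.
rewrite /= /pushforward.
have -> : h @^-1` (B `*` C) = ((fun x : R => x + a) @^-1` B) `*` ((fun x : R => x + b) @^-1` C).
  by apply/seteqP; split => z.
have mBa : measurable ((fun x : R => x + a) @^-1` B).
  rewrite -[X in measurable X]setTI; apply: (measurable_funD (g := cst a)) => //.
have mCb : measurable ((fun x : R => x + b) @^-1` C).
  rewrite -[X in measurable X]setTI; apply: (measurable_funD (g := cst b)) => //.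
rewrite product_measure1E //.
exact: (congr2 (fun u v => u * v)%E (lebesgue_measure_shift a mB) (lebesgue_measure_shift b mC)).
Qed.

Lemma periodic_shift (f : R * R -> R) (m n : int) (x y : R) : Defs.periodic f ->
  f (x + m%:~R * (2 * pi), y + n%:~R * (2 * pi)) = f (x, y).
Proof.
move=> pf.
have P1 (k : nat) (u v : R) : f (u + k%:R * (2 * pi), v) = f (u, v).
  elim: k => [|k IH]; first by rewrite mul0r addr0.
  by rewrite -natr1 mulrDl mul1r addrA; have [-> _] := pf (u + k%:R * (2 * pi)) v.
have P2 (k : nat) (u v : R) : f (u, v + k%:R * (2 * pi)) = f (u, v).
  elim: k => [|k IH]; first by rewrite mul0r addr0.
  by rewrite -natr1 mulrDl mul1r addrA; have [_ ->] := pf u (v + k%:R * (2 * pi)).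
have Z1 (k : int) (u v : R) : f (u + k%:~R * (2 * pi), v) = f (u, v).
  case: k => k; first exact: P1.
  by rewrite NegzE rmorphN /= -pmulrn mulNr -(P1 k.+1) subrK.
have Z2 (k : int) (u v : R) : f (u, v + k%:~R * (2 * pi)) = f (u, v).
  case: k => k; first exact: P2.
  by rewrite NegzE rmorphN /= -pmulrn mulNr -(P2 k.+1) subrK.
by rewrite Z1 Z2.
Qed.

Lemma period_reduce (x : R) : exists m : int, 0 <= x - m%:~R * (2 * pi) < 2 * pi.
Proof.
have p0 := two_pi_gt0 R; exists (Num.floor (x / (2 * pi))).
have /andP[] := floor_itv (x / (2 * pi)); rewrite rmorphD rmorph1.
rewrite ler_pdivlMr // ltr_pdivrMr // mulrDl mul1r => h1 h2.
by rewrite subr_ge0 h1 /=; lra.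
Qed.

Let line1 : mu ([set 0] `*` setT) = 0%E.
Proof.
rewrite product_measure1E; [|exact: measurable_set1|exact: measurableT].
have L : lebesgue_measure ([set 0] : set R) = 0%E by rewrite lebesgue_measure_set1.
by transitivity (0 * @lebesgue_measure R setT)%E; [congr (_ * _)%E | rewrite mul0e].
Qed.

Let line2 : mu (setT `*` [set 0]) = 0%E.
Proof.
rewrite product_measure1E; [|exact: measurableT|exact: measurable_set1].
have L : lebesgue_measure ([set 0] : set R) = 0%E by rewrite lebesgue_measure_set1.
by transitivity (@lebesgue_measure R setT * 0)%E; [congr (_ * _)%E | rewrite mule0].
Qed.

Let corner : set (R * R) := `[0%R, (2 * pi)%R[%classic `*` `[0%R, (2 * pi)%R[%classic.

(** A periodic function that vanishes almost everywhere on one period vanishes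
    almost everywhere: the plane is covered by countably many translates. *)
Lemma ae_zero_periodic (f : R * R -> R) : Defs.periodic f ->
  measurable_fun [set: R * R] f ->
  ae_eq mu D (fun z => (f z)%:E) (cst 0%E) -> \forall z \ae mu, f z = 0.
Proof.
move=> pf mf aeD.
pose E := [set z | f z <> 0].
have mE : measurable E.
  rewrite (_ : E = ~` (setT `&` f @^-1` [set 0])); last by rewrite setTI.
  by apply: measurableC; apply: mf => //; exact: measurable_set1.
have mC : measurable corner by apply: measurableX; exact: measurable_itv.
have CE0 : mu (corner `&` E) = 0%E.
  have NE : mu.-negligible (D `&` E).
    apply: negligibleS aeD => z [Dz fz] /(_ Dz) [].
    exact: fz.
  have : mu.-negligible (corner `&` E).
    have L1 : mu.-negligible (([set 0] `*` setT) : set (R * R)).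
      by exists ([set 0] `*` setT); split => //; apply: measurableX => //; exact: measurable_set1.
    have L2 : mu.-negligible ((setT `*` [set 0]) : set (R * R)).
      by exists (setT `*` [set 0]); split => //; apply: measurableX => //; exact: measurable_set1.
    apply: negligibleS (negligibleU (negligibleU NE L1) L2) => z [[]] /=.
    rewrite !in_itv /= => /andP[x0 x1] /andP[y0 y1] fz.
    have [zx|zx] := eqVneq z.1 0; first by left; right.
    have [zy|zy] := eqVneq z.2 0; first by right.
    left; left; split => //; split; rewrite /= in_itv /= ?x1 ?y1 andbT lt_neqAle.
      by rewrite eq_sym zx.
    by rewrite eq_sym zy.
  move/negligibleP; apply; exact: measurableI.
pose S (p : int * int) : set (R * R) :=
  (fun z => (z.1 + - (p.1%:~R * (2 * pi)), z.2 + - (p.2%:~R * (2 * pi)))) @^-1` (corner `&` E).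
pose F (k : nat) : set (R * R) := if unpickle k is Some p then S p else set0.
have FE : ~` [set z | f z = 0] `<=` \bigcup_k F k.
  move=> z fz; have [m mx] := period_reduce z.1; have [n ny] := period_reduce z.2.
  exists (pickle (m, n)); first exact: I.
  rewrite /F pickleK; split.
    by split; rewrite /= in_itv.
  rewrite /E /= => fz0; apply: fz => /=; rewrite -fz0.
  rewrite -(periodic_shift m n _ _ pf) !subrK.
  by case: z {mx ny fz0}.
suff : mu.-negligible (~` [set z | f z = 0]) by [].
apply: (@negligibleS _ _ _ mu (\bigcup_k F k) _ FE); apply: negligible_bigcup => k; rewrite /F.
case: unpickle => [p|]; last exact: negligible_set0.
have mCE : measurable (corner `&` E) by exact: measurableI.
exists (S p); split; [|by rewrite -CE0; exact: measure_shift|exact: subset_refl].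
rewrite -[X in measurable X]setTI.
apply: (measurable_fun_pair (f := fun z : R * R => z.1 - p.1%:~R * (2 * pi))
  (g := fun z : R * R => z.2 - p.2%:~R * (2 * pi))) => //.
- by apply: measurable_funB; [exact: measurable_fst | exact: measurable_cst].
- by apply: measurable_funB; [exact: measurable_snd | exact: measurable_cst].
Qed.

Lemma continuous_ae_zero (g : R * R -> R) : continuous g ->
  (\forall z \ae mu, g z = 0) -> forall z, g z = 0.
Proof.
move=> cg [N [mN N0 gN]] z; apply/eqP/negPn/negP => gz.
have : nbhs z [set z | g z != 0].
  have /cvgrPdist_lt /(_ `|g z|) := cg z; rewrite normr_gt0 => /(_ gz).
  by apply: filterS => y; apply: contraTneq => ->; rewrite subr0 ltxx.
case/nbhs_ballP => e /= e0 eg.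
pose B : set (R * R) := `](z.1 - e), (z.1 + e)[%classic `*` `](z.2 - e), (z.2 + e)[%classic.
have mB : measurable B by apply: measurableX; exact: measurable_itv.
have BN : B `<=` N.
  move=> [x y] [] /=; rewrite !in_itv /= => xe ye; apply: gN => /= g0.
  have : g (x, y) != 0.
    by apply: eg; split; rewrite /ball /= ltr_norml; lra.
  by rewrite g0 eqxx.
have B0 : mu B = 0%E.
  by apply/eqP; rewrite -measure_le0 -N0 le_measure ?inE.
have : mu B = ((e + e)%:E * (e + e)%:E)%E.
  rewrite product_measure1E; [|exact: measurable_itv|exact: measurable_itv].
  have L (x : R) : lebesgue_measure (`](x - e), (x + e)[%classic : set R) = (e + e)%:E.
    rewrite lebesgue_measure_itv /= lte_fin ifT; last by lra.
    by rewrite -EFinD; congr (_%:E); ring.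
  exact: (congr2 (fun u v => u * v)%E (L z.1) (L z.2)).
by rewrite B0 -EFinM => -[] /eqP; rewrite eq_sym mulf_eq0 orbb gt_eqF // addr_gt0.
Qed.
End translation.

Section hartley_injective.
Variable R : realType.
Notation mu := (leb2 R).
Notation Q := (square R).
Notation D := (open_square R).

Let boundary : set (R * R) := Q `\` D.

Let measure_boundary : mu boundary = 0%E.
Proof.
have p0 := two_pi_gt0 R.
have QD : Q `&` D = D.
  apply/setIidPr => z [] /=; rewrite !in_itv /= => /andP[/ltW a /ltW b] /andP[/ltW c /ltW d].
  by split; rewrite /= in_itv /= ?a ?b ?c ?d.
have mD : mu D = ((2 * pi) ^+ 2)%:E.
  rewrite /open_square product_measure1E; [|exact: measurable_itv|exact: measurable_itv].
  have L : lebesgue_measure (`]0%R, 2 * pi[%classic : set R) = (2 * pi)%:E.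
    by rewrite lebesgue_measure_itv /= lte_fin p0 oppr0 adde0.
  by rewrite expr2 EFinM; exact: (congr2 (fun a b => a * b)%E L L).
rewrite /boundary measureD.
- transitivity (mu Q - mu (Q `&` D))%E; first by [].
  by rewrite QD measure_square mD subee.
- exact: measurable_square.
- exact: measurable_open_square.
- by rewrite [X in (X < _)%E]measure_square ltry.
Qed.

Lemma integral_open_square (h : R * R -> R) : mu.-integrable Q (fun z => (h z)%:E) ->
  (\int[mu]_(z in D) (h z)%:E)%E = (torus_int h)%:E.
Proof.
move=> ih; rewrite /torus_int /Rintegral fineK.
  have mB : measurable boundary.
    by apply: measurableD; [exact: measurable_square | exact: measurable_open_square].
  rewrite (@negligible_integral _ _ R mu Q boundary _ mB (@measurable_square R) ih measure_boundary).
  congr (integral _ _ _); apply/seteqP; split => z.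
    move=> [zx zy]; have Dz : D z by split.
    split; last by case.
    move: zx zy; rewrite /= !in_itv /= => /andP[/ltW a /ltW b] /andP[/ltW c /ltW d].
    by split; rewrite /= in_itv /= ?a ?b ?c ?d.
  by move=> [Qz nB]; apply: contrapT => nD; apply: nB.
exact: (@integrable_fin_num _ _ R mu Q (@measurable_square R) _ ih).
Qed.

Lemma hartley_eq0_ae (f : R * R -> R) : Defs.periodic f ->
  measurable_fun [set: R * R] f -> mu.-integrable Q (fun z => (f z)%:E) ->
  (forall k, hartley f k = 0) -> \forall z \ae mu, f z = 0.
Proof.
move=> pf mf intf f0; apply: ae_zero_periodic => //.
have intD : mu.-integrable D (fun z => (f z)%:E).
  apply: (@integrableS _ _ R mu Q D (fun z => (f z)%:E) (@measurable_square R) (@measurable_open_square R)) => //.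
  by move=> z [] /=; rewrite !in_itv /= => /andP[/ltW a /ltW b] /andP[/ltW c /ltW d];
    split; rewrite /= in_itv /= ?a ?b ?c ?d.
apply: fourier_zero_ae => // k.
rewrite integral_open_square.
  have := f0 k; rewrite /hartley => /eqP; rewrite mulf_eq0 invr_eq0 expf_eq0 /=.
  by rewrite gt_eqF ?two_pi_gt0 //= => /eqP ->.
apply: (@integrableMl _ _ R mu Q (@measurable_square R) (fun z => (f z)%:E) (cas k) intf).
  by have [mk _] := @bmeas_cas R k; exact: measurable_funTS.
exists 2; split; first exact: num_real.
by move=> M' MM' z _; apply: le_trans (cas_le2 k z) (ltW MM').
Qed.

Lemma hartley_eq0 (f : R * R -> R) : Defs.periodic f -> continuous f ->
  (forall k, hartley f k = 0) -> forall z, f z = 0.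
Proof.
move=> pf cf f0; apply: continuous_ae_zero => //.
have tf := continuous_tame cf.
by apply: hartley_eq0_ae => //; [exact: tf.1 | exact: tame_integrable].
Qed.
End hartley_injective.

Section families.
Variable R : realType.
Implicit Types (k : Z2) (z : R * R).
Notation fn := (freq_norm R).

Definition dist1 z z' : R := `|z.1 - z'.1| + `|z.2 - z'.2|.

Lemma dist1_ge0 z z' : 0 <= dist1 z z'.
Proof. by rewrite addr_ge0. Qed.

Let trig_lip (f df : R -> R) (a b : R) : (forall x : R, is_derive x 1 f (df x)) ->
  (forall x, `|df x| <= 1) -> `|f a - f b| <= `|a - b|.
Proof.
move=> fdf df1; wlog ab : a b / a <= b.
  by move=> H; have [/H//|/ltW/H] := leP a b; rewrite distrC [leRHS]distrC.
have [c _ E] := @MVT_derive R f df a b ab (fun x _ => fdf x).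
by rewrite distrC E normrM distrC ler_piMl.
Qed.

Lemma cas_lip k z z' : `|cas k z - cas k z'| <= 2 * fn k * dist1 z z'.
Proof.
have C := @trig_lip (@cos R) (fun x => - sin x) (phase k z) (phase k z') (@is_derive_cos R).
have S := @trig_lip (@sin R) (@cos R) (phase k z) (phase k z') (@is_derive_sin R) (@cos_max R).
have {}C : `|cos (phase k z) - cos (phase k z')| <= `|phase k z - phase k z'|.
  by apply: C => x; rewrite normrN sin_max.
have P : `|phase k z - phase k z'| <= fn k * dist1 z z'.
  rewrite /phase (_ : _ - _ = k.1%:~R * (z.1 - z'.1) + k.2%:~R * (z.2 - z'.2)); last by ring.
  apply: le_trans (ler_normD _ _) _; rewrite !normrM mulrDr.
  by apply: lerD; apply: ler_wpM2r => //; [exact: normr_freq1_le | exact: normr_freq2_le].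
rewrite /cas (_ : _ - _ = (cos (phase k z) - cos (phase k z')) +
  (sin (phase k z) - sin (phase k z'))); last by ring.
apply: le_trans (ler_normD _ _) _; rewrite -mulrA mulr_natl mulr2n.
by apply: lerD; [exact: le_trans C P | exact: le_trans S P].
Qed.

(** Families that are uniformly bounded and uniformly Lipschitz have pointwise
    limits along the ultrafilter that inherit these bounds. *)
Definition equilip (K : R) (F : nat -> R * R -> R) : Prop :=
  (forall n z, `|F n z| <= K) /\
  (forall n z z', `|F n z - F n z'| <= K * dist1 z z').

Definition plim (F : nat -> R * R -> R) z : R := ulim (fun n => F n z).

Lemma plim_cvg K F z : equilip K F -> F n z @[n --> ultra_nat] --> plim F z.
Proof. by move=> [FK _]; exact: ulim_cvg. Qed.

Lemma plim_le K F z : equilip K F -> `|plim F z| <= K.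
Proof.
move=> eF; apply: (ulim_norm_le (u := fun n => F n z)); first exact: plim_cvg eF.
by move=> n; exact: (proj1 eF).
Qed.

Lemma plim_lip K F z z' : equilip K F -> `|plim F z - plim F z'| <= K * dist1 z z'.
Proof.
move=> eF; apply: (ulim_norm_le (u := fun n => F n z - F n z')); last by move=> n; exact: (proj2 eF).
by apply: cvgB; exact: plim_cvg eF.
Qed.

Lemma lip_continuous (K : R) (f : R * R -> R) :
  (forall z z', `|f z - f z'| <= K * dist1 z z') -> continuous f.
Proof.
move=> fK z; have K0 : 0 <= K.
  have := fK (1, 0) (0, 0); rewrite /dist1 /= subr0 subrr normr1 normr0 addr0 mulr1.
  exact: le_trans.
have K1 : 0 < 2 * (K + 1) by rewrite mulr_gt0 // ltr_wpDl.
apply/cvgrPdist_le => e e0.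
have r0 : 0 < e / (2 * (K + 1)) by exact: divr_gt0.
apply: filterS (nbhsx_ballx z _ r0) => z' [/= /ltW z1 /ltW z2]; apply: le_trans (fK z z') _.
apply: (@le_trans _ _ ((K + 1) * (e / (2 * (K + 1)) + e / (2 * (K + 1))))).
  by apply: ler_pM; rewrite ?dist1_ge0 ?lerDl // lerD.
by rewrite le_eqVlt; apply/orP; left; apply/eqP; field; rewrite gt_eqF // ltr_wpDl.
Qed.

Lemma plim_continuous K F : equilip K F -> continuous (plim F).
Proof. by move=> eF; apply: (@lip_continuous K) => z z'; exact: plim_lip. Qed.

Lemma plim_periodic F : (forall n, Defs.periodic (F n)) -> Defs.periodic (plim F).
Proof.
move=> pF x y; split; congr ulim; apply/funext => n.
  by have [-> _] := pF n x y.
by have [_ ->] := pF n x y.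
Qed.

Lemma grid_near (m : nat) (x : R) : 0 <= x <= 2 * pi ->
  exists i : 'I_m.+1, `|x - 2 * pi * i%:R / m.+1%:R| <= 2 * pi / m.+1%:R.
Proof.
move=> /andP[x0 x1]; have p0 := two_pi_gt0 R; have m0 : 0 < m.+1%:R :> R by [].
pose y := x / (2 * pi) * m.+1%:R; have y0 : 0 <= y by rewrite /y mulr_ge0 // divr_ge0 // ltW.
have /andP[i1 i2] := truncn_itv y0.
have E (t : R) : x - 2 * pi * t / m.+1%:R = (y - t) * (2 * pi / m.+1%:R).
  by rewrite /y; field; rewrite !gt_eqF //; have := p0; lra.
have c0 : 0 <= 2 * pi / m.+1%:R :> R by rewrite divr_ge0 // ltW.
have ym : y <= m.+1%:R.
  by rewrite /y ler_piMl // ler_pdivrMr // mul1r.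
have [im|im] := ltnP (Num.truncn y) m.+1.
  exists (Ordinal im); rewrite E normrM [X in _ * X]ger0_norm // ler_piMl //=.
  rewrite ger0_norm ?subr_ge0 //; move: i2; rewrite -natr1.
  by move: (y) (Num.truncn y)%:R => a b; lra.
exists ord_max; rewrite E normrM [X in _ * X]ger0_norm // ler_piMl //=.
have : m.+1%:R <= y by rewrite -truncn_ge_nat.
move: ym; rewrite -natr1; move: (y) m%:R => a b ab ba.
by rewrite (_ : a - b = 1) ?normr1 //; lra.
Qed.

Lemma plim_uniform K F (eps : R) : equilip K F -> 0 < eps ->
  \forall n \near ultra_nat, forall z, square R z -> `|F n z - plim F z| <= eps.
Proof.
move=> eF eps0; have p0 := two_pi_gt0 R.
have K0 : 0 <= K by apply: le_trans (proj1 eF 0%N 0).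
pose m := Num.truncn (12 * K * (2 * pi) / eps).
have mE : 12 * K * (2 * pi) / m.+1%:R <= eps.
  rewrite ler_pdivrMr // [leRHS]mulrC -ler_pdivrMr //; apply/ltW; exact: truncnS_gt.
pose g (p : 'I_m.+1 * 'I_m.+1) : R * R :=
  (2 * pi * p.1%:R / m.+1%:R, 2 * pi * p.2%:R / m.+1%:R).
have : \forall n \near ultra_nat, forall p, `|F n (g p) - plim F (g p)| <= eps / 3.
  apply: filter_forall => p; have /cvgrPdist_le := @plim_cvg K F (g p) eF.
  move=> /(_ (eps / 3)); rewrite divr_gt0 // => /(_ isT).
  by apply: filterS => n; rewrite distrC.
apply: filterS => n Fg z [zx zy].
have [i ix] : exists i : 'I_m.+1, `|z.1 - 2 * pi * i%:R / m.+1%:R| <= 2 * pi / m.+1%:R.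
  by apply: grid_near; move: zx; rewrite /= in_itv.
have [j jy] : exists i : 'I_m.+1, `|z.2 - 2 * pi * i%:R / m.+1%:R| <= 2 * pi / m.+1%:R.
  by apply: grid_near; move: zy; rewrite /= in_itv.
have dz : K * dist1 z (g (i, j)) <= eps / 6.
  apply: (@le_trans _ _ (K * (2 * pi / m.+1%:R + 2 * pi / m.+1%:R))).
    by rewrite ler_wpM2l // lerD.
  rewrite ler_pdivlMr //; apply: le_trans mE; rewrite le_eqVlt; apply/orP; left.
  by apply/eqP; ring.
have h1 := le_trans (proj2 eF n z (g (i, j))) dz.
have h2 := le_trans (@plim_lip K F z (g (i, j)) eF) dz.
have h3 := Fg (i, j).
rewrite (_ : F n z - plim F z = (F n z - F n (g (i, j))) +
   (F n (g (i, j)) - plim F (g (i, j))) - (plim F z - plim F (g (i, j)))); last by ring.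
apply: le_trans (ler_normB _ _) _.
have := le_trans (ler_normD _ _) (lerD h1 h3).
by move: h2; clear -eps0; lra.
Qed.

Lemma torus_int_plim K F : equilip K F -> (forall n, tame (F n)) ->
  torus_int (F n) @[n --> ultra_nat] --> torus_int (plim F).
Proof.
move=> eF tF; have p2 : 0 < (2 * pi) ^+ 2 :> R by rewrite exprn_gt0 // two_pi_gt0.
have tl : tame (plim F) by apply: continuous_tame; exact: plim_continuous eF.
apply/cvgrPdist_le => e e0.
have e1 : 0 < e / (2 * pi) ^+ 2 by exact: divr_gt0.
have := plim_uniform eF e1; apply: filterS => n Fn.
rewrite distrC -torus_intB //.
apply: le_trans (torus_int_norm_le (tameB (tF n) tl) Fn) _.
by rewrite mulrC divfK // gt_eqF.
Qed.

Lemma hartley_plim K F k : equilip K F -> (forall n, tame (F n)) ->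
  hartley (F n) k @[n --> ultra_nat] --> hartley (plim F) k.
Proof.
move=> eF tF; apply: cvgMl_tmp.
have tl : tame (plim F) by apply: continuous_tame; exact: plim_continuous eF.
have K0 : 0 <= K by apply: le_trans (proj1 eF 0%N 0).
have eG : equilip (2 * K + K * (2 * fn k)) (fun n z => F n z * cas k z).
  split=> [n z|n z z'].
    rewrite normrM mulrC; apply: (@le_trans _ _ (2 * K)); last first.
      by rewrite lerDl !mulr_ge0 // fn_ge0.
    by apply: ler_pM => //; [exact: cas_le2 | exact: (proj1 eF)].
  rewrite (_ : _ - _ = (F n z - F n z') * cas k z + F n z' * (cas k z - cas k z')); last by ring.
  apply: le_trans (ler_normD _ _) _; rewrite !normrM mulrDl; apply: lerD.
    rewrite [leLHS]mulrC -mulrA; apply: ler_pM => //; [exact: cas_le2 | exact: (proj2 eF)].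
  by rewrite -mulrA; apply: ler_pM => //; [exact: (proj1 eF) | exact: cas_lip].
have E : plim (fun n z => F n z * cas k z) = (fun z => plim F z * cas k z).
  by apply/funext => z; apply: ulim_eq; apply: cvgMr_tmp; exact: plim_cvg eF.
by rewrite -E; apply: torus_int_plim eG _ => n; exact: tame_cas.
Qed.

Lemma plim_d1 K K' F G : equilip K F -> equilip K' G ->
  (forall n z, is_derive z ((1, 0) : R * R) (F n) (G n z)) ->
  forall z, is_derive z ((1, 0) : R * R) (plim F) (plim G z).
Proof.
move=> eF eG FG [x y]; apply/is_derive_slice1.
apply: (@is_derive_lim R ultra_nat _ (fun n x => F n (x, y)) (fun n x => G n (x, y))
   (fun x => plim F (x, y)) _ x K' 1) => //.
- by move=> n x' _; apply/is_derive_slice1.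
- move=> n x' _; apply: le_trans (proj2 eG n _ _) _.
  by rewrite /dist1 /= subrr normr0 addr0.
- by move=> x' _; exact: plim_cvg eF.
- exact: plim_cvg eG.
Qed.

Lemma plim_d2 K K' F G : equilip K F -> equilip K' G ->
  (forall n z, is_derive z ((0, 1) : R * R) (F n) (G n z)) ->
  forall z, is_derive z ((0, 1) : R * R) (plim F) (plim G z).
Proof.
move=> eF eG FG [x y]; apply/is_derive_slice2.
apply: (@is_derive_lim R ultra_nat _ (fun n y => F n (x, y)) (fun n y => G n (x, y))
   (fun y => plim F (x, y)) _ y K' 1) => //.
- by move=> n y' _; apply/is_derive_slice2.
- move=> n y' _; apply: le_trans (proj2 eG n _ _) _.
  by rewrite /dist1 /= subrr normr0 add0r.
- by move=> y' _; exact: plim_cvg eF.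
- exact: plim_cvg eG.
Qed.

(** Trigonometric polynomials; the reflection [e] of the frequencies is the
    identity or the opposite, and changes at every differentiation. *)
Definition trig (n : nat) (c : Z2 -> R) (e : Z2 -> Z2) z : R :=
  \sum_(k <- box n) c k * cas (e k) z.

Definition l1norm (m n : nat) (c : Z2 -> R) : R :=
  \sum_(k <- box n) (1 + fn k) ^+ m * `|c k|.

Lemma l1norm_ge0 m n c : 0 <= l1norm m n c.
Proof.
by apply: sumr_ge0 => k _; rewrite mulr_ge0 // exprn_ge0 // addr_ge0 // fn_ge0.
Qed.

Lemma l1norm_mono (m m' n : nat) c : (m <= m')%N -> l1norm m n c <= l1norm m' n c.
Proof.
move=> mm; apply: ler_sum => k _; rewrite ler_wpM2r //.
by rewrite ler_weXn2l // lerDl fn_ge0.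
Qed.

Lemma l1norm_freq (m n : nat) c (d : Z2 -> R) :
  (forall k, `|d k| <= fn k) -> l1norm m n (fun k => c k * d k) <= l1norm m.+1 n c.
Proof.
move=> dk; apply: ler_sum => k _; rewrite normrM exprSr -mulrA.
have f0 := fn_ge0 R k.
apply: ler_wpM2l; first by rewrite exprn_ge0 // addr_ge0.
rewrite mulrC; apply: ler_wpM2r => //; apply: le_trans (dk k) _.
by rewrite lerDr.
Qed.

Lemma trig_equilip (c : nat -> Z2 -> R) (e : Z2 -> Z2) K :
  (forall k, fn (e k) = fn k) -> (forall n, l1norm 1 n (c n) <= K) ->
  equilip (2 * K) (fun n => trig n (c n) e).
Proof.
move=> eE cK; split=> [n z|n z z'].
  apply: le_trans (ler_norm_sum _ _ _) _.
  apply: (@le_trans _ _ (2 * l1norm 1 n (c n))); last by rewrite ler_wpM2l.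
  rewrite mulr_sumr; apply: ler_sum => k _; rewrite normrM mulrC.
  apply: ler_pM => //; first exact: cas_le2.
  by rewrite ler_peMl // expr1 lerDl fn_ge0.
rewrite /trig -sumrB; apply: le_trans (ler_norm_sum _ _ _) _.
apply: (@le_trans _ _ (2 * l1norm 1 n (c n) * dist1 z z')); last first.
  by rewrite ler_wpM2r ?dist1_ge0 // ler_wpM2l.
rewrite -mulrA mulr_suml mulr_sumr; apply: ler_sum => k _; rewrite -mulrBr normrM.
have H := cas_lip (e k) z z'; rewrite eE in H.
apply: le_trans (ler_wpM2l (normr_ge0 _) H) _.
rewrite (_ : `|c n k| * (2 * fn k * dist1 z z') = 2 * (fn k * `|c n k| * dist1 z z')); last by ring.
by rewrite ler_wpM2l // ler_wpM2r ?dist1_ge0 // ler_wpM2r // expr1 lerDr.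
Qed.

Lemma trig_d1 n c e z : is_derive z ((1, 0) : R * R) (trig n c e)
  (trig n (fun k => c k * (e k).1%:~R) (fun k => - e k) z).
Proof.
apply: is_derive_sumr => k; have := is_derive_cas1 (e k) z.
rewrite -mulrA; move: (_ * cas (- e k) z) => d h.
by apply: is_derive_eq; rewrite /GRing.scale /=; ring.
Qed.

Lemma trig_d2 n c e z : is_derive z ((0, 1) : R * R) (trig n c e)
  (trig n (fun k => c k * (e k).2%:~R) (fun k => - e k) z).
Proof.
apply: is_derive_sumr => k; have := is_derive_cas2 (e k) z.
rewrite -mulrA; move: (_ * cas (- e k) z) => d h.
by apply: is_derive_eq; rewrite /GRing.scale /=; ring.
Qed.

Lemma trig_tame n c e : tame (trig n c e).
Proof.
by apply: tame_sum => k; apply: tameM; [exact: tame_cst | exact: cas_tame].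
Qed.

Lemma trig_periodic n c e : Defs.periodic (trig n c e).
Proof.
move=> x y; rewrite /trig; split; apply: eq_bigr => k _.
  by have [-> _] := cas_periodic (e k) x y.
by have [_ ->] := cas_periodic (e k) x y.
Qed.
End families.

Section evolution.
Variable R : realType.
Implicit Types (k : Z2) (z : R * R).
Notation fn := (freq_norm R).

Lemma ler_sum_seq (I : eqType) (r : seq I) (f g : I -> R) :
  (forall i, i \in r -> f i <= g i) -> \sum_(i <- r) f i <= \sum_(i <- r) g i.
Proof. by move=> fg; rewrite big_seq [leRHS]big_seq; exact: ler_sum. Qed.

Lemma l1norm_NL (m n : nat) (psi a b : Z2 -> R) :
  (forall j, j \in box n -> fn j * `|psi j| <= `|a j|) ->
  l1norm m n (NL (box n) psi b) <= 2 * l1norm m n a * l1norm m.+1 n b.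
Proof.
move=> psia; pose w (k : Z2) : R := (1 + fn k) ^+ m.
have w0 k : 0 <= w k by rewrite exprn_ge0 // addr_ge0 // fn_ge0.
have wD j k l : asel R j k l != 0 -> w l <= w j * w k.
  move=> /asel_freq; rewrite -exprMn; have := fn_ge0 R j; have := fn_ge0 R k.
  have := fn_ge0 R l => l0 k0 j0 lk.
  apply: lerXn2r; rewrite ?nnegrE ?mulr_ge0 ?addr_ge0 //.
  by rewrite mulrDl mul1r mulrDr mulr1; have := mulr_ge0 j0 k0; move: lk; lra.
pose T j k : R := `|psi j * b k * cross R j k|.
have T0 j k : 0 <= T j k by exact: normr_ge0.
apply: (@le_trans _ _ (2^-1 * \sum_(j <- box n) \sum_(k <- box n)
    T j k * (4 * (w j * w k)))).
  apply: (@le_trans _ _ (\sum_(l <- box n) 2^-1 * \sum_(j <- box n) \sum_(k <- box n)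
      T j k * (w l * asel R j k l))).
    apply: ler_sum => l _; rewrite normrM gtr0_norm // mulrCA ler_wpM2l //.
    apply: le_trans (ler_wpM2l (w0 l) (ler_norm_sum _ _ _)) _.
    rewrite mulr_sumr; apply: ler_sum => j _.
    apply: le_trans (ler_wpM2l (w0 l) (ler_norm_sum _ _ _)) _.
    rewrite mulr_sumr; apply: ler_sum => k _.
    by rewrite normrM mulrCA ler_wpM2l // ler_wpM2l // sel_le.
  rewrite -mulr_sumr ler_wpM2l // exchange_big; apply: ler_sum => j _ /=.
  rewrite exchange_big; apply: ler_sum => k _ /=.
  rewrite -mulr_sumr; apply: ler_wpM2l => //.
  by apply: sum_asel_le; rewrite ?box_uniq // => l; exact: wD.
have -> : 2 * l1norm m n a * l1norm m.+1 n b =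
    2^-1 * \sum_(j <- box n) \sum_(k <- box n)
      (w j * `|a j|) * ((1 + fn k) ^+ m.+1 * `|b k|) * 4.
  have -> : \sum_(j <- box n) \sum_(k <- box n)
      (w j * `|a j|) * ((1 + fn k) ^+ m.+1 * `|b k|) * 4 =
      l1norm m n a * l1norm m.+1 n b * 4.
    rewrite /l1norm !mulr_suml; apply: eq_bigr => j _.
    by rewrite mulr_sumr mulr_suml.
  by field.
rewrite ler_wpM2l //; apply: ler_sum_seq => j jn; apply: ler_sum => k _.
rewrite (_ : _ * 4 = `|a j| * (`|b k| * (1 + fn k)) * (4 * (w j * w k))); last first.
  by rewrite exprS -/(w k); ring.
apply: ler_wpM2r; first by rewrite !mulr_ge0.
rewrite /T !normrM -mulrA.
apply: (@le_trans _ _ (`|psi j| * (`|b k| * (fn j * fn k)))).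
  by rewrite ler_wpM2l // ler_wpM2l // cross_le.
rewrite (_ : _ * (_ * _) = (fn j * `|psi j|) * (`|b k| * fn k)); last by ring.
apply: ler_pM; rewrite ?mulr_ge0 ?fn_ge0 ?psia //.
by rewrite ler_wpM2l // lerDr.
Qed.

Lemma NL_sub (r : seq Z2) (psi psi' b b' : Z2 -> R) l :
  NL r psi b l - NL r psi' b' l =
  NL r (fun k => psi k - psi' k) b l + NL r psi' (fun k => b k - b' k) l.
Proof.
rewrite /NL -mulrBr -mulrDr; congr (_ * _); rewrite -sumrB -big_split /=.
apply: eq_bigr => j _; rewrite -sumrB -big_split /=; apply: eq_bigr => k _.
by ring.
Qed.

Lemma l1normD m n (a b : Z2 -> R) :
  l1norm m n (fun k => a k + b k) <= l1norm m n a + l1norm m n b.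
Proof.
rewrite /l1norm -big_split /=; apply: ler_sum => k _; rewrite -mulrDr.
by rewrite ler_wpM2l ?ler_normD // exprn_ge0 // addr_ge0 // fn_ge0.
Qed.

Lemma l1norm_le m n (a b : Z2 -> R) :
  (forall k, k \in box n -> `|a k| <= `|b k|) -> l1norm m n a <= l1norm m n b.
Proof.
move=> ab; apply: ler_sum_seq => k kn.
by rewrite ler_wpM2l ?ab // exprn_ge0 // addr_ge0 // fn_ge0.
Qed.

Lemma l1normZ m n (c : R) (a : Z2 -> R) :
  l1norm m n (fun k => c * a k) = `|c| * l1norm m n a.
Proof. by rewrite mulr_sumr; apply: eq_bigr => k _; rewrite normrM; ring. Qed.

(** Coefficient families that are bounded and Lipschitz in time, with [m] spatial
    derivatives, uniformly in the order of truncation. *)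
Definition tfam (m : nat) (K : R) (c : nat -> R -> Z2 -> R) : Prop :=
  (forall n t, 0 <= t -> l1norm m n (c n t) <= K) /\
  (forall n t t', 0 <= t -> 0 <= t' ->
     l1norm m n (fun k => c n t k - c n t' k) <= K * `|t - t'|).

Lemma tfam_freq m K c (d : Z2 -> R) : (forall k, `|d k| <= fn k) ->
  tfam m.+1 K c -> tfam m K (fun n t k => c n t k * d k).
Proof.
move=> dk [cK cL]; split=> [n t t0|n t t' t0 t'0].
  by apply: le_trans (cK n t t0); exact: l1norm_freq.
apply: le_trans (cL n t t' t0 t'0); apply: le_trans (l1norm_freq _ _ _ dk).
by apply: l1norm_le => k _; rewrite mulrBl.
Qed.

Lemma tfam_mul m K c (d : Z2 -> R) : (forall k, k != 0 -> `|d k| <= 1) ->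
  tfam m K c -> tfam m K (fun n t k => c n t k * d k).
Proof.
move=> dk [cK cL]; split=> [n t t0|n t t' t0 t'0].
  apply: le_trans (cK n t t0); apply: l1norm_le => k kn.
  by rewrite normrM ler_piMr // dk // (box_neq0 kn).
apply: le_trans (cL n t t' t0 t'0); apply: l1norm_le => k kn.
by rewrite -mulrBl normrM ler_piMr // dk // (box_neq0 kn).
Qed.

Lemma tfam_mono m m' K c : (m <= m')%N -> tfam m' K c -> tfam m K c.
Proof.
move=> mm [cK cL]; split=> *; first exact: le_trans (l1norm_mono _ _ mm) (cK _ _ _).
exact: le_trans (l1norm_mono _ _ mm) (cL _ _ _ _ _).
Qed.

(** The field whose coefficients are the limits of the coefficients [c n t]. *)
Definition field (c : nat -> R -> Z2 -> R) (e : Z2 -> Z2) (t : R) : R * R -> R :=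
  plim (fun n => trig n (c n t) e).

Lemma tfam_equilip K c e t : (forall k, fn (e k) = fn k) -> tfam 1 K c -> 0 <= t ->
  equilip (2 * K) (fun n => trig n (c n t) e).
Proof. by move=> eE [cK _] t0; apply: trig_equilip => // n; exact: cK. Qed.

Lemma trig_sub n c c' e z : trig n c e z - trig n c' e z =
  trig n (fun k => c k - c' k) e z :> R.
Proof. by rewrite -sumrB; apply: eq_bigr => k _; rewrite mulrBl. Qed.

Lemma trig_le n c e z : `|trig n c e z| <= 2 * l1norm 0 n c :> R.
Proof.
apply: le_trans (ler_norm_sum _ _ _) _; rewrite mulr_sumr; apply: ler_sum => k _.
by rewrite normrM mulrC expr0 mul1r ler_wpM2r // cas_le2.
Qed.

Lemma trig_time K c e n t t' z : tfam 1 K c -> 0 <= t -> 0 <= t' ->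
  `|trig n (c n t) e z - trig n (c n t') e z| <= 2 * K * `|t - t'|.
Proof.
move=> [_ cL] t0 t'0; rewrite trig_sub; apply: le_trans (trig_le _ _ _ _) _.
rewrite -mulrA ler_wpM2l //; apply: le_trans (cL n t t' t0 t'0).
exact: l1norm_mono.
Qed.

Lemma field_time K c e t t' z : (forall k, fn (e k) = fn k) -> tfam 1 K c ->
  0 <= t -> 0 <= t' -> `|field c e t z - field c e t' z| <= 2 * K * `|t - t'|.
Proof.
move=> eE cK t0 t'0.
apply: (ulim_norm_le (u := fun n => trig n (c n t) e z - trig n (c n t') e z)).
  by apply: cvgB; [exact: plim_cvg (tfam_equilip eE cK t0)
                  |exact: plim_cvg (tfam_equilip eE cK t'0)].
by move=> n; exact: trig_time cK t0 t'0.
Qed.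

Lemma field_d1 K c e t z : (forall k, fn (e k) = fn k) -> tfam 2 K c -> 0 <= t ->
  is_derive z ((1, 0) : R * R) (field c e t)
    (field (fun n t k => c n t k * (e k).1%:~R) (fun k => - e k) t z).
Proof.
move=> eE cK t0.
have cK1 : tfam 1 K (fun n t k => c n t k * (e k).1%:~R).
  by apply: tfam_freq cK => k; rewrite -eE normr_freq1_le.
have c1 : tfam 1 K c by exact: tfam_mono cK.
have eE' k : fn (- e k) = fn k by rewrite fnN eE.
apply: plim_d1 (tfam_equilip eE c1 t0) (tfam_equilip eE' cK1 t0) _ _ => n z'.
exact: trig_d1.
Qed.

Lemma field_d2 K c e t z : (forall k, fn (e k) = fn k) -> tfam 2 K c -> 0 <= t ->
  is_derive z ((0, 1) : R * R) (field c e t)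
    (field (fun n t k => c n t k * (e k).2%:~R) (fun k => - e k) t z).
Proof.
move=> eE cK t0.
have cK1 : tfam 1 K (fun n t k => c n t k * (e k).2%:~R).
  by apply: tfam_freq cK => k; rewrite -eE normr_freq2_le.
have c1 : tfam 1 K c by exact: tfam_mono cK.
have eE' k : fn (- e k) = fn k by rewrite fnN eE.
apply: plim_d2 (tfam_equilip eE c1 t0) (tfam_equilip eE' cK1 t0) _ _ => n z'.
exact: trig_d2.
Qed.

Lemma field_continuous K c e t : (forall k, fn (e k) = fn k) -> tfam 1 K c ->
  0 <= t -> continuous (field c e t).
Proof. by move=> eE cK t0; exact: plim_continuous (tfam_equilip eE cK t0). Qed.

Lemma field_periodic c e t : Defs.periodic (field c e t).
Proof. by apply: plim_periodic => n; exact: trig_periodic. Qed.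

Lemma trig_hartley n c k : hartley (trig n c id) k = if k \in box n then c k else 0 :> R.
Proof. by rewrite /trig hartley_sum // box_uniq. Qed.

Lemma field_mean_free K c e t : (forall k, fn (e k) = fn k) -> 
  (forall k, k != 0 -> e k != 0) -> tfam 1 K c -> 0 <= t ->
  mean_free (field c e t).
Proof.
move=> eE e0 cK t0; have tT n : tame (trig n (c n t) e) by exact: trig_tame.
have := torus_int_plim (tfam_equilip eE cK t0) tT.
rewrite (_ : (fun n => torus_int _) = fun=> 0) => [L|].
  by apply: (cvg_unique _ L); [exact: Rhausdorff | exact: cvg_cst].
apply/funext => n; rewrite /trig torus_int_sum; last first.
  by move=> k; apply: tameM; [exact: tame_cst|exact: cas_tame].
rewrite big_seq big1 // => k kn; rewrite torus_intZ ?torus_int_cas; last exact: cas_tame.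
by rewrite (negPf (e0 _ (box_neq0 kn))) !mulr0.
Qed.

Lemma field_joint K c e : (forall k, fn (e k) = fn k) -> tfam 1 K c ->
  forall p : R * (R * R), 0 <= p.1 -> forall eps, 0 < eps ->
  \forall q \near p, 0 <= q.1 -> `|field c e p.1 p.2 - field c e q.1 q.2| <= eps.
Proof.
move=> eE cK [t z] /= t0 eps eps0.
have K0 : 0 <= K by case: cK => /(_ 0%N 0 (lexx _)) + _; apply: le_trans; exact: l1norm_ge0.
have K1 : 0 < 6 * (K + 1) by rewrite mulr_gt0 // ltr_wpDl.
have r0 : 0 < eps / (6 * (K + 1)) by exact: divr_gt0.
apply: filterS (nbhsx_ballx (t, z) _ r0) => -[s [x y]] [/= /ltW ts [/= /ltW zx /ltW zy]] s0.
rewrite (_ : _ - _ = (field c e t z - field c e s z) + (field c e s z - field c e s (x, y)));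
  last by ring.
apply: le_trans (ler_normD _ _) _.
have H1 := field_time z eE cK t0 s0.
have H2 := plim_lip z (x, y) (tfam_equilip eE cK s0).
apply: le_trans (lerD H1 H2) _; rewrite -mulrDr /dist1 /=.
apply: (@le_trans _ _ (2 * (K + 1) * (eps / (6 * (K + 1)) + (eps / (6 * (K + 1)) + eps / (6 * (K + 1)))))).
  apply: ler_pM; rewrite ?mulr_ge0 ?addr_ge0 //; first by rewrite ler_wpM2l // lerDl.
  by rewrite !lerD.
rewrite le_eqVlt; apply/orP; left; apply/eqP; field.
by rewrite gt_eqF // ltr_wpDl.
Qed.
End evolution.

Section galerkin_families.
Variables (R : realType) (nu alpha : R).
Hypotheses (nu0 : 0 < nu) (alpha0 : 0 < alpha).
Implicit Types (k : Z2).
Notation fsq := (freq_sq R).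
Notation fn := (freq_norm R).

Let nn : 0 <= nu / alpha ^+ 2.
Proof. by rewrite divr_ge0 ?sqr_ge0 // ltW. Qed.

Lemma stream_freq (a : Z2 -> R) j : j != 0 -> fn j * `|stream alpha a j| <= `|a j|.
Proof.
move=> j0; apply: (@le_trans _ _ (`|stream alpha a j| * fsq j)).
  rewrite mulrC ler_wpM2l // -fn_sqr expr2 ler_peMl ?fn_ge0 //; exact: fn_ge1.
rewrite (stream_le alpha a j0) ler_pdivrMr ?helm_gt0 // ler_peMr //.
exact: helm_ge1.
Qed.

Lemma galerkin_sub_l1 m n (x y : Z2 -> R) :
  l1norm m n (fun k => galerkin nu alpha n x k - galerkin nu alpha n y k) <=
  nu / alpha ^+ 2 * l1norm m n (fun k => x k - y k) +
  2 * l1norm m n (fun k => x k - y k) * l1norm m.+1 n x +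
  2 * l1norm m n y * l1norm m.+1 n (fun k => x k - y k).
Proof.
have S j : stream alpha x j - stream alpha y j = stream alpha (fun k => x k - y k) j.
  by rewrite /stream -mulrBl opprB addrC opprK addrC.
have N1 := @l1norm_NL _ m n (fun k => stream alpha x k - stream alpha y k)
  (fun k => x k - y k) x.
have N2 := @l1norm_NL _ m n (stream alpha y) y (fun k => x k - y k).
have {}N2 := N2 (fun j jn => stream_freq y (box_neq0 jn)).
have {}N1 : l1norm m n (NL (box n) (fun k => stream alpha x k - stream alpha y k) x) <=
    2 * l1norm m n (fun k => x k - y k) * l1norm m.+1 n x.
  by apply: N1 => j jn; rewrite S; exact: stream_freq (box_neq0 jn).
have D : l1norm m n (fun k => - damping nu alpha k * (x k - y k)) <=
    nu / alpha ^+ 2 * l1norm m n (fun k => x k - y k).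
  have dl k : damping nu alpha k <= nu / alpha ^+ 2 by exact: damping_le.
  move: (nu / alpha ^+ 2) (nn) dl => c c0 dl.
  rewrite -[X in X * _](ger0_norm c0) -l1normZ.
  apply: l1norm_le => k _; rewrite !normrM normrN ler_wpM2r //.
  rewrite (ger0_norm c0) ger0_norm; last exact: damping_ge0.
  exact: dl.
apply: le_trans (lerD (lerD D N1) N2).
rewrite /l1norm -!big_split /=; apply: ler_sum_seq => k kn; rewrite -!mulrDr.
apply: ler_wpM2l; first by rewrite exprn_ge0 // addr_ge0 // fn_ge0.
rewrite /galerkin kn.
have := NL_sub (box n) (stream alpha x) (stream alpha y) x y k.
move: (NL _ (stream alpha x) x k) (NL _ (stream alpha y) y k).
move: (NL _ _ _ _) (NL _ _ _ _) => B A p q pq.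
rewrite (_ : _ - _ = - damping nu alpha k * (x k - y k) - A - B); last first.
  by rewrite (_ : p = q + (A + B)); [ring | rewrite -pq; ring].
by apply: le_trans (ler_normB _ _) _; rewrite lerD2r; exact: ler_normB.
Qed.

(** Galerkin solutions of all orders with a common Gevrey bound. *)
Definition galerkin_family (sg tau0 M : R) (a : Z2 -> R) (h : nat -> R -> Z2 -> R) :=
  [/\ forall n k, h n 0 k = if k \in box n then a k else 0,
      forall n (t : R) k, 0 <= t ->
        is_derive t 1 ((h n)^~ k) (galerkin nu alpha n (h n t) k),
      forall n (t : R) k, 0 <= t -> k \notin box n -> h n t k = 0 &
      forall n (t : R), 0 <= t ->
        \sum_(k <- box n) (gw sg (radius nu alpha tau0 M t) k * h n t k) ^+ 2 <= M ^+ 2].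

Lemma galerkin_family_exists (sg tau0 M : R) (a : Z2 -> R) :
  0 < sg -> sg <= 1 -> 0 < tau0 -> 0 <= M ->
  (forall n, \sum_(k <- box n) (gw sg tau0 k * a k) ^+ 2 <= M ^+ 2) ->
  exists h, galerkin_family sg tau0 M a h.
Proof.
move=> sg0 sg1 t0 M0 aM.
have [h hP] := choice (fun n => galerkin_solution nu0 alpha0 n a).
exists h; split=> [n|n|n|n t t1]; have [h0 hG hb hE] := hP n => //.
exact: (galerkin_gevrey nu0 alpha0 sg0 sg1 t0 M0 h0 hG hE (aM n)).
Qed.

Section bounds.
Variables (sg tau0 M : R) (a : Z2 -> R) (h : nat -> R -> Z2 -> R).
Hypotheses (sg0 : 0 < sg) (tau00 : 0 < tau0) (M0 : 0 <= M).
Hypothesis hP : galerkin_family sg tau0 M a h.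

Definition radius_inf : R := tau0 * expR (- (20 * M / alpha / lm nu alpha)).

Lemma radius_inf_gt0 : 0 < radius_inf.
Proof. by rewrite mulr_gt0 ?expR_gt0. Qed.

Lemma radius_ge_inf (t : R) : radius_inf <= radius nu alpha tau0 M t.
Proof.
rewrite ler_wpM2l ?(ltW tau00) // ler_expR lerN2.
have l0 := lm_gt0 alpha nu0.
apply: ler_wpM2l; first by rewrite divr_ge0 ?mulr_ge0 // ltW.
by rewrite ler_pdivrMr // mulVf ?gt_eqF // lerBlDr lerDl expR_ge0.
Qed.

Lemma family_coef_le n (t : R) k : 0 <= t -> k \in box n ->
  `|h n t k| <= M * (gw sg radius_inf k)^-1.
Proof.
move=> t0 kn; have [_ _ _ /(_ n t t0) hM] := hP.
have g0 := gw_gt0 sg radius_inf k.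
have gg : gw sg radius_inf k <= gw sg (radius nu alpha tau0 M t) k.
  by rewrite gw.unlock ler_expR ler_wpM2r ?powR_ge0 ?radius_ge_inf.
rewrite ler_pdivlMr //; apply: (@le_trans _ _ `|gw sg (radius nu alpha tau0 M t) k * h n t k|).
  by rewrite normrM mulrC ler_wpM2r // ger0_norm ?gw_ge0.
rewrite -(@ler_pXn2r _ 2) ?nnegrE // real_normK ?num_real //.
apply: le_trans hM; rewrite (bigD1_seq k) ?box_uniq //= lerDl.
by apply: sumr_ge0 => l _; exact: sqr_ge0.
Qed.

Lemma family_bounded m : exists2 K, 0 <= K & forall n t, 0 <= t -> l1norm m n (h n t) <= K.
Proof.
have [K K0 gK] := sum_gevrey_le m sg0 radius_inf_gt0.
exists (M * K) => [|n t t0]; first exact: mulr_ge0.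
apply: le_trans (ler_wpM2l M0 (gK n)); rewrite mulr_sumr.
apply: ler_sum_seq => k kn; rewrite mulrCA ler_wpM2l ?family_coef_le //.
by rewrite exprn_ge0 // addr_ge0 // fn_ge0.
Qed.

Lemma family_galerkin_bounded m : exists2 K, 0 <= K &
  forall n t, 0 <= t -> l1norm m n (galerkin nu alpha n (h n t)) <= K.
Proof.
have [K0 K00 hK0] := family_bounded m; have [K1 K10 hK1] := family_bounded m.+1.
exists (nu / alpha ^+ 2 * K0 + 2 * K0 * K1) => [|n t t0].
  by apply: addr_ge0; rewrite mulr_ge0 // mulr_ge0.
have := galerkin_sub_l1 m n (h n t) (fun=> 0).
have Z l : l1norm l n (fun=> 0 : R) = 0.
  by rewrite /l1norm big1 // => k _; rewrite normr0 mulr0.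
have E l : l1norm l n (fun k => h n t k - 0) = l1norm l n (h n t).
  by apply: eq_bigr => k _; rewrite subr0.
rewrite !E Z mulr0 mul0r addr0.
rewrite (_ : l1norm m n (fun k => _ - _) = l1norm m n (galerkin nu alpha n (h n t))).
  move=> H; apply: le_trans H _; apply: lerD.
    by rewrite ler_wpM2l ?hK0.
  apply: ler_pM; rewrite ?mulr_ge0 ?l1norm_ge0 ?hK1 //.
  by rewrite ler_wpM2l ?hK0.
apply: eq_bigr => k _; rewrite [X in _ - X](_ : _ = 0) ?subr0 //.
rewrite /galerkin; case: ifP => // _; rewrite mulr0 /NL.
rewrite big1 ?mulr0 ?subr0 // => i _; rewrite big1 // => j _.
by rewrite mulr0 !mul0r.
Qed.

(** Testing with the signs of the increments turns the mean value theorem for a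
    single function of time into a bound on a sum. *)
Lemma family_lipschitz m : exists2 K, 0 <= K & forall n t t', 0 <= t -> 0 <= t' ->
  l1norm m n (fun k => h n t k - h n t' k) <= K * `|t - t'|.
Proof.
have [K K0 gK] := family_galerkin_bounded m; have [_ hG _ _] := hP.
exists K => // n t t' t0 t'0.
wlog tt : t t' t0 t'0 / t' <= t.
  move=> H; have [/H|/ltW/H] := leP t' t; first exact.
  rewrite distrC => /(_ t'0 t0); rewrite /l1norm.
  by under eq_bigr do rewrite distrC.
pose q k := (1 + fn k) ^+ m * Num.sg (h n t k - h n t' k).
have [c /andP[c1 c2]] : exists2 c, t' <= c <= t &
    \sum_(k <- box n) q k * h n t k - \sum_(k <- box n) q k * h n t' k =
    (\sum_(k <- box n) q k * galerkin nu alpha n (h n c) k) * (t - t').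
  apply: (@MVT_derive R (fun t => \sum_(k <- box n) q k * h n t k)
    (fun c => \sum_(k <- box n) q k * galerkin nu alpha n (h n c) k)) => // x /andP[x1 _].
  apply: is_derive_sumr => k; have := hG n x k (le_trans t'0 x1) => d.
  by apply: is_derive_eq; rewrite /GRing.scale /=; ring.
rewrite -sumrB; under eq_bigr do rewrite -mulrBr /q -mulrA -normrEsg.
rewrite -/(l1norm m n (fun k => h n t k - h n t' k)) => ->.
rewrite [`|t - t'|]ger0_norm ?subr_ge0 // ler_wpM2r ?subr_ge0 //.
apply: le_trans (gK n c (le_trans t'0 c1)).
apply: ler_sum => k _; rewrite /q -mulrA ler_wpM2l ?exprn_ge0 ?addr_ge0 ?fn_ge0 //.
apply: le_trans (ler_norm _) _; rewrite normrM ler_piMl // normr_sg.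
by case: (_ != 0).
Qed.

Lemma family_tfam m : exists2 K : R, tfam m K h & tfam m K (fun n t => galerkin nu alpha n (h n t)).
Proof.
have [A A0 hA] := family_bounded m; have [A' A'0 hA'] := family_bounded m.+1.
have [B B0 hB] := family_galerkin_bounded m.
have [L L0 hL] := family_lipschitz m; have [L' L'0 hL'] := family_lipschitz m.+1.
pose G := nu / alpha ^+ 2 * L + 2 * L * A' + 2 * A * L'.
have G0 : 0 <= G.
  rewrite /G; apply: addr_ge0; first apply: addr_ge0; first exact: mulr_ge0.
    by rewrite !mulr_ge0.
  by rewrite !mulr_ge0.
exists (A + B + L + G); split=> [n t t0|n t t' t0 t'0].
- by apply: le_trans (hA n t t0) _; move: B0 L0 G0; move: (G) => c; lra.
- apply: le_trans (hL n t t' t0 t'0) _; rewrite ler_wpM2r //.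
  by move: A0 B0 G0; move: (G) => c; lra.
- apply: le_trans (hB n t t0) _.
  by move: A0 L0 G0; move: (G) => c; lra.
apply: le_trans (galerkin_sub_l1 m n (h n t) (h n t')) _.
apply: (@le_trans _ _ (G * `|t - t'|)); last first.
  by rewrite ler_wpM2r // lerDr !addr_ge0.
set d := `|t - t'|; rewrite (_ : G * d =
  nu / alpha ^+ 2 * (L * d) + 2 * (L * d) * A' + 2 * A * (L' * d)); last first.
  by rewrite /G; move: (nu / alpha ^+ 2) => c; ring.
apply: lerD; first apply: lerD.
- by rewrite ler_wpM2l ?hL.
- apply: ler_pM; rewrite ?mulr_ge0 ?l1norm_ge0 ?hA' //.
  by rewrite ler_wpM2l ?hL.
apply: ler_pM; rewrite ?mulr_ge0 ?l1norm_ge0 ?hL' //.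
by rewrite ler_wpM2l ?hA.
Qed.
End bounds.
End galerkin_families.

Section residual.
Variables (R : realType) (nu alpha : R).
Hypotheses (nu0 : 0 < nu) (alpha0 : 0 < alpha).
Implicit Types (k : Z2).
Notation fsq := (freq_sq R).
Notation fn := (freq_norm R).
Notation opp := (fun k : Z2 => - k).

(** The part of the mode [e] that the truncation loses. *)
Definition tail n (e : Z2) (z : R * R) : R :=
  cas e z - \sum_(l <- box n) (l == e)%:R * cas l z.

Lemma tail_le n e z : e != 0 -> n%:R * `|tail n e z| <= 2 * fn e.
Proof.
move=> e0; rewrite /tail; have [en|en] := boolP (e \in box n).
  rewrite (bigD1_seq e) ?box_uniq //= eqxx mul1r big1 ?addr0 ?subrr; last first.
    by move=> l /negPf ->; rewrite mul0r.
  by rewrite normr0 mulr0 mulr_ge0 ?fn_ge0.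
rewrite big_seq big1 ?subr0; last first.
  by move=> l ln; have [le|] := eqVneq l e; [rewrite -le ln in en|rewrite mul0r].
rewrite mulrC; apply: ler_pM => //; first exact: cas_le2.
exact: box_compl.
Qed.

Definition product_defect n j k (z : R * R) : R :=
  cas (- j) z * cas (- k) z - 2^-1 * \sum_(l <- box n) sel R j k l * cas l z.

Lemma product_defectE n j k z : product_defect n j k z =
  2^-1 * (tail n (- j - k) z - tail n (j + k) z + tail n (j - k) z + tail n (k - j) z).
Proof.
rewrite /product_defect cas_mul -mulrBr; congr (_ * _).
rewrite !opprK [- k + j]addrC [- j + k]addrC /tail.
have -> : \sum_(l <- box n) sel R j k l * cas l z =
    \sum_(l <- box n) (l == - j - k)%:R * cas l z
    - \sum_(l <- box n) (l == j + k)%:R * cas l z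
    + \sum_(l <- box n) (l == j - k)%:R * cas l z
    + \sum_(l <- box n) (l == k - j)%:R * cas l z.
  rewrite -sumrB -!big_split /=; apply: eq_bigr => l _.
  by rewrite /sel !mulrDl mulNr.
by move: (\sum_(l <- _) _) (\sum_(l <- _) _) (\sum_(l <- _) _) (\sum_(l <- _) _) => *; ring.
Qed.

Lemma product_defect_le n j k z :
  n%:R * (`|cross R j k| * `|product_defect n j k z|) <=
  `|cross R j k| * (4 * (fn j + fn k)).
Proof.
rewrite mulrCA; have [->|c0] := eqVneq (cross R j k) 0; first by rewrite normr0 !mul0r.
rewrite ler_wpM2l // product_defectE.
have T e : (e = 0 -> cross R j k = 0) -> fn e <= fn j + fn k ->
    n%:R * `|tail n e z| <= 2 * (fn j + fn k).
  move=> e0 ek; have [/e0 E|en] := eqVneq e 0; first by rewrite E eqxx in c0.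
  by apply: le_trans (tail_le n z en) _; rewrite ler_wpM2l.
have X1 : j = - k -> cross R j k = 0.
  by move=> ->; rewrite -[k in X in cross _ _ X]opprK crossNr crossxx oppr0.
have X2 : j = k -> cross R j k = 0 by move=> ->; rewrite crossxx.
have f1 : fn (j - k) <= fn j + fn k by rewrite -(fnN R k) fnD.
have t1 := T (- j - k); have t2 := T (j + k); have t3 := T (j - k); have t4 := T (k - j).
have {}t1 : n%:R * `|tail n (- j - k) z| <= 2 * (fn j + fn k).
  apply: t1; last by rewrite -opprD fnN fnD.
  by move/eqP; rewrite -opprD oppr_eq0 addr_eq0 => /eqP.
have {}t2 : n%:R * `|tail n (j + k) z| <= 2 * (fn j + fn k).
  by apply: t2; [move/eqP; rewrite addr_eq0 => /eqP | exact: fnD].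
have {}t3 : n%:R * `|tail n (j - k) z| <= 2 * (fn j + fn k).
  by apply: t3 => //; move/eqP; rewrite subr_eq0 => /eqP.
have {}t4 : n%:R * `|tail n (k - j) z| <= 2 * (fn j + fn k).
  by apply: t4; [move/eqP; rewrite subr_eq0 => /eqP /esym | rewrite -fnN opprB].
move: t1 t2 t3 t4; move: (tail n _ z) (tail n _ z) (tail n _ z) (tail n _ z) => a b c d.
rewrite normrM gtr0_norm //; move: (fn j + fn k) => f t1 t2 t3 t4.
have N : `|d - c + b + a| <= `|d| + `|c| + `|b| + `|a|.
  apply: le_trans (ler_normD _ _) _; rewrite lerD2r.
  by apply: le_trans (ler_normD _ _) _; rewrite lerD2r; exact: ler_normB.
have := ler_wpM2l (ler0n R n) N; rewrite !mulrDr => {}N.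
rewrite mulrCA ler_pdivrMl //; apply: le_trans N _.
by move: t1 t2 t3 t4; move: (n%:R * _) (n%:R * _) (n%:R * _) (n%:R * _) => *; lra.
Qed.

Lemma galerkin_residual n (a : Z2 -> R) z :
  n%:R * `|trig n (galerkin nu alpha n a) id z
    - nu * trig n (fun k => a k * (helm alpha k)^-1 * - fsq k) id z
    + (trig n (fun k => stream alpha a k * - k.2%:~R) opp z * trig n (fun k => a k * k.1%:~R) opp z
       + trig n (fun k => stream alpha a k * k.1%:~R) opp z * trig n (fun k => a k * k.2%:~R) opp z)|
  <= 4 * l1norm 1 n a * l1norm 2 n a.
Proof.
have E1 : trig n (galerkin nu alpha n a) id z
    - nu * trig n (fun k => a k * (helm alpha k)^-1 * - fsq k) id z =
    - \sum_(l <- box n) NL (box n) (stream alpha a) a l * cas l z.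
  rewrite /trig mulr_sumr -sumrB -sumrN; apply: eq_big_seq => l ln.
  by rewrite /galerkin ln /damping; ring.
have E2 : trig n (fun k => stream alpha a k * - k.2%:~R) opp z * trig n (fun k => a k * k.1%:~R) opp z
    + trig n (fun k => stream alpha a k * k.1%:~R) opp z * trig n (fun k => a k * k.2%:~R) opp z =
    \sum_(j <- box n) \sum_(k <- box n)
      stream alpha a j * a k * cross R j k * (cas (- j) z * cas (- k) z).
  rewrite /trig !mulr_suml -big_split /=; apply: eq_bigr => j _.
  rewrite !mulr_sumr -big_split /=; apply: eq_bigr => k _.
  by rewrite /cross; ring.
have E3 : \sum_(l <- box n) NL (box n) (stream alpha a) a l * cas l z =
    \sum_(j <- box n) \sum_(k <- box n) stream alpha a j * a k * cross R j k *
      (2^-1 * \sum_(l <- box n) sel R j k l * cas l z).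
  transitivity (\sum_(l <- box n) \sum_(j <- box n) \sum_(k <- box n)
      stream alpha a j * a k * cross R j k * (2^-1 * (sel R j k l * cas l z))).
    apply: eq_bigr => l _; rewrite /NL mulrAC mulr_sumr; apply: eq_bigr => j _.
    by rewrite mulr_sumr; apply: eq_bigr => k _; ring.
  rewrite exchange_big; apply: eq_bigr => j _ /=.
  rewrite exchange_big; apply: eq_bigr => k _ /=.
  by rewrite -!mulr_sumr.
rewrite E1 E2 E3 addrC -sumrB.
apply: (@le_trans _ _ (\sum_(j <- box n) \sum_(k <- box n)
    `|stream alpha a j| * `|a k| * (`|cross R j k| * (4 * (fn j + fn k))))).
  rewrite mulrC; apply: le_trans (ler_wpM2r (ler0n _ _) (ler_norm_sum _ _ _)) _.
  rewrite mulr_suml; apply: ler_sum => j _; rewrite -sumrB.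
  apply: le_trans (ler_wpM2r (ler0n _ _) (ler_norm_sum _ _ _)) _.
  rewrite mulr_suml; apply: ler_sum => k _; rewrite -mulrBr -/(product_defect n j k z).
  apply: le_trans (ler_wpM2l _ (product_defect_le n j k z)); last by rewrite mulr_ge0.
  by rewrite !normrM le_eqVlt; apply/orP; left; apply/eqP; ring.
rewrite (_ : 4 * l1norm 1 n a * l1norm 2 n a = \sum_(j <- box n) \sum_(k <- box n)
    4 * (`|a j| * ((1 + fn j) * (1 + fn k) ^+ 2 * `|a k|))); last first.
  rewrite /l1norm [X in X * _]mulr_sumr mulr_suml; apply: eq_bigr => j _.
  by rewrite mulr_sumr; apply: eq_bigr => k _; rewrite expr1; ring.
apply: ler_sum_seq => j jn; apply: ler_sum => k _.
have C := cross_le R j k; have S := stream_freq alpha a (box_neq0 jn).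
have := fn_ge0 R j; have := fn_ge0 R k; move: C S.
have := normr_ge0 (cross R j k); have := normr_ge0 (a k); have := normr_ge0 (stream alpha a j).
move: `|stream alpha a j| `|a j| `|a k| `|cross R j k| (fn j) (fn k).
move=> s aj ak c fj fk s0 ak0 c0 cf sa fk0 fj0.
apply: (@le_trans _ _ (s * ak * (fj * fk * (4 * (fj + fk))))).
  by rewrite ler_wpM2l ?mulr_ge0 // ler_wpM2r // mulr_ge0 // addr_ge0.
rewrite (_ : s * ak * _ = 4 * ((fj * s) * ((fj + fk) * fk * ak))); last by ring.
rewrite ler_wpM2l //; apply: ler_pM => //; rewrite ?mulr_ge0 ?addr_ge0 //.
rewrite ler_wpM2r // expr2 mulrA; apply: ler_pM; rewrite ?addr_ge0 ?lerDr //.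
by rewrite mulrDl mul1r mulrDr mulr1; have := mulr_ge0 fj0 fk0; lra.
Qed.
End residual.

Section gevrey_hartley.
Variable R : realType.
Implicit Types (k : Z2) (v : R * R -> R).
Notation mu := (leb2 R).
Notation Q := (square R).
Notation fn := (freq_norm R).

Lemma square_integrable_integrable v : square_integrable v ->
  mu.-integrable Q (fun z => (v z)%:E).
Proof.
move=> [mv iv]; have i1 : mu.-integrable Q (fun z => (1 + v z ^+ 2)%:E).
  have -> : (fun z => (1 + v z ^+ 2)%:E) = ((fun=> 1%:E) \+ (fun z => (v z ^+ 2)%:E))%E.
    by apply/funext => z; rewrite /= EFinD.
  apply: (@integrableD _ _ R mu Q (@measurable_square R)) => //.
  exact: tame_integrable (tame_cst 1).
apply: (@le_integrable _ _ R mu Q (@measurable_square R) _ _ _ _ i1).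
  by apply/measurable_EFinP; exact: measurable_funTS.
move=> z _ /=; rewrite lee_fin [leRHS]ger0_norm ?addr_ge0 ?sqr_ge0 //.
have : 0 <= (`|v z| - 1) ^+ 2 by exact: sqr_ge0.
by rewrite -[v z ^+ 2]real_normK ?num_real //; have := normr_ge0 (v z); nra.
Qed.

Lemma integrable_cas v k : mu.-integrable Q (fun z => (v z)%:E) ->
  mu.-integrable Q (fun z => (v z * cas k z)%:E).
Proof.
move=> iv.
apply: (@integrableMl _ _ R mu Q (@measurable_square R) (fun z => (v z)%:E) (cas k) iv).
  by have [mk _] := @cas_tame R k; exact: measurable_funTS.
exists 2; split; first exact: num_real.
by move=> M' MM' z _; apply: le_trans (cas_le2 k z) (ltW MM').
Qed.

Lemma fourier_sq_hartley v k : mu.-integrable Q (fun z => (v z)%:E) ->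
  fourier_sq v k = 2^-1 * (hartley v k ^+ 2 + hartley v (- k) ^+ 2).
Proof.
move=> iv; have ik := integrable_cas k iv; have ik' := integrable_cas (- k) iv.
have mQ := @measurable_square R.
have -> : fourier_sq v k = (2^-1 * (hartley v k + hartley v (- k))) ^+ 2 +
    (2^-1 * (hartley v k - hartley v (- k))) ^+ 2.
  rewrite /fourier_sq /fourier_re /fourier_im sqrrN; congr (_ ^+ 2 + _ ^+ 2).
    rewrite /hartley -mulrDr mulrCA; congr (_ * _).
    rewrite /torus_int -(@RintegralD _ _ R mu Q _ _ mQ ik ik').
    rewrite -(@RintegralZl _ _ R mu Q _ _ mQ); last first.
      have := @integrableD _ _ R mu Q mQ _ _ ik ik'.
      by congr (mu.-integrable Q _); apply/funext => z; rewrite /= EFinD.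
    by congr Rintegral; apply/funext => z; rewrite cos_cas; ring.
  rewrite /hartley -mulrBr mulrCA; congr (_ * _).
  rewrite /torus_int -(@RintegralB _ _ R mu Q _ _ mQ ik ik').
  rewrite -(@RintegralZl _ _ R mu Q _ _ mQ); last first.
    have := @integrableB _ _ R mu Q mQ _ _ ik ik'.
    by congr (mu.-integrable Q _); apply/funext => z; rewrite /= EFinB.
  by congr Rintegral; apply/funext => z; rewrite sin_cas; ring.
by field.
Qed.

Lemma gevrey_sqnormE tau s v : mu.-integrable Q (fun z => (v z)%:E) ->
  gevrey_sqnorm 0 tau s v = (((2 * pi) ^+ 2)%:E * \esum_(k in [set: Z2])
    (2^-1 * ((gw s^-1 tau k * hartley v k) ^+ 2 +
             (gw s^-1 tau (- k) * hartley v (- k)) ^+ 2))%:E)%E.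
Proof.
move=> iv; rewrite /gevrey_sqnorm; congr (_ * _)%E; apply: eq_esum => k _.
rewrite (fourier_sq_hartley _ iv) mulr0 powRr0 mul1r.
have -> : gw s^-1 tau (- k) = gw s^-1 tau k by rewrite gw.unlock fnN.
have -> : expR (2 * tau * fn k `^ s^-1) = gw s^-1 tau k ^+ 2.
  by rewrite gw.unlock expr2 -expRD; congr expR; ring.
by congr (_%:E); ring.
Qed.

Lemma gevrey_sqnorm_lty tau s v (M : R) : mu.-integrable Q (fun z => (v z)%:E) ->
  (forall r : seq Z2, uniq r -> \sum_(k <- r) (gw s^-1 tau k * hartley v k) ^+ 2 <= M) ->
  (gevrey_sqnorm 0 tau s v < +oo)%E.
Proof.
move=> iv vM; rewrite gevrey_sqnormE //.
apply: (@le_lt_trans _ _ (((2 * pi) ^+ 2)%:E * M%:E)%E); last by rewrite -EFinM ltry.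
apply: lee_wpmul2l; first by rewrite lee_fin sqr_ge0.
apply: ge_ereal_sup => _ [A [finA _] <-].
rewrite fsbig_finite //= sumEFin lee_fin -mulr_sumr big_split /=.
have U := finmap.fset_uniq (fset_set A).
have H1 := vM _ U.
have H2 : \sum_(k <- finmap.enum_fset (fset_set A)) (gw s^-1 tau (- k) * hartley v (- k)) ^+ 2 <= M.
  rewrite -(big_map (fun k : Z2 => - k) xpredT (fun k => (gw s^-1 tau k * hartley v k) ^+ 2)).
  by apply: vM; rewrite map_inj_uniq //; exact: oppr_inj.
by move: H1 H2; move: (\sum_(_ <- _) _) (\sum_(_ <- _) _) => a b; lra.
Qed.

Lemma gevrey_norm_ge tau s v n : gevrey_dom 0 tau s v ->
  \sum_(k <- box n) (gw s^-1 tau k * hartley v k) ^+ 2 <= gevrey_norm 0 tau s v ^+ 2.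
Proof.
move=> [_ /square_integrable_integrable iv _ fin].
have E0 : (0 <= gevrey_sqnorm 0 tau s v)%E.
  rewrite gevrey_sqnormE //; apply: mule_ge0; first by rewrite lee_fin sqr_ge0.
  apply: esum_ge0 => k _.
  by rewrite lee_fin mulr_ge0 // addr_ge0 ?sqr_ge0.
rewrite sqr_sqrtr ?fine_ge0 // -lee_fin fineK; last by rewrite ge0_fin_numE.
rewrite gevrey_sqnormE //.
have p1 : 1 <= (2 * pi) ^+ 2 * 2^-1 :> R.
  by have := pi_ge2 R; nra.
apply: (@le_trans _ _ (((2 * pi) ^+ 2)%:E * (2^-1 * \sum_(k <- box n) (gw s^-1 tau k * hartley v k) ^+ 2)%:E)%E).
  rewrite -EFinM lee_fin mulrA ler_peMl //.
  by apply: sumr_ge0 => k _; exact: sqr_ge0.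
apply: lee_wpmul2l; first by rewrite lee_fin sqr_ge0.
apply: (@le_trans _ _ (\sum_(k <- box n) (2^-1 * ((gw s^-1 tau k * hartley v k) ^+ 2 +
             (gw s^-1 tau (- k) * hartley v (- k)) ^+ 2))%:E)%E).
  rewrite sumEFin lee_fin mulr_sumr; apply: ler_sum => k _.
  by rewrite ler_wpM2l // lerDl sqr_ge0.
apply: ereal_sup_ubound.
exists [set` box n]; first by split; [exact: finite_seq | ].
by rewrite -fsbig_seq ?box_uniq.
Qed.
End gevrey_hartley.

Section existence.
Variables (R : realType) (nu alpha sg tau0 M : R) (a : Z2 -> R)
  (h : nat -> R -> Z2 -> R).
Hypotheses (nu0 : 0 < nu) (alpha0 : 0 < alpha) (sg0 : 0 < sg) (tau00 : 0 < tau0)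
  (M0 : 0 <= M).
Hypothesis hP : galerkin_family nu alpha sg tau0 M a h.
Implicit Types (k : Z2) (z : R * R).
Notation fsq := (freq_sq R).
Notation fn := (freq_norm R).
Notation opp := (fun k : Z2 => - k).
Notation gal := (fun n t => galerkin nu alpha n (h n t)).

Definition solution (t : R) : R * R -> R := field h id t.

Let hT m : exists K, tfam m K h.
Proof. by have [K hK _] := family_tfam nu0 alpha0 sg0 tau00 M0 hP m; exists K. Qed.

Let galT m : exists K, tfam m K gal.
Proof. by have [K _ gK] := family_tfam nu0 alpha0 sg0 tau00 M0 hP m; exists K. Qed.

Let idE k : fn (id k) = fn k. Proof. by []. Qed.
Let oppE k : fn (opp k) = fn k. Proof. exact: fnN. Qed.

Lemma solution_dt (t : R) z : 0 < t ->
  is_derive t 1 (fun sigma => solution sigma z) (field gal id t z).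
Proof.
move=> t0; have [K cK] := hT 1; have [L cL] := galT 1; have [_ hG _ _] := hP.
have pos y : `|y - t| < t -> 0 <= y by rewrite ltr_norml => /andP[+ _]; lra.
apply: (@is_derive_lim R ultra_nat _ (fun n t => trig n (h n t) id z)
  (fun n t => trig n (gal n t) id z) _ _ t (2 * L) t t0).
- move=> n y /pos y0; apply: is_derive_sumr => k; have d := hG n y k y0.
  by apply: is_derive_eq; rewrite /GRing.scale /=; ring.
- by move=> n y /pos y0; apply: trig_time cL _ _ => //; exact: ltW.
- by move=> y /pos y0; exact: plim_cvg (tfam_equilip idE cK y0).
- exact: plim_cvg (tfam_equilip idE cL (ltW t0)).
Qed.

Lemma cvg_ultra_uniq (u : nat -> R) (x y : R) :
  u @ ultra_nat --> x -> u @ ultra_nat --> y -> x = y.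
Proof. by move=> /ulim_eq <- /ulim_eq. Qed.

Lemma near_positive (p : R * (R * R)) : 0 < p.1 -> \forall q \near p, 0 < q.1.
Proof.
move=> p0; apply: filterS (nbhsx_ballx p _ p0) => q [/= + _].
by rewrite /ball /= ltr_norml => /andP[_]; lra.
Qed.

Lemma field_cont_pos K c e t z : (forall k, fn (e k) = fn k) -> tfam 1 K c -> 0 < t ->
  {for (t, z), continuous (fun p : R * (R * R) => field c e p.1 p.2)}.
Proof.
move=> eE cK t0; apply/cvgrPdist_le => eps eps0.
have := @field_joint R K c e eE cK (t, z) (ltW t0) eps eps0.
by apply: filterS2 (near_positive (p := (t, z)) t0) => q /ltW q0; exact.
Qed.

Lemma for_continuous_near (f g : R * (R * R) -> R) p :
  {for p, continuous g} -> (\forall q \near p, f q = g q) -> {for p, continuous f}.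
Proof.
move=> cg fg; rewrite /prop_for /continuous_at (nbhs_singleton fg).
by apply: cvg_trans cg; apply: near_eq_cvg; apply: filterS fg => q ->.
Qed.

Lemma solution_regularity : classical_regularity solution.
Proof.
have [K cK] := hT 2; have [L cL] := galT 1.
have cK1 := tfam_mono (isT : (1 <= 2)%N) cK.
split.
- apply/subspace_continuousP => p p0; apply/cvgrPdist_le => eps eps0.
  by rewrite near_withinE; apply: filterS (field_joint idE cK1 p0 eps0) => q; exact.
- move=> t z t0; split.
  + by have [] := solution_dt z t0.
  + by have [] := field_d1 z idE cK (ltW t0).
  + by have [] := field_d2 z idE cK (ltW t0).
move=> t z t0; have N := near_positive (p := (t, z)) t0; split.
- apply: (for_continuous_near (@field_cont_pos _ _ _ _ z idE cL t0)).
  apply: filterS N => q q0; rewrite /dt derive1E.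
  by have [_ ->] := solution_dt q.2 q0.
- have c1 : tfam 1 K (fun n t k => h n t k * k.1%:~R).
    by apply: tfam_freq cK => k; exact: normr_freq1_le.
  apply: (for_continuous_near (@field_cont_pos _ _ _ _ z oppE c1 t0)).
  by apply: filterS N => q /ltW q0; have [_ <-] := field_d1 q.2 idE cK q0.
- have c2 : tfam 1 K (fun n t k => h n t k * k.2%:~R).
    by apply: tfam_freq cK => k; exact: normr_freq2_le.
  apply: (for_continuous_near (@field_cont_pos _ _ _ _ z oppE c2 t0)).
  by apply: filterS N => q /ltW q0; have [_ <-] := field_d2 q.2 idE cK q0.
Qed.

Lemma field_C1 (K : R) (c : nat -> R -> Z2 -> R) (e : Z2 -> Z2) (t : R) : (forall k, fn (e k) = fn k) -> tfam 2 K c -> 0 <= t ->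
  [/\ C1 (field c e t),
      d1 (field c e t) = field (fun n t k => c n t k * (e k).1%:~R) (fun k => - e k) t &
      d2 (field c e t) = field (fun n t k => c n t k * (e k).2%:~R) (fun k => - e k) t].
Proof.
move=> eE cK t0.
have D1 z := field_d1 z eE cK t0; have D2 z := field_d2 z eE cK t0.
have E1 : d1 (field c e t) = field (fun n t k => c n t k * (e k).1%:~R) (fun k => - e k) t.
  by apply/funext => z; rewrite /d1; have [_ ->] := D1 z.
have E2 : d2 (field c e t) = field (fun n t k => c n t k * (e k).2%:~R) (fun k => - e k) t.
  by apply/funext => z; rewrite /d2; have [_ ->] := D2 z.
have eE' k : fn (- e k) = fn k by rewrite fnN.
split => //; split.
- by move=> z; have [] := D1 z.
- by move=> z; have [] := D2 z.
- rewrite E1; apply: (field_continuous (K := K)) eE' _ t0.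
  by apply: tfam_freq cK => k; rewrite -(eE k) normr_freq1_le.
- rewrite E2; apply: (field_continuous (K := K)) eE' _ t0.
  by apply: tfam_freq cK => k; rewrite -(eE k) normr_freq2_le.
Qed.

Lemma solution_gradient : exists G, forall t z, 0 < t ->
  `|d1 (solution t) z| <= G /\ `|d2 (solution t) z| <= G.
Proof.
have [K cK] := hT 2; exists (2 * K) => t z /ltW t0.
have [_ -> ->] := field_C1 idE cK t0.
have c1 : tfam 1 K (fun n t k => h n t k * (id k).1%:~R).
  by apply: tfam_freq cK => k; exact: normr_freq1_le.
have c2 : tfam 1 K (fun n t k => h n t k * (id k).2%:~R).
  by apply: tfam_freq cK => k; exact: normr_freq2_le.
by split; [exact: plim_le (tfam_equilip oppE c1 t0) | exact: plim_le (tfam_equilip oppE c2 t0)].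
Qed.

Let helm_inv k : k != 0 -> `|(helm alpha k)^-1| <= 1.
Proof.
move=> _; have := helm_ge1 alpha k => g1; have g0 := helm_gt0 alpha k.
by rewrite normfV gtr0_norm // invf_le1.
Qed.

Let stream_inv k : k != 0 -> `|- (fsq k * helm alpha k)^-1| <= 1.
Proof.
move=> k0; have g1 := helm_ge1 alpha k; have f1 := freq_sq_ge1 R k0.
have g2 : 1 <= fsq k * helm alpha k.
  by rewrite -[1]mulr1; apply: ler_pM.
by rewrite normrN normfV gtr0_norm ?invf_le1 // (lt_le_trans _ g2).
Qed.

Let F n t k := h n t k * (helm alpha k)^-1.
Let S n t k := h n t k * - (fsq k * helm alpha k)^-1.

Let SE n t : stream alpha (h n t) = S n t.
Proof. by apply/funext => k; rewrite /stream /S mulrN mulNr. Qed.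

Lemma solution_equation (t : R) : 0 < t -> exists phi u1 u2 : R * R -> R,
  [/\ helmholtz_inverse alpha (solution t) phi, velocity phi u1 u2 &
   forall z, dt solution t z - nu * laplacian phi z
     + (u1 z * d1 (solution t) z + u2 z * d2 (solution t) z) = 0].
Proof.
move=> tp; have t0 := ltW tp.
have [K hK] := hT 4; have [L gL] := galT 1.
have FK : tfam 4 K F by apply: tfam_mul hK; exact: helm_inv.
have SK : tfam 4 K S by apply: tfam_mul hK; exact: stream_inv.
have q1 k : `|k.1%:~R : R| <= fn k := normr_freq1_le R k.
have q2 k : `|k.2%:~R : R| <= fn k := normr_freq2_le R k.
have q2N k : `|- k.2%:~R : R| <= fn k by rewrite normrN.
have q1' k : `|(- k).1%:~R : R| <= fn k by rewrite -(fnN R k) q1.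
have q2' k : `|(- k).2%:~R : R| <= fn k by rewrite -(fnN R k) q2.
pose F1 n t k := F n t k * k.1%:~R; pose F2 n t k := F n t k * k.2%:~R.
have F1K : tfam 3 K F1 by exact: tfam_freq FK.
have F2K : tfam 3 K F2 by exact: tfam_freq FK.
pose F11 n t k := F1 n t k * (- k).1%:~R; pose F22 n t k := F2 n t k * (- k).2%:~R.
have F11K : tfam 2 K F11 by exact: tfam_freq F1K.
have F22K : tfam 2 K F22 by exact: tfam_freq F2K.
pose U1 n t k := S n t k * - k.2%:~R; pose U2 n t k := S n t k * k.1%:~R.
have U1K : tfam 3 K U1 by exact: tfam_freq SK.
have U2K : tfam 3 K U2 by exact: tfam_freq SK.
pose phi := field F id t; pose u1 := field U1 opp t; pose u2 := field U2 opp t.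
have eqopp : (fun k : Z2 => - - k) = id by apply/funext => k; rewrite opprK.
have [Cphi d1phi d2phi] := field_C1 idE (tfam_mono (isT : (2 <= 4)%N) FK) t0.
have [CF1 d11phi d12phi] := field_C1 oppE (tfam_mono (isT : (2 <= 3)%N) F1K) t0.
have [CF2 d21phi d22phi] := field_C1 oppE (tfam_mono (isT : (2 <= 3)%N) F2K) t0.
have [Cu1 d1u1 d2u1] := field_C1 oppE (tfam_mono (isT : (2 <= 3)%N) U1K) t0.
have [Cu2 d1u2 d2u2] := field_C1 oppE (tfam_mono (isT : (2 <= 3)%N) U2K) t0.
have [Cw d1w d2w] := field_C1 idE (tfam_mono (isT : (2 <= 4)%N) hK) t0.
have E1 (m : nat) c : tfam m K c -> (1 <= m)%N -> forall e z, (forall k, fn (e k) = fn k) ->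
    trig n (c n t) e z @[n --> ultra_nat] --> field c e t z.
  by move=> cK m1 e z eE; exact: plim_cvg (tfam_equilip eE (tfam_mono m1 cK) t0).
have lapE z : laplacian phi z = field F11 id t z + field F22 id t z.
  by rewrite /laplacian /phi d1phi d2phi d11phi d22phi eqopp.
have lapL z : trig n (F n t \* (fun k => - fsq k)) id z @[n --> ultra_nat] --> laplacian phi z.
  rewrite lapE (_ : (fun n => _) = fun n => trig n (F11 n t) id z + trig n (F22 n t) id z).
    by apply: cvgD; [exact: (E1 _ _ F11K) | exact: (E1 _ _ F22K)].
  apply/funext => n; rewrite /trig -big_split /=; apply: eq_bigr => k _.
  by rewrite /F11 /F22 /F1 /F2 /= !rmorphN /= /freq_sq; ring.
exists phi, u1, u2; split.
- split; first exact: field_periodic.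
  + by apply: (field_mean_free idE _ (tfam_mono (isT : (1 <= 4)%N) FK) t0).
  + by split; [exact: Cphi | rewrite d1phi; exact: CF1 | rewrite d2phi; exact: CF2].
  move=> z; apply/esym; apply: ulim_eq.
  have P := E1 4 F FK isT id z idE.
  have P' : alpha ^+ 2 * trig n (F n t \* (fun k => - fsq k)) id z @[n --> ultra_nat] -->
      alpha ^+ 2 * laplacian phi z by apply: cvgMl_tmp; exact: lapL.
  have H := cvgB P P'.
  rewrite [X in X @ _ --> _](_ : _ = (fun n => trig n (F n t) id z -
    alpha ^+ 2 * trig n (F n t \* (fun k => - fsq k)) id z)); first exact: H.
  apply/funext => n; rewrite /trig mulr_sumr -sumrB; apply: eq_bigr => k _.
  rewrite /= /F; have := helm_gt0 alpha k; rewrite /helm.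
  by move: (cas k z) (fsq k) (h n t k) => x y c H0; field; rewrite gt_eqF.
- split.
  + by split; exact: field_periodic.
  + have o0 k : k != 0 -> opp k != 0 by rewrite oppr_eq0.
    by split; [apply: (field_mean_free oppE o0 (tfam_mono (isT : (1 <= 3)%N) U1K) t0)
              |apply: (field_mean_free oppE o0 (tfam_mono (isT : (1 <= 3)%N) U2K) t0)].
  + by split; [exact: Cu1 | exact: Cu2].
  + move=> z; rewrite /u1 /u2 d1u1 d2u2.
    have A : tfam 2 K (fun n t k => U1 n t k * (- k).1%:~R) by exact: tfam_freq U1K.
    have B : tfam 2 K (fun n t k => U2 n t k * (- k).2%:~R) by exact: tfam_freq U2K.
    have eqE k : fn (- - k) = fn k by rewrite opprK.
    apply: (cvg_ultra_uniq (u := fun n => trig n (fun k => U1 n t k * (- k).1%:~R) (fun k => - - k) z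
      + trig n (fun k => U2 n t k * (- k).2%:~R) (fun k => - - k) z)).
      by apply: cvgD; [exact: E1 _ _ A isT _ z eqE | exact: E1 _ _ B isT _ z eqE].
    rewrite [X in X @ _ --> _](_ : _ = fun=> 0); first exact: cvg_cst.
    apply/funext => n /=; rewrite /trig -big_split /= big1 // => k _.
    by rewrite /U1 /U2 !rmorphN /=; ring.
  move=> z; rewrite /u1 /u2 d1u2 d2u1.
  have A : tfam 2 K (fun n t k => U2 n t k * (- k).1%:~R) by exact: tfam_freq U2K.
  have B : tfam 2 K (fun n t k => U1 n t k * (- k).2%:~R) by exact: tfam_freq U1K.
  have eqE k : fn (- - k) = fn k by rewrite opprK.
  apply: (cvg_ultra_uniq (u := fun n => trig n (fun k => U2 n t k * (- k).1%:~R) (fun k => - - k) z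
      - trig n (fun k => U1 n t k * (- k).2%:~R) (fun k => - - k) z)).
    by apply: cvgB; [exact: E1 _ _ A isT _ z eqE | exact: E1 _ _ B isT _ z eqE].
  rewrite [X in X @ _ --> _](_ : _ = fun n => trig n (F n t) id z).
    exact: E1 _ _ FK isT id z idE.
  apply/funext => n /=; rewrite /trig -sumrB; apply: eq_big_seq => k kn.
  rewrite opprK /U1 /U2 /S /F !rmorphN /=.
  have f0 : 0 < k.1%:~R ^+ 2 + k.2%:~R ^+ 2 :> R.
    exact: lt_le_trans (freq_sq_ge1 R (box_neq0 kn)).
  have g0 := helm_gt0 alpha k; rewrite /freq_sq.
  by field; rewrite !gt_eqF.
move=> z.
have -> : dt solution t z = field gal id t z.
  by rewrite /dt derive1E; have [_ ->] := solution_dt z tp.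
pose Rn n := trig n (galerkin nu alpha n (h n t)) id z
    - nu * trig n (F n t \* (fun k => - fsq k)) id z
    + (trig n (U1 n t) opp z * trig n (fun k => h n t k * k.1%:~R) opp z
       + trig n (U2 n t) opp z * trig n (fun k => h n t k * k.2%:~R) opp z).
have h1 : tfam 3 K (fun n t k => h n t k * k.1%:~R) by exact: tfam_freq hK.
have h2 : tfam 3 K (fun n t k => h n t k * k.2%:~R) by exact: tfam_freq hK.
have H : Rn n @[n --> ultra_nat] --> field gal id t z - nu * laplacian phi z
     + (u1 z * d1 (solution t) z + u2 z * d2 (solution t) z).
  rewrite /solution d1w d2w; apply: cvgD.
    apply: cvgB; first exact: plim_cvg (tfam_equilip idE gL t0).
    by apply: cvgMl_tmp; exact: lapL.
  apply: cvgD; apply: cvgM; by [exact: E1 _ _ U1K isT opp z oppE|exact: E1 _ _ U2K isT opp z oppE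
    |exact: E1 _ _ h1 isT opp z oppE|exact: E1 _ _ h2 isT opp z oppE].
apply: (cvg_ultra_uniq H); apply: cvg_ultra_nat; pose C := 4 * K * K.
have B n : n%:R * `|Rn n| <= C.
  have := galerkin_residual nu alpha n (h n t) z; rewrite SE -/(Rn n) => G.
  apply: le_trans G _; rewrite /C -!mulrA ler_wpM2l //.
  have [c1 _] := tfam_mono (isT : (1 <= 4)%N) hK.
  have [c2 _] := tfam_mono (isT : (2 <= 4)%N) hK.
  by apply: ler_pM; rewrite ?l1norm_ge0 ?c1 ?c2.
apply/cvgr0Pnorm_le => e e0.
have C0 : 0 <= C by apply: le_trans (B 0%N); rewrite mul0r.
apply: filterS (nbhs_infty_gtr (C / e)) => n; rewrite ltr_pdivrMr // => Cn.
have n0 : 0 < n%:R :> R.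
  by rewrite ltr0n lt0n; apply/eqP => n0; move: Cn; rewrite n0 mul0r ltNge C0.
by rewrite -(ler_pM2l n0); apply: le_trans (B n) (ltW Cn).
Qed.
End existence.

Section existence_gevrey.
Variables (R : realType) (nu alpha s tau0 M : R) (a : Z2 -> R)
  (h : nat -> R -> Z2 -> R).
Hypotheses (nu0 : 0 < nu) (alpha0 : 0 < alpha) (s0 : 0 < s) (tau00 : 0 < tau0)
  (M0 : 0 <= M).
Hypothesis hP : galerkin_family nu alpha s^-1 tau0 M a h.
Implicit Types (k : Z2) (z : R * R).
Notation mu := (leb2 R).
Notation Q := (square R).
Notation fn := (freq_norm R).

Let hT m : exists K, tfam m K h.
Proof.
have si0 : 0 < s^-1 by rewrite invr_gt0.
by have [K hK _] := family_tfam nu0 alpha0 si0 tau00 M0 hP m; exists K.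
Qed.

Let idE k : fn (id k) = fn k. Proof. by []. Qed.

Lemma solution_continuous (t : R) : 0 <= t -> continuous (solution h t).
Proof. by move=> t0; have [K hK] := hT 1; exact: field_continuous idE hK t0. Qed.

Lemma solution_hartley (t : R) k : 0 <= t ->
  h n t k @[n --> ultra_nat] --> hartley (solution h t) k.
Proof.
move=> t0; have [K hK] := hT 1; have [_ _ hb _] := hP.
have tT n : tame (trig n (h n t) id) by exact: trig_tame.
have := @hartley_plim _ _ _ k (tfam_equilip idE hK t0) tT.
rewrite [X in X @ _ --> _ -> _](_ : _ = (fun n => h n t k)) //.
apply/funext => n; rewrite trig_hartley.
by case: ifPn => // kn; rewrite hb.
Qed.

Lemma sum_box_sub n (r : seq Z2) (f : Z2 -> R) : uniq r -> (forall k, 0 <= f k) ->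
  (forall k, k \notin box n -> f k = 0) -> \sum_(k <- r) f k <= \sum_(k <- box n) f k.
Proof.
move=> ur f0 fn0; rewrite (bigID (mem (box n))) /= [X in _ + X]big1 ?addr0; last first.
  by move=> k; exact: fn0.
rewrite -big_filter [leRHS](bigID (mem r)) /= -[X in _ <= X + _]big_filter.
rewrite (perm_big [seq k <- box n | k \in r]) /=.
  by rewrite lerDl; apply: sumr_ge0.
apply: uniq_perm => [||k]; [exact: filter_uniq | exact: filter_uniq (box_uniq n) | ].
by rewrite !mem_filter andbC.
Qed.

Lemma solution_gevrey (t : R) : 0 <= t ->
  gevrey_dom 0 (radius nu alpha tau0 M t) s (solution h t).
Proof.
move=> t0; have [K hK] := hT 1; have c := solution_continuous t0.
have tc := continuous_tame c.
split.
- exact: field_periodic.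
- split; first exact: continuous_measurable2.
  apply: (tame_integrable (v := fun z => solution h t z ^+ 2)).
  by rewrite (_ : (fun z => _) = fun z => solution h t z * solution h t z) //; exact: tameM.
- by apply: (field_mean_free idE _ hK t0).
have [_ _ hb hM] := hP.
apply: (@gevrey_sqnorm_lty _ _ _ _ (M ^+ 2)); first exact: tame_integrable.
move=> r ur; set g := gw _ _.
apply: (ulim_le (u := fun n => \sum_(k <- r) (g k * h n t k) ^+ 2) (v := fun=> M ^+ 2)).
- apply: cvg_sumr => k; apply: cvgM; apply: cvgMl_tmp; exact: solution_hartley.
- exact: cvg_cst.
move=> n; apply: le_trans (hM n t t0); apply: sum_box_sub => // k.
  exact: sqr_ge0.
by move=> kn; rewrite hb // mulr0 expr0n.
Qed.

Lemma solution_initial (w0 : R * R -> R) : Defs.periodic w0 ->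
  square_integrable w0 -> mean_free w0 -> (forall k, a k = hartley w0 k) ->
  solution h 0 = w0 %[ae mu].
Proof.
move=> pw iw mw aE; have iw1 := square_integrable_integrable iw.
have [mw0 _] := iw; have mQ := @measurable_square R.
have [K hK] := hT 1; have c := solution_continuous (lexx 0).
have [h0 _ _ _] := hP.
have tc := continuous_tame c.
have i0 := tame_integrable tc.
have H k : hartley (solution h 0) k = hartley w0 k.
  apply: (cvg_ultra_uniq (@solution_hartley 0 k (lexx 0))).
  have [->|k0] := eqVneq k 0.
    rewrite (_ : hartley w0 0 = 0); last first.
      rewrite /hartley (torus_int_eq (w := w0)) ?mw ?mulr0 // => z _.
      by rewrite cas0 mulr1.
    rewrite [X in X @ _ --> _](_ : _ = fun=> 0); first exact: cvg_cst.
    by apply/funext => n; rewrite h0; case: ifP => // /box_neq0; rewrite eqxx.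
  apply: cvg_ultra_nat; apply: cvg_near_cst.
  apply: filterS (nbhs_infty_ger (fn k)) => n kn.
  by rewrite h0 (@box_freq R).
have : \forall z \ae mu, solution h 0 z - w0 z = 0.
  apply: hartley_eq0_ae.
  - move=> x y; have [p1 p2] := @field_periodic R h id 0 x y; have [q1 q2] := pw x y.
    by rewrite /solution p1 p2 q1 q2.
  - by apply: measurable_funB => //; exact: continuous_measurable2.
  - rewrite (_ : (fun z => _) = (fun z => (solution h 0 z)%:E - (w0 z)%:E)%E) //.
    exact: (@integrableB _ _ R mu Q mQ).
  move=> k; have := H k; rewrite /hartley => /(congr1 (fun x => x * (2 * pi) ^+ 2)).
  have p0 : (2 * pi) ^+ 2 != 0 :> R by rewrite expf_neq0 // gt_eqF // two_pi_gt0.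
  rewrite ![_ ^- 2 * _]mulrC !mulfVK // => E.
  rewrite (_ : torus_int _ = torus_int (fun z => solution h 0 z * cas k z) - torus_int (fun z => w0 z * cas k z)).
    by rewrite E subrr mul0r.
  rewrite /torus_int -(@RintegralB _ _ R mu Q _ _ mQ (integrable_cas k i0) (integrable_cas k iw1)).
  by congr Rintegral; apply/funext => z; ring.
apply: filterS; first exact: (@ae_filter_ringOfSetsType _ _ R mu).
by move=> z /eqP; rewrite subr_eq0 => /eqP + _.
Qed.
End existence_gevrey.

Section static.
Variable R : realType.
Implicit Types (k : Z2) (z : R * R) (f g v : R * R -> R).
Notation fn := (freq_norm R).
Notation fsq := (freq_sq R).

Lemma C1_is_derive1 f z : C1 f -> is_derive z ((1, 0) : R * R) f (d1 f z).
Proof. by move=> [D _ _ _]; exact: derivableP. Qed.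

Lemma C1_is_derive2 f z : C1 f -> is_derive z ((0, 1) : R * R) f (d2 f z).
Proof. by move=> [_ D _ _]; exact: derivableP. Qed.

Let MVT_norm (f df : R -> R) (a r M x y : R) :
  (forall t : R, is_derive t 1 f (df t)) -> (forall t, `|t - a| < r -> `|df t| <= M) ->
  `|x - a| < r -> `|y - a| < r -> `|f x - f y| <= M * `|x - y|.
Proof.
move=> fdf dM; wlog xy : x y / x <= y.
  move=> H; have [/H//|/ltW yx xr yr] := leP x y.
  by rewrite distrC [`|x - y|]distrC; exact: H.
rewrite !ltr_norml => /andP[x1 x2] /andP[y1 y2].
have [c /andP[c1 c2] E] := @MVT_derive R f df x y xy (fun t _ => fdf t).
rewrite distrC E normrM distrC ler_wpM2r // dM // ltr_norml.
by apply/andP; split; lra.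
Qed.

Lemma C1_continuous f : C1 f -> continuous f.
Proof.
move=> Cf [x y]; have [_ _ c1 c2] := Cf.
have [r r0 [M M0 B]] : exists2 r : R, 0 < r & exists2 M : R, 0 < M &
    forall x' y', `|x' - x| < r -> `|y' - y| < r ->
      `|d1 f (x', y')| <= M /\ `|d2 f (x', y')| <= M.
  have /cvgrPdist_le/(_ 1 ltr01) N1 := c1 (x, y).
  have /cvgrPdist_le/(_ 1 ltr01) N2 := c2 (x, y).
  have [r /= r0 rB] := (@nbhs_ballP R (R^o * R^o)%type (x, y) _).1 (filterI N1 N2).
  exists r => //; exists (1 + `|d1 f (x, y)| + `|d2 f (x, y)|).
    by rewrite -addrA ltr_pwDl // addr_ge0.
  move=> x' y' xr yr; have [|/= b1 b2] := rB (x', y').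
    by split; rewrite /ball /= distrC.
  split.
    rewrite -[d1 f (x', y')](subrK (d1 f (x, y))); apply: le_trans (ler_normD _ _) _.
    rewrite distrC; apply: le_trans (lerD b1 (lexx _)) _.
    by rewrite lerDl.
  rewrite -[d2 f (x', y')](subrK (d2 f (x, y))); apply: le_trans (ler_normD _ _) _.
  rewrite distrC; apply: le_trans (lerD b2 (lexx _)) _.
  by rewrite [leRHS]addrAC lerDl.
apply/cvgrPdist_le => e e0.
pose s := Num.min r (e / (2 * M)).
have s0 : 0 < s by rewrite lt_min r0 divr_gt0 // mulr_gt0.
have sr : s <= r by rewrite ge_min lexx.
have sM : M * s <= e / 2.
  apply: (@le_trans _ _ (M * (e / (2 * M)))).
    by rewrite ler_wpM2l ?(ltW M0) // ge_min lexx orbT.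
  by rewrite le_eqVlt; apply/orP; left; apply/eqP; field; rewrite gt_eqF.
apply: filterS (nbhsx_ballx ((x, y) : R * R) s s0) => -[x' y'] [].
rewrite /ball /= => xs ys.
have xr : `|x' - x| < r by rewrite distrC; exact: lt_le_trans xs sr.
have yr : `|y' - y| < r by rewrite distrC; exact: lt_le_trans ys sr.
have H1 : `|f (x, y') - f (x', y')| <= M * `|x - x'|.
  apply: (@MVT_norm (fun t => f (t, y')) (fun t => d1 f (t, y')) x r) => //.
  - by move=> t; apply/is_derive_slice1; exact: C1_is_derive1.
  - by move=> t tr; have [] := B t y' tr yr.
  - by rewrite subrr normr0.
have H2 : `|f (x, y) - f (x, y')| <= M * `|y - y'|.
  apply: (@MVT_norm (fun t => f (x, t)) (fun t => d2 f (x, t)) y r) => //.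
  - by move=> t; apply/is_derive_slice2; exact: C1_is_derive2.
  - by move=> t tr; have [] := B x t _ tr => //; rewrite subrr normr0.
  - by rewrite subrr normr0.
rewrite -(subrK (f (x, y')) (f (x, y))) -addrA; apply: le_trans (ler_normD _ _) _.
have h1 : M * `|x - x'| <= M * s by rewrite ler_wpM2l // ltW.
have h2 : M * `|y - y'| <= M * s by rewrite ler_wpM2l // ltW.
by move: H1 H2 h1 h2 sM; lra.
Qed.

Lemma C1B f g : C1 f -> C1 g ->
  [/\ C1 (fun z => f z - g z), d1 (fun z => f z - g z) = (fun z => d1 f z - d1 g z) &
      d2 (fun z => f z - g z) = (fun z => d2 f z - d2 g z)].
Proof.
move=> [f1 f2 cf1 cf2] [g1 g2 cg1 cg2].
have E1 : d1 (fun z => f z - g z) = (fun z => d1 f z - d1 g z).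
  by apply/funext => z; rewrite /d1 -(deriveB (f1 z) (g1 z)).
have E2 : d2 (fun z => f z - g z) = (fun z => d2 f z - d2 g z).
  by apply/funext => z; rewrite /d2 -(deriveB (f2 z) (g2 z)).
split; [ | exact: E1 | exact: E2]; split.
- by move=> z; apply: derivableB; [exact: f1 | exact: g1].
- by move=> z; apply: derivableB; [exact: f2 | exact: g2].
- by rewrite E1 => z; apply: cvgB; [exact: cf1 | exact: cg1].
- by rewrite E2 => z; apply: cvgB; [exact: cf2 | exact: cg2].
Qed.

Lemma periodicB f g : Defs.periodic f -> Defs.periodic g ->
  Defs.periodic (fun z => f z - g z).
Proof.
by move=> pf pg x y; have [-> ->] := pf x y; have [-> ->] := pg x y.
Qed.

Lemma mean_freeB f g : tame f -> tame g -> mean_free f -> mean_free g ->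
  mean_free (fun z => f z - g z).
Proof. by move=> tf tg mf mg; rewrite /mean_free torus_intB // mf mg subrr. Qed.

Lemma C1_tame f : C1 f -> tame f.
Proof. by move=> /C1_continuous; exact: continuous_tame. Qed.

Lemma helmholtz_inverseB (alpha : R) w w' phi phi' :
  helmholtz_inverse alpha w phi -> helmholtz_inverse alpha w' phi' ->
  helmholtz_inverse alpha (fun z => w z - w' z) (fun z => phi z - phi' z) /\
  forall z, laplacian (fun z => phi z - phi' z) z = laplacian phi z - laplacian phi' z.
Proof.
move=> [pp mp [C C1p C2p] ep] [pp' mp' [C' C1p' C2p'] ep'].
have [D E1 E2] := C1B C C'; have [D1 E11 E12] := C1B C1p C1p'.
have [D2 E21 E22] := C1B C2p C2p'.
have C2D : C2 (fun z => phi z - phi' z).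
  by split; [exact: D | rewrite E1; exact: D1 | rewrite E2; exact: D2].
have L z : laplacian (fun z => phi z - phi' z) z = laplacian phi z - laplacian phi' z.
  by rewrite /laplacian E1 E2 E11 E22 addrACA -opprD.
split; [split | exact: L].
- exact: periodicB.
- by apply: mean_freeB mp mp'; exact: C1_tame.
- exact: C2D.
- move=> z; rewrite L -ep -ep'.
  by move: (laplacian phi z) (laplacian phi' z) => l l'; ring.
Qed.

Lemma velocityB phi phi' u1 u2 u1' u2' :
  velocity phi u1 u2 -> velocity phi' u1' u2' ->
  velocity (fun z => phi z - phi' z) (fun z => u1 z - u1' z) (fun z => u2 z - u2' z).
Proof.
move=> [[p1 p2] [m1 m2] [C C2] dv cu] [[p1' p2'] [m1' m2'] [C' C2'] dv' cu'].
have [D E1 E2] := C1B C C'; have [D2 E21 E22] := C1B C2 C2'.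
split; first by split; exact: periodicB.
- by split; [apply: mean_freeB m1 m1' | apply: mean_freeB m2 m2']; exact: C1_tame.
- by split; [exact: D | exact: D2].
- by move=> z; rewrite E1 E22 addrACA -opprD dv dv' subrr.
- by move=> z; rewrite E21 E2 -cu -cu'; ring.
Qed.

Lemma hartley_C1 f k : Defs.periodic f -> C1 f ->
  hartley (d1 f) k = - (k.1%:~R * hartley f (- k)) /\
  hartley (d2 f) k = - (k.2%:~R * hartley f (- k)).
Proof.
move=> pf Cf; have cf := C1_continuous Cf; have [_ _ c1 c2] := Cf; split.
  exact: (hartley_d1 k pf cf c1 (fun z => C1_is_derive1 z Cf)).
exact: (hartley_d2 k pf cf c2 (fun z => C1_is_derive2 z Cf)).
Qed.

Lemma derive_shift f (a b v : R * R) : (forall u, f (u + a) = f (u + b)) ->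
  'D_v f a = 'D_v f b.
Proof.
move=> H; rewrite /derive.
have E : (fun e : R => e^-1 *: ((f \o shift a) (e *: v) - f a)) =
    (fun e : R => e^-1 *: ((f \o shift b) (e *: v) - f b)).
  apply/funext => e /=; rewrite H; congr (_ *: (_ - _)).
  by have := H 0; rewrite !add0r.
by rewrite E.
Qed.

Lemma periodic_derive f : Defs.periodic f ->
  Defs.periodic (d1 f) /\ Defs.periodic (d2 f).
Proof.
move=> pf.
have P1 (x y : R) (u : R * R) : f (u + (x + 2 * pi, y)) = f (u + (x, y)).
  case: u => p q; have [<- _] := pf (p + x) (q + y).
  by congr f; congr (_, _); exact: addrA.
have P2 (x y : R) (u : R * R) : f (u + (x, y + 2 * pi)) = f (u + (x, y)).
  case: u => p q; have [_ <-] := pf (p + x) (q + y).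
  by congr f; congr (_, _); exact: addrA.
by split=> x y; split; apply: derive_shift => u; [exact: P1|exact: P2|exact: P1|exact: P2].
Qed.

Lemma trig_hartley_opp n c k :
  hartley (trig n c (fun k => - k)) k = if - k \in box n then c (- k) else 0 :> R.
Proof.
have E : trig n c (fun k => - k) =
    (fun z => \sum_(j <- [seq - j | j <- box n]) c (- j) * cas j z) :> (R * R -> R).
  apply/funext => z; rewrite big_map; apply: eq_bigr => j _.
  by rewrite opprK.
rewrite E hartley_sum; last by rewrite map_inj_uniq ?box_uniq //; exact: oppr_inj.
by rewrite -[in k \in _](opprK k) mem_map //; exact: oppr_inj.
Qed.

Lemma hartley_mean_free f : mean_free f -> hartley f 0 = 0.
Proof.
move=> mf; rewrite /hartley (torus_int_eq (w := f)) ?mf ?mulr0 // => z _.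
by rewrite cas0 mulr1.
Qed.

(** A periodic function with absolutely summable Hartley coefficients is the sum
    of its series, hence bounded by twice the sum of the coefficients. *)
Lemma sup_le_hartley f (K : R) : Defs.periodic f -> continuous f -> mean_free f ->
  (forall n, l1norm 1 n (fun k => hartley f (- k)) <= K) -> forall z, `|f z| <= 2 * K.
Proof.
move=> pf cf mf fK.
pose F n := trig n (fun k => hartley f (- k)) (fun k => - k).
have eF : equilip (2 * K) F by apply: trig_equilip => // k; exact: fnN.
have tF n : tame (F n) by exact: trig_tame.
have H k : hartley (plim F) k = hartley f k.
  apply: cvg_ultra_uniq (hartley_plim eF tF) _.
  apply: cvg_ultra_nat; apply: cvg_near_cst.
  have [->|k0] := eqVneq k 0.
    apply: nearW => n; rewrite trig_hartley_opp hartley_mean_free //.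
    by case: ifP => // /box_neq0; rewrite oppr0 eqxx.
  apply: filterS (nbhs_infty_ger (fn k)) => n kn.
  by rewrite trig_hartley_opp opprK (@box_freq R) ?fnN // oppr_eq0.
have c := plim_continuous eF.
have E z : f z - plim F z = 0.
  apply: (@hartley_eq0 _ (fun z => f z - plim F z)) => [||k].
  - by apply: periodicB => //; apply: plim_periodic => n; exact: trig_periodic.
  - by move=> x; apply: cvgB; [exact: cf | exact: c].
  by rewrite hartleyB ?H ?subrr //; exact: continuous_tame.
move=> z; have /eqP := E z; rewrite subr_eq0 => /eqP ->; exact: plim_le eF.
Qed.
End static.

Section energy.
Variables (R : realType) (alpha : R).
Hypothesis alpha0 : 0 < alpha.
Implicit Types (k : Z2) (z : R * R) (f g v : R * R -> R).
Notation fn := (freq_norm R).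
Notation fsq := (freq_sq R).

Lemma hartley_cst0 k : hartley (fun=> 0 : R) k = 0.
Proof.
rewrite /hartley (torus_int_eq (w := fun=> 0)); last by move=> z _; rewrite mul0r.
by rewrite torus_int_cst !mulr0.
Qed.

Local Opaque d1 d2 hartley.

Let neg1 k : (- k).1%:~R = - k.1%:~R :> R. Proof. by rewrite /= rmorphN. Qed.
Let neg2 k : (- k).2%:~R = - k.2%:~R :> R. Proof. by rewrite /= rmorphN. Qed.

Let helmholtz_algebra (w q a b c d k1 k2 x : R) : w = q - x * (a + b) ->
  a = - (k1 * c) -> b = - (k2 * d) -> c = - (- k1 * q) -> d = - (- k2 * q) ->
  w = (1 + x * (k1 ^+ 2 + k2 ^+ 2)) * q.
Proof. by move=> -> -> -> -> ->; ring. Qed.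

Let velocity_algebra (q a b c d x y k1 k2 : R) : a + d = 0 -> c - b = q ->
  a = - (k1 * x) -> b = - (k2 * x) -> c = - (k1 * y) -> d = - (k2 * y) ->
  (k1 ^+ 2 + k2 ^+ 2) * (x ^+ 2 + y ^+ 2) = q ^+ 2.
Proof.
move=> D <- ea -> -> ed; have D0 : k1 * x + k2 * y = 0.
  by apply/eqP; rewrite -oppr_eq0 opprD -ea -ed D.
transitivity ((k1 * x + k2 * y) ^+ 2 + (- (k1 * y) - - (k2 * x)) ^+ 2); first by ring.
by rewrite D0 expr0n add0r.
Qed.

Lemma helmholtz_hartley w q k : helmholtz_inverse alpha w q ->
  hartley w k = helm alpha k * hartley q k.
Proof.
move=> [pq mq [Cq Cq1 Cq2] eq].
have [pq1 pq2] := periodic_derive pq.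
have [_ _ c11 _] := Cq1; have [_ _ _ c22] := Cq2.
have [] := hartley_C1 (- k) pq Cq; rewrite opprK !neg1 !neg2 => E1 E2.
have [E11 _] := hartley_C1 k pq1 Cq1; have [_ E22] := hartley_C1 k pq2 Cq2.
have tL : tame (fun z => d1 (d1 q) z + d2 (d2 q) z).
  by apply: tameD; exact: continuous_tame.
have H : hartley w k = hartley q k - alpha ^+ 2 * (hartley (d1 (d1 q)) k + hartley (d2 (d2 q)) k).
  have -> : w = (fun z => q z - alpha ^+ 2 * (d1 (d1 q) z + d2 (d2 q) z)).
    by apply/funext => z; rewrite -eq.
  rewrite hartleyB; [|exact: C1_tame|exact: tameM (tame_cst _) tL].
  by rewrite hartleyZ // hartleyD; [|exact: continuous_tame|exact: continuous_tame].
exact: helmholtz_algebra H E11 E22 E1 E2.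
Qed.

Lemma velocity_hartley q v1 v2 k : velocity q v1 v2 ->
  fsq k * (hartley v1 (- k) ^+ 2 + hartley v2 (- k) ^+ 2) = hartley q k ^+ 2.
Proof.
move=> [[p1 p2] _ [Cv1 Cv2] dv cu].
have [A1 A2] := hartley_C1 k p1 Cv1; have [B1 B2] := hartley_C1 k p2 Cv2.
have [_ _ a1 a2] := Cv1; have [_ _ b1 b2] := Cv2.
have D : hartley (d1 v1) k + hartley (d2 v2) k = 0.
  rewrite -hartleyD; [|exact: continuous_tame|exact: continuous_tame].
  rewrite (_ : (fun z => _) = fun=> 0) ?hartley_cst0 //.
  by apply/funext => z; exact: dv.
have C : hartley (d1 v2) k - hartley (d2 v1) k = hartley q k.
  rewrite -hartleyB; [|exact: continuous_tame|exact: continuous_tame].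
  by rewrite (_ : (fun z => _) = q) //; apply/funext => z; exact: cu.
exact: velocity_algebra D C A1 A2 B1 B2.
Qed.

(** Two derivatives are gained from vorticity to velocity, which makes the Fourier
    series of the velocity absolutely summable. *)
Lemma velocity_sup w q v1 v2 : helmholtz_inverse alpha w q -> velocity q v1 v2 ->
  continuous w -> forall v, v = v1 \/ v = v2 -> forall z,
  v z ^+ 2 <= 400 / alpha ^+ 2 * (2 * pi) ^- 2 * torus_int (fun z => w z ^+ 2).
Proof.
move=> hq vq cw v v12 z.
have vp := vq; case: vp => [[p1 p2] [m1 m2] [Cv1 Cv2] _ _].
have tw := continuous_tame cw.
have Cv : C1 v by case: v12 => ->.
have pv : Defs.periodic v by case: v12 => ->.
have mv : mean_free v by case: v12 => ->.
pose I := torus_int (fun z => w z ^+ 2).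
pose B := 100 / alpha ^+ 2 * (2 * pi) ^- 2 * I.
have coef k : k != 0 -> fn k * `|hartley v (- k)| <= `|hartley w k| * (helm alpha k)^-1.
  move=> k0; have g0 := helm_gt0 alpha k.
  have -> : `|hartley w k| * (helm alpha k)^-1 = `|hartley q k|.
    rewrite (helmholtz_hartley k hq); move: (hartley q k) (helm alpha k) g0 => x y y0.
    by rewrite normrM (gtr0_norm y0) mulrAC mulfV ?mul1r ?gt_eqF.
  have := velocity_hartley k vq.
  have : hartley v (- k) = hartley v1 (- k) \/ hartley v (- k) = hartley v2 (- k).
    by case: v12 => ->; [left|right].
  move: (hartley v (- k)) (hartley v1 (- k)) (hartley v2 (- k)) (hartley q k).
  move=> x x1 x2 y xx E.
  rewrite -(@ler_pXn2r _ 2) ?nnegrE ?mulr_ge0 ?fn_ge0 // exprMn fn_sqr.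
  rewrite !real_normK ?num_real // -E.
  rewrite ler_wpM2l ?freq_sq_ge0 //; case: xx => ->; first by rewrite lerDl sqr_ge0.
  by rewrite lerDr sqr_ge0.
have sum n : l1norm 1 n (fun k => hartley v (- k)) <= Num.sqrt B.
  pose S := \sum_(k <- box n) `|hartley w k| * (helm alpha k)^-1.
  have S0 : 0 <= S.
    by apply: sumr_ge0 => k _; rewrite mulr_ge0 // invr_ge0 ltW // helm_gt0.
  have S2 : S ^+ 2 <= 25 / alpha ^+ 2 * ((2 * pi) ^- 2 * I).
    apply: le_trans (cauchy_schwarz _ _ _) _; rewrite mulrC; apply: ler_pM.
    - by apply: sumr_ge0 => k _; exact: sqr_ge0.
    - by apply: sumr_ge0 => k _; exact: sqr_ge0.
    - apply: le_trans (sum_helmholtz_le n alpha0); rewrite le_eqVlt; apply/orP; left.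
      by apply/eqP; apply: eq_bigr => k _; rewrite exprVn.
    apply: le_trans (bessel (box_uniq n) tw); rewrite le_eqVlt; apply/orP; left.
    by apply/eqP; apply: eq_bigr => k _; rewrite real_normK ?num_real.
  apply: (@le_trans _ _ (2 * S)).
    rewrite mulr_sumr; apply: ler_sum_seq => k /box_neq0 k0.
    apply: le_trans (ler_wpM2l _ (coef k k0)) => //.
    rewrite mulrA ler_wpM2r // expr1; have := fn_ge1 R k0.
    by move: (fn k) => x; lra.
  rewrite -[leLHS]ger0_norm ?mulr_ge0 // -sqrtr_sqr ler_wsqrtr //.
  rewrite exprMn /B; move: S2; move: ((2 * pi) ^- 2) (alpha ^+ 2)^-1 (S ^+ 2) => x y s.
  by move: (I) => e; lra.
have H := sup_le_hartley pv (C1_continuous Cv) mv sum z.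
have I0 : 0 <= I.
  have := torus_int_le (tame_cst 0) (tameM tw tw).
  by rewrite torus_int_cst mulr0; apply=> y _; rewrite -expr2 sqr_ge0.
have B0 : 0 <= B.
  by rewrite /B mulr_ge0 // mulr_ge0 ?invr_ge0 ?sqr_ge0 // mulr_ge0 ?invr_ge0 ?sqr_ge0.
have : `|v z| ^+ 2 <= (2 * Num.sqrt B) ^+ 2.
  by apply: lerXn2r => //; rewrite nnegrE mulr_ge0 // sqrtr_ge0.
rewrite real_normK ?num_real // exprMn sqr_sqrtr // => h; apply: le_trans h _.
rewrite /B -/I; move: ((2 * pi) ^- 2) (alpha ^+ 2)^-1 (I) => x y e.
by rewrite le_eqVlt; apply/orP; left; apply/eqP; ring.
Qed.

Let is_deriveM1 f g (df dg : R) z (v : R * R) : is_derive z v f df -> is_derive z v g dg ->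
  is_derive z v (fun z => f z * g z) (f z * dg + g z * df).
Proof. by move=> hf hg; exact: (is_deriveM hf hg). Qed.

Lemma energy_dissipation w q : helmholtz_inverse alpha w q -> continuous w ->
  torus_int (fun z => w z * laplacian q z) <= 0.
Proof.
move=> [pq mq [Cq Cq1 Cq2] eq] cw.
have [pq1 pq2] := periodic_derive pq.
have [_ _ c1 c2] := Cq; have [_ _ c11 _] := Cq1; have [_ _ _ c22] := Cq2.
have cq := C1_continuous Cq.
have t0 := continuous_tame cq; have t1 := continuous_tame c1; have t2 := continuous_tame c2.
have t11 := continuous_tame c11; have t22 := continuous_tame c22.
pose A z := q z * d1 (d1 q) z + d1 q z * d1 q z.
pose B z := q z * d2 (d2 q) z + d2 q z * d2 q z.
have cA : continuous A.
  by move=> z; apply: cvgD; apply: cvgM; [exact: cq|exact: c11|exact: c1|exact: c1].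
have cB : continuous B.
  by move=> z; apply: cvgD; apply: cvgM; [exact: cq|exact: c22|exact: c2|exact: c2].
have IA : torus_int A = 0.
  apply: (@torus_int_d1 R (fun z => q z * d1 q z) A _ cA) => [x y|z].
    by have [-> ->] := pq x y; have [-> ->] := pq1 x y.
  by apply: is_deriveM1; exact: C1_is_derive1.
have IB : torus_int B = 0.
  apply: (@torus_int_d2 R (fun z => q z * d2 q z) B _ cB) => [x y|z].
    by have [-> ->] := pq x y; have [-> ->] := pq2 x y.
  by apply: is_deriveM1; exact: C1_is_derive2.
have tA := continuous_tame cA; have tB := continuous_tame cB.
have tw := continuous_tame cw.
rewrite -[leRHS](_ : torus_int (fun z => A z + B z) = 0); last first.
  exact: etrans (torus_intD tA tB) (etrans (congr2 +%R IA IB) (addr0 0)).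
apply: torus_int_le => [||z _]; first exact: tameM tw (tameD t11 t22).
  exact: tameD tA tB.
rewrite -eq /laplacian /A /B; move: (d1 (d1 q) z) (d2 (d2 q) z) (d1 q z) (d2 q z) (q z).
move=> a b c d e; rewrite -subr_ge0.
rewrite (_ : _ - _ = c ^+ 2 + d ^+ 2 + (alpha * (a + b)) ^+ 2); last by ring.
by rewrite !addr_ge0 ?sqr_ge0.
Qed.

Let transport_algebra (a b c d e f g : R) : a + b = 0 ->
  e * (f * c + g * d) =
  2^-1 * (e * e * a + f * (e * c + e * c) + (e * e * b + g * (e * d + e * d))).
Proof. by move=> /eqP; rewrite addrC addr_eq0 => /eqP ->; field. Qed.

Lemma energy_transport w v1 v2 : Defs.periodic w -> C1 w ->
  Defs.periodic v1 -> Defs.periodic v2 -> C1 v1 -> C1 v2 ->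
  (forall z, d1 v1 z + d2 v2 z = 0) ->
  torus_int (fun z => w z * (v1 z * d1 w z + v2 z * d2 w z)) = 0.
Proof.
move=> pw Cw p1 p2 Cv1 Cv2 dv.
have [_ _ c1 c2] := Cw; have [_ _ a1 _] := Cv1; have [_ _ _ b2] := Cv2.
have cw := C1_continuous Cw; have ca := C1_continuous Cv1; have cb := C1_continuous Cv2.
pose A z := w z * w z * d1 v1 z + v1 z * (w z * d1 w z + w z * d1 w z).
pose B z := w z * w z * d2 v2 z + v2 z * (w z * d2 w z + w z * d2 w z).
have cA : continuous A.
  move=> z; apply: cvgD; apply: cvgM; [|exact: a1|exact: ca|].
    by apply: cvgM; exact: cw.
  by apply: cvgD; apply: cvgM; [exact: cw|exact: c1|exact: cw|exact: c1].
have cB : continuous B.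
  move=> z; apply: cvgD; apply: cvgM; [|exact: b2|exact: cb|].
    by apply: cvgM; exact: cw.
  by apply: cvgD; apply: cvgM; [exact: cw|exact: c2|exact: cw|exact: c2].
have IA : torus_int A = 0.
  apply: (@torus_int_d1 R (fun z => w z * w z * v1 z) A _ cA) => [x y|z].
    by have [-> ->] := pw x y; have [-> ->] := p1 x y.
  by apply: is_deriveM1; [apply: is_deriveM1; exact: C1_is_derive1 | exact: C1_is_derive1].
have IB : torus_int B = 0.
  apply: (@torus_int_d2 R (fun z => w z * w z * v2 z) B _ cB) => [x y|z].
    by have [-> ->] := pw x y; have [-> ->] := p2 x y.
  by apply: is_deriveM1; [apply: is_deriveM1; exact: C1_is_derive2 | exact: C1_is_derive2].
have tA := continuous_tame cA; have tB := continuous_tame cB.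
rewrite (torus_int_eq (w := fun z => 2^-1 * (A z + B z))).
  rewrite torus_intZ; last exact: tameD tA tB.
  have -> : torus_int (fun z => A z + B z) = 0.
    exact: etrans (torus_intD tA tB) (etrans (congr2 +%R IA IB) (addr0 0)).
  exact: mulr0.
by move=> z _; exact: transport_algebra (dv z).
Qed.
End energy.

Section evolution_in_time.
Variable R : realType.
Implicit Types (z : R * R) (f df : R -> R * R -> R).
Notation mu := (leb2 R).
Notation Q := (square R).

Lemma bounded_on_cylinder f (a b : R) : 0 < a ->
  (forall t z, 0 < t -> {for (t, z), continuous (fun p : R * (R * R) => f p.1 p.2)}) ->
  exists2 C, 0 <= C & forall t z, a <= t <= b -> Q z -> `|f t z| <= C.
Proof.
move=> a0 cf; pose K : set (R * (R * R)) := `[a, b] `*` Q.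
have cK : compact K.
  by apply: compact_setX; [exact: segment_compact | exact: compact_square].
have : compact ((fun p : R * (R * R) => f p.1 p.2) @` K).
  apply: continuous_compact cK; apply: continuous_in_subspaceT => -[t z].
  rewrite inE => -[/= ta _]; apply: cf; move: ta.
  by rewrite in_itv /= => /andP[/(lt_le_trans a0)].
move=> /compact_bounded [M [_ MM]].
exists (Num.max 0 (M + 1)); first by rewrite le_max lexx.
move=> t z tab Qz; rewrite le_max; apply/orP; right.
apply: (MM (M + 1)); first by rewrite ltrDl.
by exists (t, z) => //; split => //=; rewrite in_itv.
Qed.

Lemma slice_continuous (g : R * (R * R) -> R) (t : R) z :
  {for (t, z), continuous g} -> {for z, continuous (fun z => g (t, z))}.
Proof.
move=> cg; have P : (fun z => (t, z)) @ z --> (t, z).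
  by apply: cvg_pair2; [exact: cvg_cst | exact: cvg_id].
exact: (cvg_comp _ g P cg).
Qed.

Lemma torus_int_derive f df (t : R) : 0 < t ->
  (forall (t : R) z, 0 < t -> is_derive t 1 (f^~ z) (df t z)) ->
  (forall t z, 0 < t -> {for (t, z), continuous (fun p : R * (R * R) => df p.1 p.2)}) ->
  (forall t, 0 < t -> continuous (f t)) ->
  is_derive t 1 (fun t => torus_int (f t)) (torus_int (df t)).
Proof.
move=> t0 fdf cdf cf.
have t20 : 0 < t / 2 by rewrite divr_gt0.
have [C C0 dfC] := bounded_on_cylinder (2 * t) t20 cdf.
have It : `]t / 2, 2 * t[%classic t by rewrite /= in_itv /=; apply/andP; split; lra.
have pos (x : R) : `]t / 2, 2 * t[%classic x -> 0 < x.
  by rewrite /= in_itv /= => /andP[/(lt_trans t20)].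
have mQ := @measurable_square R.
have i x : `]t / 2, 2 * t[%classic x -> mu.-integrable Q (EFin \o f x).
  by move=> /pos x0; exact: tame_integrable (continuous_tame (cf x x0)).
have d x z : `]t / 2, 2 * t[%classic x -> Q z -> derivable (f^~ z) x 1.
  by move=> /pos x0 _; have [] := fdf x z x0.
have iC : mu.-integrable Q (EFin \o (fun=> C)) by exact: tame_integrable (tame_cst C).
have E x z : 0 < x -> partial1of2 f x z = df x z.
  by move=> x0; rewrite partial1of2E; have [_ ->] := fdf x z x0.
have B x z : `]t / 2, 2 * t[%classic x -> Q z -> `|partial1of2 f x z| <= C.
  move=> Ix Qz; rewrite E ?pos //; apply: dfC => //.
  by move: Ix; rewrite /= in_itv /= => /andP[/ltW -> /ltW ->].
have D := @derivable_under_integral R _ _ mu f Q mQ t _ _ It i d (fun=> C) (fun=> C0) iC B.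
have V := @differentiation_under_integral R _ _ mu f Q mQ t _ _ It i d (fun=> C) (fun=> C0) iC B.
have -> : torus_int (df t) = 'D_1 (fun t => torus_int (f t)) t.
  rewrite -derive1E; apply: etrans (esym V); apply: torus_int_eq => z _.
  by rewrite E.
exact: derivableP.
Qed.

Lemma vanishing_uniform f (e : R) : 0 < e -> (forall z, f 0 z = 0) ->
  {within [set p : R * (R * R) | 0 <= p.1],
     continuous (fun p : R * (R * R) => f p.1 p.2)} ->
  exists2 r : R, 0 < r & forall t z, 0 <= t < r -> Q z -> `|f t z| <= e.
Proof.
move=> e0 f0 /subspace_continuousP cf.
have /compact_near_coveringP nc := @compact_square R.
have := nc R (within [set t : R | 0 <= t] (nbhs (0 : R))) (fun (t : R) z => `|f t z| <= e) _.
case.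
  move=> z _; have /cvgrPdist_le/(_ e e0) := cf (0, z) (lexx 0).
  rewrite near_withinE => -[[U V] /= [U0 Vz] UV].
  exists (V, [set t | U t /\ 0 <= t]) => /=.
    split => //; rewrite /within /=.
    by apply: filterS U0 => t.
  move=> [z' t] /= [Vz' [Ut t0]].
  have := UV (t, z') (conj Ut Vz') t0.
  by rewrite /from_subspace /= f0 sub0r normrN.
move=> r /= r0 rB; exists r => // t z /andP[t0 tr] Qz.
apply: (rB t) => //=.
by rewrite /ball /= sub0r normrN ger0_norm.
Qed.
End evolution_in_time.

Section uniqueness.
Variables (R : realType) (nu alpha s : R) (w0 : R * R -> R) (w w' : R -> R * R -> R).
Hypotheses (nu0 : 0 < nu) (alpha0 : 0 < alpha).
Hypotheses (sw : gevrey_solution nu alpha s w0 w) (sw' : gevrey_solution nu alpha s w0 w').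
Variable G : R.
Hypothesis wG : forall t z, 0 < t -> `|d1 (w t) z| <= G /\ `|d2 (w t) z| <= G.
Implicit Types (z : R * R).
Notation mu := (leb2 R).
Notation Q := (square R).

Let delta t z := w' t z - w t z.
Let ddelta t z := dt w' t z - dt w t z.
Let energy t := torus_int (fun z => delta t z ^+ 2).

Lemma regular_C1 (v : R -> R * R -> R) (t : R) : classical_regularity v -> 0 < t -> C1 (v t).
Proof.
move=> [_ dv cv] t0; split=> z.
- by have [] := dv t z t0.
- by have [] := dv t z t0.
- by have [_ H _] := cv t z t0; exact: (slice_continuous H).
- by have [_ _ H] := cv t z t0; exact: (slice_continuous H).
Qed.

Lemma regular_continuous (v : R -> R * R -> R) (t : R) :
  classical_regularity v -> 0 <= t -> continuous (v t).
Proof.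
move=> [/subspace_continuousP cv _ _] t0 z.
have := cv (t, z) t0; rewrite /from_subspace /= => H.
have P0 : (fun z => (t, z)) @ z --> (t, z).
  by apply: cvg_pair2; [exact: cvg_cst | exact: cvg_id].
have P : (fun z => (t, z)) @ z --> within [set p : R * (R * R) | 0 <= p.1] (nbhs (t, z)).
  move=> A WA; have W : \forall z' \near z, 0 <= t -> A (t, z') := P0 _ WA.
  by apply: filterS W => z'; exact.
exact: (cvg_comp _ (fun p : R * (R * R) => v p.1 p.2) P H).
Qed.

Lemma regular_joint (v : R -> R * R -> R) (t : R) z : classical_regularity v -> 0 < t ->
  {for (t, z), continuous (fun p : R * (R * R) => v p.1 p.2)}.
Proof.
move=> [/subspace_continuousP cv _ _] t0.
have := cv (t, z) (ltW t0); rewrite /from_subspace /= => H.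
have P : id @ (t, z) --> within [set p : R * (R * R) | 0 <= p.1] (nbhs (t, z)).
  move=> A WA; have W : \forall q \near (t, z), 0 <= q.1 -> A q := WA.
  by apply: filterS2 (near_positive (p := (t, z)) t0) W => q /ltW q0; exact.
exact: (cvg_comp id (fun p : R * (R * R) => v p.1 p.2) P H).
Qed.

Lemma regular_dt (v : R -> R * R -> R) (t : R) z : classical_regularity v -> 0 < t ->
  is_derive t 1 (fun sigma => v sigma z) (dt v t z).
Proof.
move=> [_ dv _] t0; have [D _ _] := dv t z t0.
by rewrite /dt derive1E; exact: derivableP.
Qed.

Let rw : classical_regularity w. Proof. by have [] := sw. Qed.
Let rw' : classical_regularity w'. Proof. by have [] := sw'. Qed.

Lemma gevrey_class_periodic (v : R * R -> R) : gevrey_class s v -> Defs.periodic v.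
Proof. by move=> [r [tau [_ _ []]]]. Qed.

Let pdelta (t : R) : 0 <= t -> Defs.periodic (delta t).
Proof.
move=> t0; have [g _ _ _] := sw; have [g' _ _ _] := sw'.
by apply: periodicB; apply: gevrey_class_periodic; [exact: g' | exact: g].
Qed.

Let cdelta (t : R) : 0 <= t -> continuous (delta t).
Proof.
move=> t0 z; apply: cvgB.
  exact: (regular_continuous rw' t0).
exact: (regular_continuous rw t0).
Qed.

Let delta0 z : delta 0 z = 0.
Proof.
apply: (@continuous_ae_zero R (delta 0)); first exact: cdelta (lexx 0).
have [_ _ e _] := sw; have [_ _ e' _] := sw'.
have FF := @ae_filter_ringOfSetsType _ _ R mu.
apply: (@filterS2 _ _ FF _ _ _ _ e' e) => x h' h.
by rewrite /delta h' // h // subrr.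
Qed.

Let ddeltaP (t : R) z : 0 < t -> is_derive t 1 (delta^~ z) (ddelta t z).
Proof.
by move=> t0; apply: is_deriveB; [exact: regular_dt rw' t0 | exact: regular_dt rw t0].
Qed.

Let jddelta (t : R) z : 0 < t ->
  {for (t, z), continuous (fun p : R * (R * R) => ddelta p.1 p.2)}.
Proof.
move=> t0; have [_ _ H] := rw; have [_ _ H'] := rw'.
have [h _ _] := H t z t0; have [h' _ _] := H' t z t0.
have X := continuousB h' h; exact: X.
Qed.

Let energyP (t : R) : 0 < t ->
  is_derive t 1 energy (torus_int (fun z => 2 * (delta t z * ddelta t z))).
Proof.
move=> t0.
apply: (@torus_int_derive R (fun t z => delta t z ^+ 2)
  (fun t z => 2 * (delta t z * ddelta t z)) t t0) => {t0 t} t.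
- move=> z t0; have D := ddeltaP z t0.
  by apply: is_derive_eq; rewrite /GRing.scale /=; ring.
- move=> z t0.
  have jd : {for (t, z), continuous (fun p : R * (R * R) => delta p.1 p.2)}.
    have a' := @regular_joint w' t z rw' t0; have a := @regular_joint w t z rw t0.
    have X := continuousB a' a.
    exact: X.
  have jdd := @jddelta t z t0.
  have c2 : {for (t, z), continuous (fun _ : R * (R * R) => 2 : R)} by exact: cst_continuous.
  have X := continuousM c2 (continuousM jd jdd).
  exact: X.
move=> t0 z; apply: cvgM; exact: cdelta (ltW t0) z.
Qed.

Let C := 1 + (2 * pi) ^+ 2 * (4 * G ^+ 2 * (400 / alpha ^+ 2 * (2 * pi) ^- 2)).

Let energy_ge0 (t : R) : 0 <= t -> 0 <= energy t.
Proof.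
move=> t0; have T := continuous_tame (cdelta t0).
have := torus_int_le (tame_cst 0) (tameM T T).
by rewrite torus_int_cst mulr0; apply=> y _; rewrite -expr2 sqr_ge0.
Qed.

Let pointwise (x a a' L L' u1 u2 u1' u2' p q p' q' m : R) :
  a - nu * L + (u1 * p + u2 * q) = 0 -> a' - nu * L' + (u1' * p' + u2' * q') = 0 ->
  `|p| <= G -> `|q| <= G -> (u1' - u1) ^+ 2 <= m -> (u2' - u2) ^+ 2 <= m ->
  2 * (x * (a' - a)) <= 2 * nu * (x * (L' - L))
    - 2 * (x * (u1' * (p' - p) + u2' * (q' - q))) + x * x + 4 * G ^+ 2 * m.
Proof.
move=> E E' pG qG m1 m2.
have p2 : p ^+ 2 <= G ^+ 2.
  by rewrite -real_normK ?num_real // lerXn2r ?nnegrE // (le_trans _ pG).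
have q2 : q ^+ 2 <= G ^+ 2.
  by rewrite -real_normK ?num_real // lerXn2r ?nnegrE // (le_trans _ qG).
have A : ((u1' - u1) * p) ^+ 2 <= m * G ^+ 2.
  by rewrite exprMn ler_pM ?sqr_ge0.
have B : ((u2' - u2) * q) ^+ 2 <= m * G ^+ 2.
  by rewrite exprMn ler_pM ?sqr_ge0.
have ea : a = nu * L - (u1 * p + u2 * q).
  by apply/eqP; rewrite -subr_eq0 -E; apply/eqP; ring.
have ea' : a' = nu * L' - (u1' * p' + u2' * q').
  by apply/eqP; rewrite -subr_eq0 -E'; apply/eqP; ring.
rewrite -subr_ge0.
rewrite (_ : _ - _ = (x + (u1' - u1) * p + (u2' - u2) * q) ^+ 2
   + (((u1' - u1) * p - (u2' - u2) * q) ^+ 2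
   + 2 * ((m * G ^+ 2 - ((u1' - u1) * p) ^+ 2) + (m * G ^+ 2 - ((u2' - u2) * q) ^+ 2)))).
  apply: addr_ge0 (sqr_ge0 _) (addr_ge0 (sqr_ge0 _) _).
  by apply: mulr_ge0 => //; apply: addr_ge0; rewrite subr_ge0.
by rewrite ea ea'; ring.
Qed.

Let energy_le (t : R) : 0 < t ->
  torus_int (fun z => 2 * (delta t z * ddelta t z)) <= C * energy t.
Proof.
move=> t0; have [_ _ _ /(_ t t0)] := sw; have [_ _ _ /(_ t t0)] := sw'.
move=> [phi' [u1' [u2' [hi' vel' eq']]]] [phi [u1 [u2 [hi vel eq]]]].
have [hd lapB] := helmholtz_inverseB hi' hi; have vd := velocityB vel' vel.
have cd := cdelta (ltW t0).
have sup := velocity_sup alpha0 hd vd cd.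
set m := 400 / alpha ^+ 2 * (2 * pi) ^- 2 * torus_int (fun z => (w' t z - w t z) ^+ 2) in sup.
have Cw := regular_C1 rw t0; have Cw' := regular_C1 rw' t0.
have [Cd E1 E2] := C1B Cw' Cw.
have [[p1 p2] _ [Cu1 Cu2] dv _] := vel'.
have IA := energy_dissipation hd cd.
have IT := energy_transport (pdelta (ltW t0)) Cd p1 p2 Cu1 Cu2 dv.
have [_ _ [_ [_ _ c11 _] [_ _ _ c22]] _] := hd.
have td := continuous_tame cd.
pose A z := delta t z * (laplacian phi' z - laplacian phi z).
pose T z := delta t z * (u1' z * (d1 (w' t) z - d1 (w t) z) + u2' z * (d2 (w' t) z - d2 (w t) z)).
have tA : tame A.
  have -> : A = (fun z => delta t z * laplacian (fun z => phi' z - phi z) z).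
    by apply/funext => z; rewrite lapB.
  exact: tameM td (tameD (continuous_tame c11) (continuous_tame c22)).
have tT : tame T.
  have [_ _ a1 a2] := Cw'; have [_ _ b1 b2] := Cw.
  apply: tameM td (tameD (tameM (C1_tame Cu1) _) (tameM (C1_tame Cu2) _)).
    exact: tameB (continuous_tame a1) (continuous_tame b1).
  exact: tameB (continuous_tame a2) (continuous_tame b2).
have {}IA : torus_int A <= 0.
  apply: le_trans IA; rewrite le_eqVlt; apply/orP; left; apply/eqP.
  by apply: torus_int_eq => z _; rewrite lapB.
have {}IT : torus_int T = 0.
  rewrite -[RHS]IT; apply: torus_int_eq => z _.
  by congr (_ * (_ * _ + _ * _)); [rewrite E1 | rewrite E2].
have tdd : tame (ddelta t).
  by apply: continuous_tame => z; exact: (slice_continuous (@jddelta t z t0)).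
have tL : tame (fun z => 2 * (delta t z * ddelta t z)) := tameM (tame_cst 2) (tameM td tdd).
pose K := 4 * G ^+ 2 * m.
pose B z := 2 * nu * A z - 2 * T z + delta t z * delta t z + K.
have t1 : tame (fun z => 2 * nu * A z) := tameM (tame_cst _) tA.
have t2 : tame (fun z => 2 * T z) := tameM (tame_cst _) tT.
have t3 := tameM td td.
have tB : tame B := tameD (tameD (tameB t1 t2) t3) (tame_cst K).
have IB : torus_int B = 2 * nu * torus_int A - 2 * torus_int T + energy t + (2 * pi) ^+ 2 * K.
  have i1 := torus_intD (tameD (tameB t1 t2) t3) (tame_cst K).
  have i2 := torus_intD (tameB t1 t2) t3; have i3 := torus_intB t1 t2.
  have i4 := torus_intZ (2 * nu) tA; have i5 := torus_intZ 2 tT.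
  have i6 := torus_int_cst K.
  have add3 (a b c d e f g h i j : R) : a = b + c -> b = d + e -> d = f - g ->
    f = h -> g = i -> c = j -> a = h - i + e + j by move=> -> -> -> -> -> ->.
  exact: add3 i1 i2 i3 i4 i5 i6.
have LB : torus_int (fun z => 2 * (delta t z * ddelta t z)) <= torus_int B.
  apply: torus_int_le tL tB _ => z _; have [g1 g2] := wG z t0.
  exact: (pointwise _ (eq z) (eq' z) g1 g2 (sup _ (or_introl erefl) z) (sup _ (or_intror erefl) z)).
apply: le_trans LB _; rewrite IB IT mulr0 subr0 -addrA.
have nA : 2 * nu * torus_int A <= 0 by rewrite pmulr_rle0 // mulr_gt0.
apply: le_trans (lerD nA (lexx _)) _; rewrite add0r.
rewrite /K /m -/(energy t) /C; move: (energy t) (alpha ^+ 2)^-1.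
move: ((2 * pi : R) ^+ 2) ((2 * pi : R) ^- 2) => u x e y.
by rewrite le_eqVlt; apply/orP; left; apply/eqP; ring.
Qed.

Let C0 : 0 <= C.
Proof.
have V (x : R) : 0 <= (x ^+ 2)^-1 by rewrite invr_ge0 sqr_ge0.
apply: addr_ge0; first exact: ler01.
apply: mulr_ge0; first exact: sqr_ge0.
apply: mulr_ge0; first exact: mulr_ge0 (ler0n _ 4) (sqr_ge0 _).
by apply: mulr_ge0; [exact: mulr_ge0 (ler0n _ 400) (V _) | exact: V].
Qed.

(** Gronwall: [expR (- C t) * energy t] does not increase. *)
Let energy_gronwall (r t : R) : 0 < r -> r <= t -> energy t <= expR (C * (t - r)) * energy r.
Proof.
move=> r0 rt; pose g x := expR (- (C * x)) * energy x.
have D (x : R) : 0 < x -> is_derive x 1 g (expR (- (C * x)) *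
    (torus_int (fun z => 2 * (delta x z * ddelta x z)) - C * energy x)).
  move=> x0; have d1 : is_derive x 1 (fun x => - (C * x)) (- C).
    by apply: is_derive_eq; rewrite /GRing.scale /=; ring.
  have d2 := is_derive_expR_comp d1; have d3 := energyP x0.
  have d4 := is_deriveM d2 d3; apply: is_derive_eq.
  by rewrite /GRing.scale /=; move: (torus_int _) (energy x) (expR _) => a b e; ring.
have D' x (rx : r <= x <= t) := D x (lt_le_trans r0 (elimT andP rx).1).
have [c /andP[c1 _] E] := MVT_derive rt D'.
have H : g t <= g r.
  rewrite -subr_le0 E; apply: mulr_le0_ge0; last by rewrite subr_ge0.
  apply: mulr_ge0_le0; first exact: expR_ge0.
  by rewrite subr_le0; apply: energy_le; exact: lt_le_trans c1.
move: H; rewrite /g => H.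
have -> : energy t = expR (C * t) * (expR (- (C * t)) * energy t).
  by rewrite mulrA -expRD subrr expR0 mul1r.
apply: le_trans (ler_wpM2l (expR_ge0 _) H) _.
by rewrite mulrA -expRD mulrBr.
Qed.

Theorem gevrey_solution_unique (t : R) z : 0 <= t -> w' t z = w t z.
Proof.
rewrite le_eqVlt => /predU1P[<-|t0].
  by apply/eqP; rewrite -subr_eq0; apply/eqP; exact: delta0.
have E0 : energy t = 0.
  apply/eqP; rewrite eq_le; apply/andP; split; last exact: energy_ge0 (ltW t0).
  apply/ler_addgt0Pr => e e0; rewrite add0r.
  pose L := expR (C * t) * (2 * pi) ^+ 2.
  have L0 : 0 < L by rewrite mulr_gt0 ?expR_gt0 // exprn_gt0 // two_pi_gt0.
  pose e1 := Num.min 1 (e / L).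
  have e10 : 0 < e1 by rewrite lt_min ltr01 divr_gt0.
  have W : {within [set p : R * (R * R) | 0 <= p.1],
      continuous (fun p : R * (R * R) => delta p.1 p.2)}.
    have [c _ _] := rw; have [c' _ _] := rw' => p.
    have X := continuousB (c' p) (c p); exact: X.
  have [r r0 rP] := vanishing_uniform e10 delta0 W.
  pose x := Num.min (r / 2) t.
  have x0 : 0 < x by rewrite lt_min t0 divr_gt0.
  have xt : x <= t by rewrite ge_min lexx orbT.
  have xr : x < r by rewrite gt_min; apply/orP; left; rewrite ltr_pdivrMr //; lra.
  have Ex : energy x <= (2 * pi) ^+ 2 * (e / L).
    have T := continuous_tame (cdelta (ltW x0)).
    apply: le_trans (ler_norm _) _; apply: torus_int_norm_le (tameM T T) _ => y Qy.
    have := rP x y; rewrite (ltW x0) xr => /(_ isT Qy) h.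
    rewrite normrM; apply: (@le_trans _ _ (1 * (e / L))); last by rewrite mul1r.
    by apply: ler_pM => //; apply: le_trans h _; rewrite ge_min lexx ?orbT.
  apply: le_trans (energy_gronwall x0 xt) _.
  apply: (@le_trans _ _ (expR (C * t) * ((2 * pi) ^+ 2 * (e / L)))).
    apply: ler_pM; rewrite ?expR_ge0 ?energy_ge0 ?(ltW x0) //.
    by rewrite ler_expR ler_wpM2l // gerBl ltW.
  by rewrite mulrA -/L mulrCA mulfV ?mulr1 // gt_eqF.
have c := cdelta (ltW t0); have T := continuous_tame c.
have H k : hartley (delta t) k = 0.
  have := bessel (r := [:: k]) isT T; rewrite big_seq1 -/(energy t) E0 mulr0.
  by move=> h; apply/eqP; rewrite -sqrf_eq0 eq_le h sqr_ge0.
by have := hartley_eq0 (pdelta (ltW t0)) c H z => /eqP; rewrite subr_eq0 => /eqP.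
Qed.
End uniqueness.

Lemma integral_decay (R : realType) (l t : R) : 0 < l -> 0 <= t ->
  \int[@lebesgue_measure R]_(sigma in `[0, t]) expR (- (l * sigma)) =
  (1 - expR (- (l * t))) / l.
Proof.
move=> l0; rewrite le_eqVlt => /predU1P[<-|t0].
  by rewrite set_itv1 Rintegral_set1 mulr0 oppr0 expR0 subrr mul0r.
pose F (x : R) := - expR (- (l * x)) / l.
have dF (x : R) : is_derive x 1 F (expR (- (l * x))).
  have d0 : is_derive x 1 (fun x => - (l * x)) (- l).
    by apply: is_derive_eq; rewrite /GRing.scale /=; ring.
  have d := is_derive_expR_comp d0; rewrite /F; apply: is_derive_eq.
  rewrite /GRing.scale /=; move: (expR _) => y; field.
  by rewrite gt_eqF.
have cF (x : R) : F @ x --> F x by exact: is_derive_cvg (dF x).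
rewrite /Rintegral (@continuous_FTC2 R (fun x => expR (- (l * x))) F 0 t) //.
- by rewrite -EFinB /= /F mulr0 oppr0 expR0; field; rewrite gt_eqF.
- apply: continuous_subspaceT => x.
  have d0 : is_derive x 1 (fun x => - (l * x)) (- l).
    by apply: is_derive_eq; rewrite /GRing.scale /=; ring.
  exact: is_derive_cvg (is_derive_expR_comp d0).
- split.
  + by move=> x _; have [] := dF x.
  + by apply: cvg_at_right_filter; exact: cF.
  + by apply: cvg_at_left_filter; exact: cF.
- by move=> x _; rewrite derive1E; case: (dF x).
Qed.

Theorem theorem3p1 (R : realType) :
  exists C : R, 0 < C /\
  forall (nu alpha s tau0 : R) (w0 : R * R -> R),
    0 < nu -> 0 < alpha -> 1 <= s -> 0 < tau0 ->
    gevrey_dom 0 tau0 s w0 ->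
    let M0 := gevrey_norm 0 tau0 s w0 in
    exists w : R -> R * R -> R,
      [/\ gevrey_solution nu alpha s w0 w,
          forall w' : R -> R * R -> R, gevrey_solution nu alpha s w0 w' ->
            forall (t : R) (z : R * R), 0 <= t -> w' t z = w t z
        & exists tau : R -> R, forall t : R, 0 <= t ->
            let lower_bound :=
              tau0 * expR (- (C * M0 / alpha *
                \int[@lebesgue_measure R]_(sigma in `[0, t])
                  expR (- (nu * sigma / (2 + 2 * alpha ^+ 2))))) in
            [/\ gevrey_dom 0 (tau t) s (w t),
                tau t >= lower_bound
              & lower_bound >=
                tau0 * expR (- (C * (2 + 2 * alpha ^+ 2) * M0 / (alpha * nu)))]].
Proof.
exists 20; split=> // nu alpha s tau0 w0 nu0 alpha0 s1 tau00 dom M.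
have s0 : 0 < s by exact: lt_le_trans s1.
have si0 : 0 < s^-1 by rewrite invr_gt0.
have si1 : s^-1 <= 1 by rewrite invf_le1.
have M0 : 0 <= M by exact: sqrtr_ge0.
have [pw0 iw0 mw0 _] := dom.
have aM n : \sum_(k <- box n) (gw s^-1 tau0 k * hartley w0 k) ^+ 2 <= M ^+ 2.
  exact: gevrey_norm_ge.
have [h hP] := galerkin_family_exists nu0 alpha0 si0 si1 tau00 M0 aM.
have gevrey t (t0 : 0 <= t) := solution_gevrey nu0 alpha0 s0 tau00 M0 hP t0.
have sol : gevrey_solution nu alpha s w0 (solution h).
  split.
  - move=> t t0; exists 0, (radius nu alpha tau0 M t).
    by split; [exact: lexx | exact: radius_gt0 | exact: gevrey].
  - exact: solution_regularity nu0 alpha0 si0 tau00 M0 hP.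
  - exact: (solution_initial nu0 alpha0 s0 tau00 M0 hP pw0 iw0 mw0 (fun=> erefl)).
  - by move=> t t0; exact: (solution_equation nu0 alpha0 si0 tau00 M0 hP t0).
exists (solution h); split=> //.
  move=> w' sol' t z t0.
  have [G HG] := solution_gradient nu0 alpha0 si0 tau00 M0 hP.
  exact: (gevrey_solution_unique nu0 alpha0 sol sol' HG).
exists (radius nu alpha tau0 M) => t t0.
have l0 := lm_gt0 alpha nu0.
have E : \int[@lebesgue_measure R]_(sigma in `[0, t])
    expR (- (nu * sigma / (2 + 2 * alpha ^+ 2))) = (1 - expR (- (lm nu alpha * t))) / lm nu alpha.
  rewrite -integral_decay //; congr Rintegral; apply/funext => x.
  by congr (expR (- _)); rewrite /lm mulrAC.
rewrite E; split; [exact: gevrey | exact: lexx |].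
rewrite ler_wpM2l ?(ltW tau00) // ler_expR lerN2.
have -> : 20 * (2 + 2 * alpha ^+ 2) * M / (alpha * nu) = 20 * M / alpha * (lm nu alpha)^-1.
  have a2 : 2 + 2 * alpha ^+ 2 != 0 by rewrite gt_eqF // ltr_wpDr // mulr_ge0 // sqr_ge0.
  by rewrite /lm; field; rewrite a2 !gt_eqF.
apply: ler_wpM2l; first by rewrite divr_ge0 ?mulr_ge0 // ltW.
by rewrite ler_pdivrMr // mulVf ?gt_eqF // gerBl expR_ge0.
Qed.
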